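(* Let $e^{2u_0}|dz|^2$ be a smooth metric on the unit disc $\mathcal{D}\subset\mathbb{C}$ satisfying the upper curvature bound $K[u_0]\leq -1$. For some $T>0$ let $e^{2v(t)}|dz|^2$, $t\in[0,T]$, be an admissible Ricci flow on $\mathcal{D}$ with $v(0)=u_0$. Then $e^{2v(t)}|dz|^2$ is unique among such solutions; that is, if $e^{2\hat v(t)}|dz|^2$, $t\in[0,T]$, is any admissible Ricci flow on $\mathcal{D}$ with $\hat v(0)=u_0$, then $\hat v(t)=v(t)$ for all $t\in[0,T]$.
   Context: Here $z=x+iy$ is the complex coordinate on the unit disc $\mathcal{D}$, $|dz|^2=dx^2+dy^2$, and $K[u]$ denotes the Gauss curvature of the metric $e^{2u}|dz|^2$, i.e. $K[u]=-e^{-2u}\Delta u$ with $\Delta=\frac{\partial^2}{\partial x^2}+\frac{\partial^2}{\partial y^2}$. A Ricci flow on a surface is a family of metrics satisfying $\frac{\partial g}{\partial t}=-2K[g]g$; for $g=e^{2u}|dz|^2$ this is $\frac{\partial u}{\partial t}=e^{-2u}\Delta u=-K[u]$. Definition (admissible). A smooth Ricci flow $g(t)$ on $\mathcal{D}$ for $t\in[0,T]$ is called admissible if: (i) $g(t)$ is complete for $t>0$; (ii) there is a constant $C$ with $K[g]\leq C$ on $[0,T]\times\mathcal{D}$; (iii) for every $\varepsilon\in(0,T]$ there is a constant $C_\varepsilon$ with $K[g]\geq -C_\varepsilon$ on $[\varepsilon,T]\times\mathcal{D}$. *)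

(* Defs.v *)
From mathcomp Require Import all_boot all_order all_algebra.
From mathcomp Require Import all_classical all_reals all_analysis.
Set Implicit Arguments.
Unset Strict Implicit.
Unset Printing Implicit Defensive.
Import Order.TTheory GRing.Theory Num.Theory.
Import numFieldNormedType.Exports.
Local Open Scope classical_set_scope.
Local Open Scope ring_scope.

Section Regularity.
Context {R : realType} {V W : normedModType R}.

(* Only meant for U open and V finite-dimensional. *)
Fixpoint Ck_open (k : nat) (U : set V) (f : V -> W) : Prop :=
  match k with
  | 0 => forall x, U x -> {for x, continuous f}
  | k'.+1 => (forall x, U x -> differentiable f x) /\
             forall h : V, Ck_open k' U (fun x => 'D_h f x)
  end.

(* Regularity on a set S that need not be open (a closed interval, or
   `[0, T] `*` disc): f agrees on S, locally around each point of S, with a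
   function of that regularity on an open set. *)
Definition Ck_on (k : nat) (S : set V) (f : V -> W) : Prop :=
  forall p, S p -> exists (U : set V) (F : V -> W),
    [/\ open U, U p, Ck_open k U F & forall x, S x -> U x -> F x = f x].

Definition smooth_on (S : set V) (f : V -> W) : Prop :=
  forall p, S p -> exists (U : set V) (F : V -> W),
    [/\ open U, U p, (forall k, Ck_open k U F) & forall x, S x -> U x -> F x = f x].

End Regularity.

Section ConformalMetrics.
Context {R : realType}.

(* The complex plane is R * R, with z = x + iy given by z.1 = x, z.2 = y; the
   library norm on R * R is the sup norm, hence the explicit squares. *)
Definition disc : set (R * R) := [set z | z.1 ^+ 2 + z.2 ^+ 2 < 1].

Definition laplacian (u : R * R -> R) (z : R * R) : R :=
  'D_(1, 0) (fun w => 'D_(1, 0) u w) z + 'D_(0, 1) (fun w => 'D_(0, 1) u w) z.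

(* Throughout, a function u : R * R -> R stands for the metric e^{2u}|dz|^2 on
   the disc; its values outside the disc are irrelevant. *)
Definition gauss_curvature (u : R * R -> R) (z : R * R) : R :=
  - expR (- (2 * u z)) * laplacian u z.

Definition piecewise_C1 (c : R -> R * R) : Prop :=
  exists (n : nat) (s : nat -> R), [/\ s 0%N = 0, s n = 1 &
    forall i, (i < n)%N -> s i < s i.+1 /\ Ck_on 1 `[s i, s i.+1] c].

Definition disc_curve (p q : R * R) (c : R -> R * R) : Prop :=
  [/\ piecewise_C1 c, c 0 = p, c 1 = q & forall s : R, s \in `[0, 1] -> disc (c s)].

(* At the finitely many break points of c the value of the integrand is
   arbitrary. *)
Definition curve_length (u : R * R -> R) (c : R -> R * R) : \bar R :=
  (\int[lebesgue_measure]_(s in `[0%R, 1%R])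
     (expR (u (c s)) *
      Num.sqrt (('D_1 c s).1 ^+ 2 + ('D_1 c s).2 ^+ 2))%:E)%E.

Definition riem_dist (u : R * R -> R) (p q : R * R) : \bar R :=
  ereal_inf [set curve_length u c | c in disc_curve p q].

Definition complete_metric (u : R * R -> R) : Prop :=
  forall x : nat -> R * R,
    (forall n, disc (x n)) ->
    (forall e : R, 0 < e -> exists N : nat, forall m n : nat,
       (N <= m)%N -> (N <= n)%N -> (riem_dist u (x m) (x n) < e%:E)%E) ->
    exists2 l, disc l &
      forall e : R, 0 < e -> exists N : nat, forall n : nat,
        (N <= n)%N -> (riem_dist u (x n) l < e%:E)%E.

(* The time derivative is one-sided at t = 0 and t = T. *)
Definition ricci_flow (T : R) (v : R -> R * R -> R) : Prop :=
  smooth_on (`[0, T] `*` disc) (fun p : R * (R * R) => v p.1 p.2) /\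
  forall (t : R) z, t \in `[0, T] -> disc z ->
    (v s z - v t z) / (s - t) @[s --> within `[0, T] t^'] -->
      - gauss_curvature (v t) z.

Definition admissible (T : R) (v : R -> R * R -> R) : Prop :=
  [/\ ricci_flow T v,
      forall t : R, t \in `]0, T] -> complete_metric (v t),
      exists C : R, forall (t : R) z, t \in `[0, T] -> disc z ->
        gauss_curvature (v t) z <= C
    & forall e : R, e \in `]0, T] -> exists C : R, forall (t : R) z,
        t \in `[e, T] -> disc z -> - C <= gauss_curvature (v t) z].

End ConformalMetrics.

(* Main.v *)
(* Write hyp for the conformal factor of the hyperbolic metric of curvature -1.
   By the maximum principle K[u0] <= -1 gives u0 <= hyp, and every flow v from
   u0 satisfies v(t) <= hyp + C; no completeness is needed for this.  If w is
   complete with curvature bounded below, the Schwarz lemma of Yau gives the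
   opposite inequality w >= hyp - C.  For delta > 0 put w(t) = vhat(t + delta).
   Then v - w is bounded above, hyp is an exhaustion of the disc, and
   e^(-2v) Lap hyp <= e^(2(hyp - w)) is bounded wherever v > w, so that the
   maximum principle holds for v - w even though the domain is not compact.
   As v(0) - w(0) = O(delta) by the upper curvature bound, delta -> 0 yields
   v <= vhat, and the roles can be exchanged.

   For Yau's lemma the distance from a point o is replaced by the energy
   E = N sum_i e^(2 w(x_i)) |x_(i+1) - x_i|^2 of chains o = x_0, ..., x_N, and
   one maximises (1 - E) e^(hyp - w)(x_N) over chains; completeness (through a
   Hopf-Rinow argument) keeps chains of energy at most 1 in a compact subset of
   the disc.  A maximum is varied along (i/N) U_i, where U is a discrete
   parallel field, and along the field turned by a right angle.  The sum of the
   two second variations of E is bounded by the lower curvature bound alone,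
   whether or not the chain is close to a geodesic, because the first order
   terms complete to a square that parallelism makes small. *)
Require Import Defs.
From mathcomp Require Import all_boot all_order all_algebra.
From mathcomp Require Import all_classical all_reals all_analysis.
From mathcomp Require Import ring lra.
Set Implicit Arguments.
Unset Strict Implicit.
Unset Printing Implicit Defensive.
Import Order.TTheory GRing.Theory Num.Theory.
Import numFieldNormedType.Exports.
Local Open Scope classical_set_scope.
Local Open Scope ring_scope.

(** * Second order expansions in one variable *)

(** The order of the limits is decisive. The Schwarz constant of vhat(t + delta) depends on the
    lower curvature bound on [delta, T], which may blow up as delta -> 0. It only multiplies the
    coefficient eps of hyp, and eps -> 0 is taken while delta is fixed; what remains is e^(2Ct) C
    delta, where C comes from the upper curvature bound. The factor e^(2Ct) pays for the reaction
    term (1 - e^(-2(v - w))) K[w] <= 2C (v - w), valid where v > w. N is chosen once, from C^2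
    bounds of w on a compact subdisc, and no limit in N is taken. The factor 1 - E acts as a cutoff;
    the constant chain at o has E = 0, so a bound at the maximum is a bound for e^(hyp - w)(o). The
    cutoff radius stays fixed, which gives a constant that is not sharp but finite, and finiteness
    is all the comparison asks for. A parallel field turned by a right angle is again parallel in
    dimension two, and the two directions together make up the Laplacian. *)

Section Jets.
Context {R : realType}.
Implicit Types f g : R -> R.

(** A relation rather than an equation between derivatives: jets of compound functions are then
    derived rule by rule. The second derivative is only asked for at 0, the point where [jet2_max]
    tests it. *)
Definition jet2 f (b c : R) := exists f' : R -> R,
  [/\ \forall t \near (0 : R), is_derive (t : R) 1 f (f' t), f' 0 = b & is_derive (0 : R) 1 f' c].

Lemma jet2_is_derive f b c : jet2 f b c -> is_derive (0 : R) 1 f b.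
Proof. by move=> [f' [/nbhs_singleton df <- _]]. Qed.

Lemma jet2_continuous f b c : jet2 f b c -> {for 0, continuous f}.
Proof.
move=> /jet2_is_derive [df _].
by apply: differentiable_continuous; apply/derivable1_diffP.
Qed.

Lemma jet2_eq f b c b' c' : jet2 f b c -> b = b' -> c = c' -> jet2 f b' c'.
Proof. by move=> jf <- <-. Qed.

Lemma near_eq_jet2 f g b c :
  (\forall t \near (0 : R), f t = g t) -> jet2 f b c -> jet2 g b c.
Proof.
move=> /near_join fg [f' [df fb dfc]]; exists f'; split=> //.
near=> t; apply: (@near_eq_is_derive _ _ _ f); last by near: t.
by near: t; exact: fg.
Unshelve. all: by end_near. Qed.

Lemma jet2_cst (k : R) : jet2 (fun=> k) 0 0.
Proof.
exists (fun=> 0); split=> //; last exact: is_derive_cst.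
by near=> t; exact: is_derive_cst.
Unshelve. all: by end_near. Qed.

Lemma jet2_id : jet2 id 1 0.
Proof.
exists (fun=> 1); split=> //; last exact: is_derive_cst.
by near=> t; exact: is_derive_id.
Unshelve. all: by end_near. Qed.

Lemma jet2D f g b c b' c' : jet2 f b c -> jet2 g b' c' ->
  jet2 (fun t => f t + g t) (b + b') (c + c').
Proof.
move=> [f' [df <- df']] [g' [dg <- dg']]; exists (fun t => f' t + g' t).
split=> //; last exact: is_deriveD.
by near=> t; apply: is_deriveD; near: t.
Unshelve. all: by end_near. Qed.

Lemma jet2M f g b c b' c' : jet2 f b c -> jet2 g b' c' ->
  jet2 (fun t => f t * g t) (b * g 0 + f 0 * b')
    (c * g 0 + 2 * b * b' + f 0 * c').
Proof.
move=> jf jg; move: (jet2_is_derive jf) (jet2_is_derive jg) => df0 dg0.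
move: jf jg => [f' [df fb df']] [g' [dg gb dg']].
exists (fun t => f' t * g t + f t * g' t); split.
- near=> t.
  have dft : is_derive (t : R) 1 f (f' t) by near: t.
  have dgt : is_derive t 1 g (g' t) by near: t.
  by apply: is_derive_eq; rewrite /GRing.scale /= addrC mulrC.
- by rewrite fb gb.
- have := is_deriveD (is_deriveM df' dg0) (is_deriveM df0 dg').
  by move=> /is_derive_eq; apply; rewrite /GRing.scale /= -fb -gb; ring.
Unshelve. all: by end_near. Qed.

Lemma jet2_comp f (h h' : R -> R) (b c d : R) : jet2 f b c ->
  (\forall x \near f 0, is_derive (x : R) 1 h (h' x)) ->
  is_derive (f 0) 1 h' d ->
  jet2 (fun t => h (f t)) (h' (f 0) * b) (d * b ^+ 2 + h' (f 0) * c).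
Proof.
move=> jf dh dh'; move: (jet2_is_derive jf) (jet2_continuous jf) => df0 cf.
move: jf => [f' [df fb df']].
exists (fun t => h' (f t) * f' t); split.
- have dhf : \forall t \near (0 : R), is_derive (f t) 1 h (h' (f t)) by have := cf _ dh.
  near=> t.
  have dft : is_derive (t : R) 1 f (f' t) by near: t.
  have dht : is_derive (f t) 1 h (h' (f t)) by near: t.
  exact: is_derive1_comp.
- by rewrite fb.
- have d1 := is_derive1_comp dh' df0.
  have := is_deriveM d1 df'.
  by move=> /is_derive_eq; apply; rewrite /GRing.scale /= fb; ring.
Unshelve. all: by end_near. Qed.

Lemma jet2_expR f b c : jet2 f b c ->
  jet2 (fun t => expR (f t)) (expR (f 0) * b) (expR (f 0) * (b ^+ 2 + c)).
Proof.
move=> jf.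
have /= := @jet2_comp f expR expR b c (expR (f 0)) jf.
rewrite -mulrDr; apply.
by near=> x; exact: is_derive_expR.
Unshelve. all: by end_near. Qed.

Lemma jet2_ln f b c : jet2 f b c -> 0 < f 0 ->
  jet2 (fun t => ln (f t)) (b / f 0) (c / f 0 - (b / f 0) ^+ 2).
Proof.
move=> jf f0.
have dV : is_derive (f 0) 1 (fun x : R => x^-1) (- (f 0) ^- 2).
  have := @is_deriveV R id (f 0) 1 1 (lt0r_neq0 f0) (is_derive_id _ _).
  by move=> /is_derive_eq; apply; rewrite scaler1.
have dln : \forall x \near f 0, is_derive (x : R) 1 (@ln R) (x^-1).
  by near=> x; apply: is_derive1_ln; near: x; exact: lt_nbhsr.
by apply: (jet2_eq (jet2_comp jf dln dV)); [rewrite mulrC|field; lra].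
Unshelve. all: by end_near. Qed.

Lemma jet2Z f (k b c : R) : jet2 f b c -> jet2 (fun t => k * f t) (k * b) (k * c).
Proof.
by move=> jf; apply: (jet2_eq (jet2M (jet2_cst k) jf)); ring.
Qed.

Lemma jet2B f g b c b' c' : jet2 f b c -> jet2 g b' c' ->
  jet2 (fun t => f t - g t) (b - b') (c - c').
Proof.
move=> jf /(jet2Z (-1)) /(jet2D jf) j.
apply: (near_eq_jet2 _ (jet2_eq j _ _)); rewrite ?mulN1r//.
by near=> t; rewrite mulN1r.
Unshelve. all: by end_near. Qed.

Lemma jet2_sum (n : nat) (F : nat -> R -> R) (b c : nat -> R) :
  (forall i, (i < n)%N -> jet2 (F i) (b i) (c i)) ->
  jet2 (fun t => \sum_(i < n) F i t) (\sum_(i < n) b i) (\sum_(i < n) c i).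
Proof.
elim: n => [_|n IH H].
  rewrite !big_ord0; apply: (near_eq_jet2 _ (jet2_cst 0)).
  by near=> t; rewrite big_ord0.
rewrite !big_ord_recr /=.
apply: (near_eq_jet2 _ (jet2D (IH _) (H n _))) => //.
  by near=> t; rewrite big_ord_recr.
by move=> i /ltnW; exact: H.
Unshelve. all: by end_near. Qed.

(** Fermat's theorem gives b = 0. If c were positive, f' would be positive just to the right of 0,
    and the mean value theorem would push f above f 0. *)
Lemma jet2_max f b c : jet2 f b c -> (\forall t \near (0 : R), f t <= f 0) ->
  b = 0 /\ c <= 0.
Proof.
move=> [f' [df fb df']] fmax.
have [e /= e0 He] : exists2 e : R, 0 < e & forall t, `|t| < e ->
    is_derive (t : R) 1 f (f' t) /\ f t <= f 0.
  have /nbhs_ballP[e /= e0 He] :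
      \forall t \near (0 : R), is_derive (t : R) 1 f (f' t) /\ f t <= f 0.
    by near=> t; split; near: t.
  by exists e => // t te; apply: He; rewrite /ball /= sub0r normrN.
have b0 : b = 0.
  have : is_derive (0 : R) 1 f 0.
    apply: (@derive1_at_max _ f (- e) e).
    - by lra.
    - by move=> t; rewrite in_itv /= => te; have [] := He t _; rewrite ?ltr_norml.
    - by rewrite in_itv /=; lra.
    - by move=> t; rewrite in_itv /= => te; have [] := He t _; rewrite ?ltr_norml.
  move=> /@derive_val d0.
  have /@derive_val : is_derive (0 : R) 1 f (f' 0).
    by have [] := He 0 _; rewrite ?normr0.
  by rewrite d0 fb.
split=> //; rewrite leNgt; apply/negP => c0.
have lc : h^-1 *: (f' (h *: (1 : R) + 0) - f' 0) @[h --> 0^'] --> c.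
  by case: df' => df' <-; exact: df'.
have /nbhs_ballP[d /= d0 Hd] :
    \forall h \near 0^', 0 < h^-1 *: (f' (h *: (1 : R) + 0) - f' 0).
  by apply: (cvgr_gt c).
pose t := Num.min d e / 2.
have t0 : 0 < t by rewrite divr_gt0// lt_min d0.
have td : t < d by rewrite ltr_pdivrMr// gt_min; apply/orP; left; lra.
have te : t < e by rewrite ltr_pdivrMr// gt_min; apply/orP; right; lra.
have f'pos s : 0 < s <= t -> 0 < f' s.
  move=> /andP[s0 st].
  have := Hd s; rewrite /ball /= sub0r normrN gtr0_norm// => /(_ _ _).
  rewrite fb b0 subr0 addr0 [s *: 1]mulr1 pmulr_rgt0 ?invr_gt0//.
  by apply; rewrite ?gt_eqF//; lra.
have [||s /[!in_itv]/= /andP[s0 st] Hs] := @MVT R f f' 0 t t0.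
- move=> x; rewrite in_itv /= => /andP[x0 xt].
  by have [] := He x _ => //; rewrite gtr0_norm//; lra.
- apply: derivable_within_continuous => x; rewrite in_itv /= => /andP[x0 xt].
  have xe : `|x| < e by rewrite ger0_norm//; lra.
  by case: (He x xe) => -[].
have [|_] := He t; first by rewrite gtr0_norm.
rewrite -subr_le0 Hs subr0 leNgt => /negP; apply.
by rewrite mulr_gt0// f'pos// s0 ltW.
Unshelve. all: by end_near. Qed.

(** Differentiates piecewise quadratic functions such as [sqp] at their junction points without
    one-sided limits. *)
Lemma is_derive_quadratic_error f (t L K : R) :
  (forall h, `|f (t + h) - f t - h * L| <= K * h ^+ 2) -> is_derive t 1 f L.
Proof.
move=> H.
have : h^-1 *: (f (h *: (1 : R) + t) - f t) @[h --> 0^'] --> L.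
  apply/cvgrPdist_le => e e0; near=> h.
  have h0 : h != 0 by near: h; exact: nbhs_dnbhs_neq.
  have -> : L - h^-1 *: (f (h *: (1 : R) + t) - f t) =
            - (f (t + h) - f t - h * L) / h.
    rewrite [h *: (1 : R)]mulr1 [h^-1 *: _]mulrC (addrC h); field.
    exact: h0.
  rewrite normrM normrN normfV ler_pdivrMr ?normr_gt0//.
  apply: (le_trans (H h)).
  rewrite -(real_normK (num_real h)) expr2 mulrA ler_wpM2r//.
  have he : `|h| <= e / (`|K| + 1).
    near: h; apply: dnbhs0_le; apply: divr_gt0 => //; exact: ltr_wpDl.

  apply: (@le_trans _ _ ((`|K| + 1) * `|h|)).
    by apply: ler_wpM2r => //; rewrite (le_trans (ler_norm _))// lerDl.
  by rewrite mulrC -ler_pdivlMr// ltr_wpDl.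
move=> cv; split; first by apply/cvg_ex; exists L.
exact: (cvg_lim _ cv).
Unshelve. all: by end_near. Qed.

(* [sqp] is of class C^1, which makes it usable for gluing curves and for bumps. *)
Definition sqp (s : R) : R := Num.max s 0 ^+ 2.

Lemma is_derive_sqp (s : R) : is_derive s 1 sqp (2 * Num.max s 0).
Proof.
apply: (@is_derive_quadratic_error _ _ _ 1) => h; rewrite /sqp mul1r.
rewrite ler_norml; case: (leP 0 (s + h)) => sh; case: (leP 0 s) => s0;
  apply/andP; split; nra.
Qed.

End Jets.

(** * Functions of class C^2 on the disc *)
Section Plane.
Context {R : realType}.
Implicit Types (w : R * R -> R) (z V : R * R).

Definition nsq z : R := z.1 ^+ 2 + z.2 ^+ 2.

Definition ray z V (t : R) : R * R := (z.1 + t * V.1, z.2 + t * V.2).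

Lemma nsq_ge0 z : 0 <= nsq z.
Proof. by rewrite addr_ge0// sqr_ge0. Qed.

Lemma continuous_nsq : continuous nsq.
Proof.
have -> : nsq = fun z => z.1 * z.1 + z.2 * z.2.
  by apply/funext => z; rewrite /nsq !expr2.
by move=> z; apply: cvgD; apply: cvgM; by [exact: cvg_fst|exact: cvg_snd].
Qed.

Lemma open_disc : open (@disc R).
Proof.
have -> : disc = nsq @^-1` [set x : R | x < 1] by [].
apply: open_comp; last exact: open_lt.
by move=> z _; apply: continuous_nsq.
Qed.

Lemma continuous_pair (T U U' : topologicalType) (f : T -> U) (g : T -> U') x :
  f @ x --> f x -> g @ x --> g x -> {for x, continuous (fun x => (f x, g x))}.
Proof.
by move=> cf cg; apply: (@cvg_pair _ _ _ _ (nbhs (f x)) (nbhs (g x))).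
Qed.

Lemma continuous_ray z V : continuous (ray z V).
Proof.
move=> t; have c1 (a b : R) : (fun s => a + s * b) @ t --> a + t * b.
  by apply: cvgD; [exact: cvg_cst|apply: cvgM; [exact: cvg_id|exact: cvg_cst]].
exact: (continuous_pair (c1 _ _) (c1 _ _)).
Qed.

Lemma ray0 z V : ray z V 0 = z.
Proof. by case: z => a b; rewrite /ray /= !mul0r !addr0. Qed.

Lemma near_ray_disc z V : disc z -> \forall t \near (0 : R), disc (ray z V t).
Proof.
move=> dz; apply: (@continuous_ray z V 0); rewrite ray0.
by apply: open_nbhs_nbhs; split=> //; exact: open_disc.
Qed.

(** Directional derivatives that are linear in the direction, plus continuity: restrictions to lines
    are all that the second derivative tests look at. *)
Definition C1disc w (w1 w2 : R * R -> R) := forall z, disc z ->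
  {for z, continuous w} /\
  forall V, is_derive (0 : R) 1 (fun t => w (ray z V t)) (V.1 * w1 z + V.2 * w2 z).

(** The two mixed derivatives are separate fields. Along a ray only their sum occurs, so their
    symmetry never has to be proved. *)
Record C2disc w := C2Disc {
  dx : R * R -> R;
  dy : R * R -> R;
  dxx : R * R -> R;
  dxy : R * R -> R;
  dyx : R * R -> R;
  dyy : R * R -> R;
  C1_fun : C1disc w dx dy;
  C1_dx : C1disc dx dxx dxy;
  C1_dy : C1disc dy dyx dyy;
  continuous_dxx : forall z, disc z -> {for z, continuous dxx};
  continuous_dxy : forall z, disc z -> {for z, continuous dxy};
  continuous_dyx : forall z, disc z -> {for z, continuous dyx};
  continuous_dyy : forall z, disc z -> {for z, continuous dyy};
  laplacianE : forall z, disc z -> laplacian w z = dxx z + dyy z }.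

Lemma is_derive_ray w w1 w2 z V (t : R) : C1disc w w1 w2 -> disc (ray z V t) ->
  is_derive t 1 (fun t => w (ray z V t))
    (V.1 * w1 (ray z V t) + V.2 * w2 (ray z V t)).
Proof.
move=> H dz; have [_ /(_ V) dw] := H _ dz.
have dg : is_derive t 1 (fun s => s - t) 1.
  have := is_deriveB (is_derive_id t (1 : R)) (is_derive_cst t t (1 : R)).
  by rewrite subr0.
have dw' : is_derive (t - t) 1 (fun s => w (ray (ray z V t) V s))
    (V.1 * w1 (ray z V t) + V.2 * w2 (ray z V t)) by rewrite subrr.
have := @is_derive1_comp _ _ (fun s => s - t) t _ _ dw' dg; rewrite mulr1; congr (is_derive _ _ _ _).
by apply/funext => s /=; congr (w _); rewrite /ray /=; congr pair; ring.
Qed.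

Lemma jet2_ray w (W : C2disc w) z V : disc z ->
  jet2 (fun t => w (ray z V t)) (V.1 * dx W z + V.2 * dy W z)
   (V.1 ^+ 2 * dxx W z + V.1 * V.2 * (dxy W z + dyx W z) + V.2 ^+ 2 * dyy W z).
Proof.
move=> dz; exists (fun t => V.1 * dx W (ray z V t) + V.2 * dy W (ray z V t)).
split.
- near=> t; apply: (is_derive_ray (C1_fun W)).
  by near: t; exact: near_ray_disc.
- by rewrite ray0.
- have [_ /(_ V) d1] := C1_dx W dz; have [_ /(_ V) d2] := C1_dy W dz.
  have := is_deriveD (is_deriveZ V.1 d1) (is_deriveZ V.2 d2).
  by move=> /is_derive_eq; apply; rewrite /GRing.scale /=; ring.
Unshelve. all: by end_near. Qed.

End Plane.

(** * Regularity of the time slices of a flow *)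

Section Regularity.
Context {R : realType}.
Implicit Types (w : R * R -> R) (z V : R * R).

Lemma continuous_slice (t : R) : continuous (fun z : R * R => (t, z)).
Proof.
move=> z; have ct : (fun=> t) @ z --> t by exact: cvg_cst.
exact: (continuous_pair ct (@cvg_id _ (nbhs z))).
Qed.

Lemma derive_slice (F : R * (R * R) -> R) (t : R) (V : R * R) :
  'D_V (fun z => F (t, z)) = fun z => 'D_(0, V) F (t, z).
Proof.
apply/funext => z; rewrite /derive.
apply: (congr1 (fun G : R -> R => lim (G @ (0 : R)^'))); apply/funext => h /=; congr (_ *: (F _ - _)).
by rewrite [RHS]surjective_pairing /= scaler0 add0r.
Qed.

Lemma Ck_open_slice (k : nat) (U : set (R * (R * R))) (F : R * (R * R) -> R)
  (t : R) : Ck_open k U F ->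
  Ck_open k [set z | U (t, z)] (fun z => F (t, z)).
Proof.
elim: k F => [|k IH] F /=.
  move=> H z /H cF; apply: (@continuous_comp _ _ _ (fun z : R * R => (t, z)) F) => //.
  by apply: continuous_slice.
move=> [dF H]; split; last by move=> V; rewrite derive_slice; exact: (IH ('D_(0, V) F) (H _)).
move=> z /dF dFz; apply: (@differentiable_comp _ _ _ _ (fun z : R * R => (t, z)) F) => //.
Qed.

Definition locally_C2 w := forall z, disc z -> exists (U : set (R * R)) F,
  [/\ open U, U z, Ck_open 2 U F & forall x, disc x -> U x -> F x = w x].

Lemma smooth_on_slice (T : R) (v : R -> R * R -> R) (t : R) :
  smooth_on (`[0, T] `*` disc) (fun p : R * (R * R) => v p.1 p.2) ->
  t \in `[0, T] -> locally_C2 (v t).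
Proof.
move=> H tT z dz; have [|U [F [oU Uz /(_ 2%N) CF FE]]] := H (t, z).
  by split.
exists [set z | U (t, z)], (fun z => F (t, z)); split => //.
- have -> : [set z | U (t, z)] = (fun z : R * R => (t, z)) @^-1` U by [].
  by apply: open_comp => // x _; exact: continuous_slice.
- exact: Ck_open_slice.
- by move=> x dx Ux; apply: (FE (t, x)).
Qed.

Lemma derive_plane (F : R * R -> R) z V : differentiable F z ->
  'D_V F z = V.1 * 'D_(1, 0) F z + V.2 * 'D_(0, 1) F z.
Proof.
move=> dF; rewrite !deriveE//.
have E : V = V.1 *: (1, 0) + V.2 *: (0, 1) :> R * R.
  rewrite [RHS]surjective_pairing /= !scaler0 addr0 add0r.
  by rewrite [_ *: _]mulr1 [_ *: _]mulr1 -surjective_pairing.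
by rewrite {1}E linearD !linearZ.
Qed.

Lemma is_derive_along w z V : derivable w z V ->
  is_derive (0 : R) 1 (fun t => w (ray z V t)) ('D_V w z).
Proof.
move=> dw.
have E : (fun h : R => h^-1 *: ((fun t => w (ray z V t)) (h *: (1 : R) + 0) -
      w (ray z V 0))) = (fun h : R => h^-1 *: (w (h *: V + z) - w z)).
  apply/funext => h; rewrite ray0 addr0 [h *: (1 : R)]mulr1; congr (_ *: (w _ - _)).
  by case: z V dw => a b [c d] _; rewrite addrC.
split; first by rewrite /derivable /= E.
by rewrite /derive /= E.
Qed.

Lemma differentiable_C1disc w z : differentiable w z ->
  {for z, continuous w} /\
  forall V, is_derive (0 : R) 1 (fun t => w (ray z V t))
    (V.1 * 'D_(1, 0) w z + V.2 * 'D_(0, 1) w z).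
Proof.
move=> dw; split; first exact: differentiable_continuous.
by move=> V; rewrite -derive_plane//; apply: is_derive_along; exact: diff_derivable.
Qed.

Lemma near_eq_continuous (F w : R * R -> R) z :
  (\near z, F z = w z) -> {for z, continuous F} -> {for z, continuous w}.
Proof.
move=> Fw cF; rewrite /prop_for /continuous_at -(nbhs_singleton Fw).
by apply: cvg_trans cF; exact: near_eq_cvg.
Qed.

Lemma near_eq_C1disc (F w : R * R -> R) z :
  (\near z, F z = w z) -> differentiable F z ->
  {for z, continuous w} /\
  forall V, is_derive (0 : R) 1 (fun t => w (ray z V t))
    (V.1 * 'D_(1, 0) w z + V.2 * 'D_(0, 1) w z).
Proof.
move=> Fw dF; have [cF H] := differentiable_C1disc dF; split.
  exact: near_eq_continuous cF.
move=> V; have := H V; rewrite !(near_eq_derive _ Fw); apply: near_eq_is_derive.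
have nFw : nbhs (ray z V 0) [set x | F x = w x] by rewrite ray0.
exact: (@continuous_ray _ z V 0 _ nFw).
Qed.

Lemma near_eq_near_derive (F G : R * R -> R) z V :
  (\forall x \near z, F x = G x) -> \forall x \near z, 'D_V F x = 'D_V G x.
Proof.
by move=> /near_join FG; near=> x; apply: near_eq_derive; near: x.
Unshelve. all: by end_near. Qed.

(** The disc is open, so a local extension coincides with [w] near [z] and so do the iterated
    derivatives. The fields can therefore be the derivatives of [w] itself, which makes [laplacianE]
    hold by definition. *)
Lemma locally_C2_C2disc w : locally_C2 w -> C2disc w.
Proof.
move=> H.
have {}H z : disc z -> exists F, [/\ \forall x \near z, F x = w x,
   differentiable F z, forall V, differentiable ('D_V F) z &
   forall V V', {for z, continuous ('D_V' ('D_V F))}].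
  move=> dz; have [U [F [oU Uz [dF CF] FE]]] := H z dz; exists F; split.
  - have nU : nbhs z U by exact: open_nbhs_nbhs.
    have nd : nbhs z disc by apply: open_nbhs_nbhs; split=> //; exact: open_disc.
    by near=> x; apply: FE; near: x.
  - exact: dF.
  - by move=> V; have [dV _] := CF V; exact: (dV z Uz).
  - by move=> V V'; have [_ +] := CF V; move=> /(_ V' z Uz).
apply: (@C2Disc _ w ('D_(1, 0) w) ('D_(0, 1) w)
  ('D_(1, 0) ('D_(1, 0) w)) ('D_(0, 1) ('D_(1, 0) w))
  ('D_(1, 0) ('D_(0, 1) w)) ('D_(0, 1) ('D_(0, 1) w))).
- move=> z /H [F [Fw dF _ _]]; exact: near_eq_C1disc dF.
- move=> z /H [F [Fw _ dF _]]; apply: near_eq_C1disc (dF (1, 0)); exact: near_eq_near_derive.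
- move=> z /H [F [Fw _ dF _]]; apply: near_eq_C1disc (dF (0, 1)); exact: near_eq_near_derive.
- move=> z /H [F [Fw _ _ dF]]; apply: near_eq_continuous (dF _ _).
  by apply: near_eq_near_derive; exact: near_eq_near_derive.
- move=> z /H [F [Fw _ _ dF]]; apply: near_eq_continuous (dF _ _).
  by apply: near_eq_near_derive; exact: near_eq_near_derive.
- move=> z /H [F [Fw _ _ dF]]; apply: near_eq_continuous (dF _ _).
  by apply: near_eq_near_derive; exact: near_eq_near_derive.
- move=> z /H [F [Fw _ _ dF]]; apply: near_eq_continuous (dF _ _).
  by apply: near_eq_near_derive; exact: near_eq_near_derive.
- by [].
Unshelve. all: by end_near. Qed.

End Regularity.

(** * Bounds for the distance of a conformal metric *)
Section IntegralBound.
Context {R : realType}.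

Lemma continuous_within_in (f : R -> R) (a b x y : R) :
  {in `]a, b[, continuous f} -> a < x -> y < b ->
  {within `[x, y], continuous f}.
Proof.
move=> cf ax yb; apply: continuous_in_subspaceT => s.
rewrite inE /= in_itv /= => /andP[xs sy]; apply: cf.
by rewrite in_itv /= (lt_le_trans ax)//= (le_lt_trans sy).
Qed.

(** The derivative of a curve is uncontrolled at the ends of a piece. Hence the fundamental theorem
    of calculus is used on some [x, y] inside ]a, b[, and the ends are reached by continuity of
    [Psi]. *)
Lemma increment_le_integral (g Psi Psi' : R -> R) (a b : R) : a < b ->
  {in `]a, b[, forall s : R, is_derive s 1 Psi (Psi' s)} ->
  {in `]a, b[, continuous Psi'} -> {in `]a, b[, continuous g} ->
  {in `]a, b[, forall s, Psi' s <= g s} -> (forall s, 0 <= g s) ->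
  {within `[a, b], continuous Psi} ->
  ((Psi b - Psi a)%:E <= \int[lebesgue_measure]_(s in `]a, b[) (g s)%:E)%E.
Proof.
move=> ab dPsi cPsi' cg Psi'g g0 cPsi.
have compact_le x y : a < x -> x < y -> y < b ->
    ((Psi y - Psi x)%:E <= \int[lebesgue_measure]_(s in `]a, b[) (g s)%:E)%E.
  move=> ax xy yb.
  have xyab s : s \in `[x, y] -> s \in `]a, b[.
    rewrite !in_itv /= => /andP[xs sy].
    by rewrite (lt_le_trans ax)//= (le_lt_trans sy).
  have sub : `[x, y]%classic `<=` `]a, b[%classic by move=> s /= /xyab.
  have cPsi1 : {within `[x, y], continuous Psi'} by exact: continuous_within_in cPsi' _ _.
  have cg1 : {within `[x, y], continuous g} by exact: continuous_within_in cg _ _.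
  have -> : ((Psi y - Psi x)%:E = \int[lebesgue_measure]_(s in `[x, y]) (Psi' s)%:E)%E.
    rewrite (@continuous_FTC2 _ Psi' Psi x y xy cPsi1).
    - by rewrite EFinB.
    - split.
      + move=> s sxy; apply: (@ex_derive _ _ _ _ _ _ (Psi' s)).
        by apply/dPsi/xyab/subset_itv_oo_cc.
      + apply: cvg_at_right_filter.
        apply: differentiable_continuous; apply/derivable1_diffP.
        apply: (@ex_derive _ _ _ _ _ _ (Psi' x)).
        by apply/dPsi/xyab; rewrite in_itv /= lexx ltW.
      + apply: cvg_at_left_filter.
        apply: differentiable_continuous; apply/derivable1_diffP.
        apply: (@ex_derive _ _ _ _ _ _ (Psi' y)).
        by apply/dPsi/xyab; rewrite in_itv /= lexx ltW.
    - move=> s sxy; rewrite derive1E; apply: derive_val.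
      by apply/dPsi/xyab/subset_itv_oo_cc.
  apply: (@le_trans _ _ (\int[lebesgue_measure]_(s in `[x, y]) (g s)%:E)%E).
    apply: le_integral => //.
    - by apply: continuous_compact_integrable => //; exact: segment_compact.
    - by apply: continuous_compact_integrable => //; exact: segment_compact.
    - by move=> s; rewrite inE => /xyab sab; rewrite lee_fin Psi'g.
  apply: ge0_subset_integral => //.
  - apply/measurable_realfun.measurable_EFinP; apply: measurable_realfun.open_continuous_measurable_fun.
      exact: interval_open.
    by move=> s; rewrite inE; exact: cg.
  - by move=> s _; rewrite lee_fin.
have [_ ca cb] := (continuous_within_itvP Psi ab).1 cPsi.
apply/lee_addgt0Pr => e e0.
have [x ax xmid] : exists2 x, a < x < (a + b) / 2 & `|Psi a - Psi x| <= e / 2.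
  have H : \forall x \near a^'+, `|Psi a - Psi x| <= e / 2.
    by have /cvgrPdist_le := ca; apply; exact: divr_gt0.
  have H2 : \forall x \near a^'+, a < x < (a + b) / 2.
    near=> x; apply/andP; split => //.
    by near: x; apply: nbhs_right_lt; lra.
  near a^'+ => u; exists u.
    by near: u.
  by near: u.
have [y yb ymid] : exists2 y, (a + b) / 2 < y < b & `|Psi b - Psi y| <= e / 2.
  have H : \forall x \near b^'-, `|Psi b - Psi x| <= e / 2.
    by have /cvgrPdist_le := cb; apply; exact: divr_gt0.
  have H2 : \forall x \near b^'-, (a + b) / 2 < x < b.
    near=> u; apply/andP; split => //.
    by near: u; apply: nbhs_left_gt; lra.
  near b^'- => u; exists u.
    by near: u.
  by near: u.
have {}H : ((Psi y - Psi x)%:E <= \int[lebesgue_measure]_(s in `]a, b[) (g s)%:E)%E.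
  by apply: compact_le; lra.
apply: le_trans (leeD2r e%:E H); rewrite -EFinD lee_fin.
by move: xmid ymid; rewrite !ler_norml; lra.
Unshelve. all: by end_near. Qed.

Lemma increment_le_integral_pieces (g Psi Psi' : R -> R) (n : nat) (s : nat -> R) :
  (forall i, (i < n)%N -> s i < s i.+1 /\
    [/\ {in `]s i, s i.+1[, forall x : R, is_derive x 1 Psi (Psi' x)},
        {in `]s i, s i.+1[, continuous Psi'},
        {in `]s i, s i.+1[, continuous g},
        {in `]s i, s i.+1[, forall x, Psi' x <= g x} &
        {within `[s i, s i.+1], continuous Psi}]) ->
  (forall x, 0 <= g x) ->
  ((Psi (s n) - Psi (s 0%N))%:E <=
    \int[lebesgue_measure]_(x in `[s 0%N, s n]) (g x)%:E)%E.
Proof.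
move=> H g0.
(* Measurability of [g] and s 0 <= s n are carried through the induction, since splitting the
   integral at s n requires them. *)
suff : (measurable_fun `[s 0%N, s n] g /\ s 0%N <= s n) /\
    ((Psi (s n) - Psi (s 0%N))%:E <=
    \int[lebesgue_measure]_(x in `[s 0%N, s n]) (g x)%:E)%E by case.
elim: n H => [|n IH] H.
  split; last first.
    by rewrite subrr; apply: integral_ge0 => x _; rewrite lee_fin.
  split=> //; rewrite set_itv1; exact: measurable_fun_set1.
have [|[mg s0n] IHle] := IH; first by move=> i /ltnW; exact: H.
have [sn [dPsi cPsi' cg Psi'g cPsi]] := H n (ltnSn n).
have mgoo : measurable_fun `]s n, s n.+1[ g.
  apply: measurable_realfun.open_continuous_measurable_fun.
    exact: interval_open.
  by move=> x; rewrite inE; exact: cg.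
have mgU : measurable_fun (`[s 0%N, s n] `|` `]s n, s n.+1[) g.
  by apply/measurable_funU.
have E : `[s 0%N, s n.+1]%classic =
    (`[s 0%N, s n] `|` `]s n, s n.+1[) `|` [set s n.+1].
  apply/seteqP; split=> x /=; rewrite !in_itv /=.
    move=> /andP[x0]; rewrite le_eqVlt => /predU1P[->|xn]; first by right.
    left; rewrite x0 xn andbT /=.
    by have [xs|xs] := leP x (s n); [left|right].
  case=> [[/andP[-> /= xs]|/andP[xs xs']]|->].
  - by rewrite (le_trans xs)// ltW.
  - by rewrite (le_trans s0n (ltW xs))//= ltW.
  - by rewrite lexx andbT (le_trans s0n)// ltW.
have mgS : measurable_fun `[s 0%N, s n.+1] g.
  rewrite E; apply/measurable_funU => //.
    exact: measurableU.
  by split=> //; exact: measurable_fun_set1.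
split; first by split=> //; rewrite (le_trans s0n)// ltW.
apply: (@le_trans _ _ (\int[lebesgue_measure]_(x in `[s 0%N, s n] `|` `]s n, s n.+1[)
    (g x)%:E)%E); last first.
  apply: ge0_subset_integral => //.
  - exact: measurableU.
  - exact/measurable_realfun.measurable_EFinP.
  - by move=> x _; rewrite lee_fin.
  - by rewrite E; exact: subsetUl.
rewrite ge0_integral_setU//; last 3 first.
  - exact/measurable_realfun.measurable_EFinP.
  - by move=> x _; rewrite lee_fin.
  - apply/disj_setPS => x /= []; rewrite !in_itv /= => /andP[_ xs] /andP[sx _].
    by move: (lt_le_trans sx xs); rewrite ltxx.
have -> : Psi (s n.+1) - Psi (s 0%N) = (Psi (s n) - Psi (s 0%N)) +
   (Psi (s n.+1) - Psi (s n)) by ring.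
rewrite EFinD; apply: leeD => //.
exact: increment_le_integral dPsi cPsi' cg Psi'g g0 cPsi.
Qed.

End IntegralBound.

(** * Lower bounds for lengths of curves *)

Section CurveLowerBound.
Context {R : realType}.
Implicit Types (w : R * R -> R) (c : R -> R * R) (z : R * R).

Definition sqdist z l : R := (z.1 - l.1) ^+ 2 + (z.2 - l.2) ^+ 2.

Lemma nbhs_sqdist (P : set (R * R)) l : nbhs l P ->
  exists2 r : R, 0 < r & forall z, sqdist z l < r -> P z.
Proof.
move=> /nbhs_ballP[e /= e0 H]; exists (e ^+ 2); first exact: exprn_gt0.
move=> z zl; apply: H; rewrite /ball /= /prod_ball /ball /=.
have abs_lt (a b : R) : a ^+ 2 + b ^+ 2 < e ^+ 2 -> `|a| < e.
  move=> ab; rewrite ltr_norml; apply/andP; split; nra.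
split; rewrite distrC.
  exact: abs_lt zl.
by apply: (@abs_lt _ (z.1 - l.1)); rewrite addrC.
Qed.

Lemma Ck_on_interior c (a b s : R) : Ck_on 1 `[a, b] c -> s \in `]a, b[ ->
  derivable c s 1 /\ {for s, continuous ('D_1 c)}.
Proof.
move=> H sab; have [|U [F [oU Us [dF CF] FE]]] := H s.
  exact: subset_itv_oo_cc.
have Fc : \forall x \near s, F x = c x.
  have nU : nbhs s U by exact: open_nbhs_nbhs.
  have nab : nbhs s `]a, b[%classic.
    by apply: open_nbhs_nbhs; split=> //; exact: interval_open.
  near=> x; apply: FE; last by near: x.
  by apply: subset_itv_oo_cc; near: x.
split.
  apply: (near_eq_derivable Fc); apply: diff_derivable; exact: dF.
have DFc : \forall x \near s, 'D_1 F x = 'D_1 c x.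
  move/near_join : Fc => Fc; near=> x.
  by apply: near_eq_derive; near: x.
have := CF 1 s Us; rewrite /prop_for /continuous_at (nbhs_singleton DFc) => cF.
by apply: cvg_trans cF; exact: near_eq_cvg.
Unshelve. all: by end_near. Qed.

Lemma Ck_on_within c (a b : R) : Ck_on 1 `[a, b] c -> {within `[a, b], continuous c}.
Proof.
move=> H; apply/subspace_continuousP => s sab.
have [U [F [oU Us [dF CF] FE]]] := H s sab.
have cF : F @ s --> F s by apply: differentiable_continuous; exact: dF.
rewrite (FE s sab Us) in cF.
have H1 : F @ within `[a, b]%classic (nbhs s) --> c s by exact: cvg_within_filter.
apply: cvg_trans H1; apply: near_eq_cvg.
have nU : nbhs s U by exact: open_nbhs_nbhs.
by apply: filterS nU => x Ux xab; apply: FE.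
Qed.

Lemma is_derive_fst_snd c (s : R) : derivable c s 1 ->
  is_derive s 1 (fun s => (c s).1) ('D_1 c s).1 /\
  is_derive s 1 (fun s => (c s).2) ('D_1 c s).2.
Proof.
move=> dc.
have d1 : (fun h : R => h^-1 *: (c (h *: (1 : R) + s) - c s)) @ (0 : R)^' --> 'D_1 c s.
  exact: dc.
have e1 : (fun h : R => h^-1 *: ((c (h *: (1 : R) + s)).1 - (c s).1)) @ (0 : R)^'
     --> ('D_1 c s).1.
  have cf : fst @ 'D_1 c s --> ('D_1 c s).1 by exact: cvg_fst.
  exact: (@cvg_comp _ _ _ _ fst _ _ _ d1 cf).
have e2 : (fun h : R => h^-1 *: ((c (h *: (1 : R) + s)).2 - (c s).2)) @ (0 : R)^'
     --> ('D_1 c s).2.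
  have cf : snd @ 'D_1 c s --> ('D_1 c s).2 by exact: cvg_snd.
  exact: (@cvg_comp _ _ _ _ snd _ _ _ d1 cf).
split; (split; last by apply: cvg_lim); apply/cvg_ex; eexists; [exact: e1|exact: e2].
Qed.

Lemma continuous_sqdist l : continuous (fun z => sqdist z l).
Proof.
have -> : (fun z => sqdist z l) =
    fun z => (z.1 - l.1) * (z.1 - l.1) + (z.2 - l.2) * (z.2 - l.2).
  by apply/funext => z; rewrite /sqdist !expr2.
move=> z; have c1 : (fun z => z.1 - l.1) @ z --> z.1 - l.1.
  by apply: cvgB; [exact: cvg_fst|exact: cvg_cst].
have c2 : (fun z => z.2 - l.2) @ z --> z.2 - l.2.
  by apply: cvgB; [exact: cvg_snd|exact: cvg_cst].
exact: cvgD (cvgM c1 c1) (cvgM c2 c2).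
Qed.

(* [bump l r] composed with a curve changes by at most a constant times the
   length of the part of the curve near [l], so it detects d-convergence to [l]. *)
Definition bump l (r : R) z : R := sqp (r - sqdist z l).

Lemma continuous_bump l r : continuous (bump l r).
Proof.
move=> z; have c1 : (fun z => r - sqdist z l) @ z --> r - sqdist z l.
  by apply: cvgB; [exact: cvg_cst|exact: continuous_sqdist].
have c2 : {for r - sqdist z l, continuous (@sqp R)}.
  apply: differentiable_continuous; apply/derivable1_diffP.
  by have [] := is_derive_sqp (r - sqdist z l).
exact: (@cvg_comp _ _ _ _ (@sqp R) _ _ _ c1 c2).
Qed.

Lemma is_derive_bump c l r (s : R) : derivable c s 1 ->
  is_derive s 1 (fun s => bump l r (c s))
    (2 * Num.max (r - sqdist (c s) l) 0 *
     - (2 * (((c s).1 - l.1) * ('D_1 c s).1 + ((c s).2 - l.2) * ('D_1 c s).2))).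
Proof.
move=> /is_derive_fst_snd [dX dY].
have dq : is_derive s 1 (fun s => r - sqdist (c s) l)
    (- (2 * (((c s).1 - l.1) * ('D_1 c s).1 + ((c s).2 - l.2) * ('D_1 c s).2))).
  have d1 := is_deriveB dX (is_derive_cst l.1 s (1 : R)).
  have d2 := is_deriveB dY (is_derive_cst l.2 s (1 : R)).
  have := is_deriveB (is_derive_cst r s (1 : R))
     (is_deriveD (is_deriveM d1 d1) (is_deriveM d2 d2)).
  move=> /is_derive_eq => /(_ (- (2 * (((c s).1 - l.1) * ('D_1 c s).1 + ((c s).2 - l.2) * ('D_1 c s).2)))).
  rewrite (_ : (cst r - _) = (fun s => r - sqdist (c s) l)).
    by apply; rewrite !fctE /GRing.scale /=; ring.
  by apply/funext => x; rewrite /sqdist !expr2.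
exact: (@is_derive1_comp _ _ _ _ _ _ (is_derive_sqp _) dq).
Qed.

(** The 4 is 2 * 2, from the square in [sqp] and the square in [sqdist]; r <= 1 bounds both the
    height r - d and, by Cauchy-Schwarz, the radial component. *)
Lemma bump_slope_le c l r (s : R) : r <= 1 ->
  `|2 * Num.max (r - sqdist (c s) l) 0 *
     - (2 * (((c s).1 - l.1) * ('D_1 c s).1 + ((c s).2 - l.2) * ('D_1 c s).2))|
  <= if sqdist (c s) l < r then
     4 * Num.sqrt (('D_1 c s).1 ^+ 2 + ('D_1 c s).2 ^+ 2) else 0.
Proof.
move=> r1; case: ifPn => [cr|]; last first.
  by rewrite -leNgt => cr; rewrite max_r ?subr_le0// mulr0 mul0r normr0.
rewrite max_l; last by rewrite subr_ge0 ltW.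
set a := (c s).1 - l.1; set b := (c s).2 - l.2.
set a' := ('D_1 c s).1; set b' := ('D_1 c s).2; set d := sqdist _ _.
have d0 : 0 <= d by rewrite addr_ge0// sqr_ge0.
have -> : 2 * (r - d) * - (2 * (a * a' + b * b')) =
   - (4 * (r - d) * (a * a' + b * b')) by ring.
rewrite normrN normrM ger0_norm; last by rewrite mulr_ge0// subr_ge0 ltW.
have CS : `|a * a' + b * b'| <= Num.sqrt (a' ^+ 2 + b' ^+ 2).
  rewrite -sqrtr_sqr ler_wsqrtr//.
  have : d * (a' ^+ 2 + b' ^+ 2) <= a' ^+ 2 + b' ^+ 2.
    rewrite ler_piMl ?addr_ge0 ?sqr_ge0//.
    by rewrite (le_trans (ltW cr)).
  have -> : d = a ^+ 2 + b ^+ 2 by [].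
  by have := sqr_ge0 (a * b' - b * a'); nra.
rewrite -mulrA ler_wpM2l// -[leRHS]mul1r; apply: ler_pM => //; last by lra.
by rewrite subr_ge0 ltW.
Qed.

Lemma continuous_bump_slope c l r (s : R) : derivable c s 1 ->
  {for s, continuous ('D_1 c)} ->
  {for s, continuous (fun s => 2 * Num.max (r - sqdist (c s) l) 0 *
     - (2 * (((c s).1 - l.1) * ('D_1 c s).1 + ((c s).2 - l.2) * ('D_1 c s).2)))}.
Proof.
move=> dc cc'.
have cc : c @ s --> c s by apply: differentiable_continuous; apply/derivable1_diffP.
have c1 : (fun s => (c s).1) @ s --> (c s).1 by exact: (@cvg_comp _ _ _ _ fst _ _ _ cc cvg_fst).
have c2 : (fun s => (c s).2) @ s --> (c s).2 by exact: (@cvg_comp _ _ _ _ snd _ _ _ cc cvg_snd).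
have c1' : (fun s => ('D_1 c s).1) @ s --> ('D_1 c s).1.
  exact: (@cvg_comp _ _ _ _ fst _ _ _ cc' cvg_fst).
have c2' : (fun s => ('D_1 c s).2) @ s --> ('D_1 c s).2.
  exact: (@cvg_comp _ _ _ _ snd _ _ _ cc' cvg_snd).
have csq : (fun s => sqdist (c s) l) @ s --> sqdist (c s) l.
  exact: (@cvg_comp _ _ _ _ (fun z => sqdist z l) _ _ _ cc (@continuous_sqdist l (c s))).
have cmax : (fun s => Num.max (r - sqdist (c s) l) 0) @ s --> Num.max (r - sqdist (c s) l) 0.
  apply: (@continuous_max _ _ (fun s => r - sqdist (c s) l) (fun=> 0)).
    by apply: cvgB; [exact: cvg_cst|exact: csq].
  exact: cvg_cst.
apply: cvgM; first by apply: cvgM; [exact: cvg_cst|exact: cmax].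
apply: cvgN; apply: cvgM; first exact: cvg_cst.
by apply: cvgD; apply: cvgM => //; apply: cvgB => //; exact: cvg_cst.
Qed.

Lemma continuous_length_density w c (s : R) : (forall z, disc z -> {for z, continuous w}) ->
  disc (c s) -> derivable c s 1 -> {for s, continuous ('D_1 c)} ->
  {for s, continuous (fun s => expR (w (c s)) *
     Num.sqrt (('D_1 c s).1 ^+ 2 + ('D_1 c s).2 ^+ 2))}.
Proof.
move=> cw dcs dc cc'.
have cc : c @ s --> c s by apply: differentiable_continuous; apply/derivable1_diffP.
have cwc := @cvg_comp _ _ _ _ w _ _ _ cc (cw _ dcs).
apply: cvgM; first exact: (@cvg_comp _ _ _ _ (@expR R) _ _ _ cwc (@continuous_expR R _)).
have cn := @cvg_comp _ _ _ _ (@nsq R) _ _ _ cc' (@continuous_nsq R _).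
exact: (@cvg_comp _ _ _ _ (@Num.sqrt R) _ _ _ cn (@sqrt_continuous R _)).
Qed.

Lemma bump_le_length w l r A c p q :
  (forall z, disc z -> {for z, continuous w}) -> 0 < A -> r <= 1 ->
  (forall z, disc z -> sqdist z l < r -> 4 <= A * expR (w z)) ->
  disc_curve p q c ->
  (`|A^-1 * bump l r q - A^-1 * bump l r p|%:E <= curve_length w c)%E.
Proof.
move=> cw A0 r1 Aw [[n [s [s0 sn Hs]]] cp cq cd].
have s_mono i j : (i <= j)%N -> (j <= n)%N -> s i <= s j.
  elim: j => [|j IH]; first by rewrite leqn0 => /eqP ->.
  rewrite leq_eqVlt => /predU1P[->//|ij] jn.
  by rewrite (le_trans (IH ij (ltnW jn)))// ltW//; have [] := Hs j jn.
have in01 i x : (i < n)%N -> x \in `]s i, s i.+1[ -> x \in `[0, 1].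
  rewrite !in_itv /= => lin /andP[ix xi]; apply/andP; split.
    by rewrite -s0 (le_trans _ (ltW ix))// s_mono// ltnW.
  by rewrite -sn (le_trans (ltW xi))// s_mono.
pose g x := expR (w (c x)) * Num.sqrt (('D_1 c x).1 ^+ 2 + ('D_1 c x).2 ^+ 2).
have g0 x : 0 <= g x by rewrite mulr_ge0// ?expR_ge0 ?sqrtr_ge0.
(* Taking k = A^-1 and k = - A^-1 treats both signs of the increment. *)
suff main k : `|k| = A^-1 ->
    ((k * bump l r q - k * bump l r p)%:E <= curve_length w c)%E.
  rewrite -mulrBr; have [ge0|lt0] := leP 0 (A^-1 * (bump l r q - bump l r p)).
    by rewrite ger0_norm// mulrBr; apply: main; rewrite gtr0_norm ?invr_gt0.
  rewrite ltr0_norm// -mulNr mulrBr; apply: main.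
  by rewrite normrN gtr0_norm ?invr_gt0.
move=> kA.
pose slope x := k * (2 * Num.max (r - sqdist (c x) l) 0 *
   - (2 * (((c x).1 - l.1) * ('D_1 c x).1 + ((c x).2 - l.2) * ('D_1 c x).2))).
have := @increment_le_integral_pieces _ g (fun x => k * bump l r (c x)) slope n s.
rewrite s0 sn cp cq; apply => // i lin.
have [si Ci] := Hs i lin; split => //; split.
- move=> x xi; have [dc _] := Ck_on_interior Ci xi.
  exact: (is_deriveZ k (is_derive_bump l r dc)).
- move=> x xi; have [dc cc'] := Ck_on_interior Ci xi.
  by apply: cvgM; [exact: cvg_cst|exact: continuous_bump_slope].
- move=> x xi; have [dc cc'] := Ck_on_interior Ci xi.
  by apply: continuous_length_density => //; exact/cd/(in01 i).
- move=> x xi; rewrite (le_trans (ler_norm _))// normrM kA.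
  rewrite ler_pdivrMl//; apply: (le_trans (bump_slope_le c l x r1)).
  case: ifPn => [cl|_]; last by rewrite mulr_ge0// ltW.
  by rewrite /g mulrA ler_wpM2r ?sqrtr_ge0// Aw//; exact/cd/(in01 i).
- apply/subspace_continuousP => x xi.
  have := Ck_on_within Ci => /subspace_continuousP/(_ x xi) cc.
  apply: cvgM; first exact: cvg_cst.
  exact: (@cvg_comp _ _ _ _ (bump l r) _ _ _ cc (@continuous_bump l r (c x))).
Qed.

(** A function that is 1-Lipschitz for the distance and separates [l] from the boundary. It lets the
    limit supplied by completeness be exploited without comparing the metric topology with the
    Euclidean one. *)
Lemma riem_dist_bump w l : (forall z, disc z -> {for z, continuous w}) -> disc l ->
  exists (psi : R * R -> R) (s : R),
  [/\ 0 < psi l, s < 1, forall z, s <= nsq z -> psi z = 0 &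
   forall p q (e : R), (riem_dist w p q < e%:E)%E -> `|psi q - psi p| < e].
Proof.
move=> cw dl.
pose s := (1 + nsq l) / 2.
have ls : nsq l < s by rewrite /s; move: dl; rewrite /disc /= -/(nsq l); lra.
(* Any constant below e^(w l) would do: it is a lower bound of e^w near [l]. *)
pose m := expR (w l - 1).
have m0 : 0 < m by exact: expR_gt0.
have n1 : \forall z \near l, nsq z < s /\ m <= expR (w z).
  near=> z; split; near: z.
    by apply: (cvgr_lt _ (@continuous_nsq R l)).
  have c1 : w z @[z --> l] --> w l by exact: cw.
  near=> z; rewrite ler_expR; near: z.
  by apply: (cvgr_ge _ c1); rewrite ltrBlDr ltrDl.
have [r0 r00 Hr] := nbhs_sqdist n1.
pose r := Num.min r0 1.
have r_gt0 : 0 < r by rewrite lt_min r00 ltr01.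
exists (fun z => (4 / m)^-1 * bump l r z), s; split.
- rewrite mulr_gt0// ?invr_gt0 ?divr_gt0// /bump /sqp /sqdist !subrr expr0n /= addr0 subr0.
  by rewrite exprn_gt0// lt_max r_gt0.
- by rewrite /s; move: dl; rewrite /disc /= -/(nsq l); lra.
- move=> z sz; rewrite /bump /sqp max_r ?expr0n ?mulr0// subr_le0 leNgt; apply/negP => zr.
  have [|] := Hr z; first by rewrite (lt_le_trans zr)// ge_min lexx.
  by rewrite ltNge sz.
- move=> p q e /ereal_inf_lt[_ [c cpq <-] ce].
  rewrite -lte_fin; apply: le_lt_trans ce; apply: bump_le_length => //.
  + exact: divr_gt0.
  + by rewrite ge_min lexx orbT.
  + move=> z dz zl; have [|_ mz] := Hr z; first by rewrite (lt_le_trans zl)// ge_min lexx.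
    by rewrite mulrAC ler_pdivlMr// ler_wpM2l.
Unshelve. all: by end_near. Qed.

End CurveLowerBound.

(** * Polygons and bounds for their lengths *)

Section Connections.
Context {R : realType}.
Implicit Types (w : R * R -> R) (x y z : R * R).

(* Polygons of length at most [r] from [x] to [z], where the length of a segment
   is overestimated by any upper bound [m] of the conformal factor on it; with
   this convention a segment can be cut at an arbitrary point. *)
Inductive conn w : R -> R * R -> R * R -> Prop :=
| conn_refl r x : 0 <= r -> disc x -> conn w r x x
| conn_step r r' m x y z : disc x -> disc y ->
    (forall t, 0 <= t <= 1 -> expR (w (ray x (y - x) t)) <= m) ->
    m * Num.sqrt (nsq (y - x)) + r' <= r -> conn w r' y z -> conn w r x z.

Lemma conn_disc w r x z : conn w r x z -> disc x /\ disc z.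
Proof. by elim=> // {}r r' m {}x y {}z dx dy _ _ _ [_ dz]. Qed.

Lemma segment_bound_ge0 w m x y :
  (forall t, 0 <= t <= 1 -> expR (w (ray x (y - x) t)) <= m) -> 0 < m.
Proof. by move=> H; apply: lt_le_trans (expR_gt0 _) (H 0 _); rewrite lexx ler01. Qed.

Lemma conn_ge0 w r x z : conn w r x z -> 0 <= r.
Proof.
elim=> // {}r r' m {}x y {}z _ _ /segment_bound_ge0 m0 rr _ r'0.
by rewrite (le_trans _ rr)// addr_ge0// mulr_ge0 ?sqrtr_ge0// ltW.
Qed.

Lemma conn_le w r s x z : conn w r x z -> r <= s -> conn w s x z.
Proof.
case=> [{}r {}x r0 dx rs|{}r r' m {}x y {}z dx dy mb mr c rs].
  by apply: conn_refl => //; exact: le_trans rs.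
by apply: (conn_step dx dy mb _ c); exact: le_trans rs.
Qed.

Lemma conn_trans w r s x y z : conn w r x y -> conn w s y z -> conn w (r + s) x z.
Proof.
elim=> [{}r {}x r0 dx cs|{}r r' m {}x {}y y' dx dy mb mr c IH cs].
  by apply: conn_le cs _; rewrite lerDr.
by apply: (conn_step dx dy mb _ (IH cs)); rewrite addrA lerD2r.
Qed.

Lemma conn_segment w m r x y : disc x -> disc y ->
  (forall t, 0 <= t <= 1 -> expR (w (ray x (y - x) t)) <= m) ->
  m * Num.sqrt (nsq (y - x)) <= r -> conn w r x y.
Proof.
move=> dx dy mb mr; apply: (conn_step (r' := 0) dx dy mb); first by rewrite addr0.
exact: conn_refl.
Qed.

Lemma nsqN z : nsq (- z) = nsq z.
Proof. by rewrite /nsq /= !sqrrN. Qed.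

Lemma conn_sym w r x z : conn w r x z -> conn w r z x.
Proof.
elim=> [{}r {}x r0 dx|{}r r' m {}x y {}z dx dy mb mr c IH]; first exact: conn_refl.
apply: (conn_le (r := r' + m * Num.sqrt (nsq (y - x)))); last by rewrite addrC.
apply: (conn_trans IH); apply: (conn_segment (m := m)) => //.
  move=> t t01; have := mb (1 - t); rewrite (_ : ray _ _ (1 - t) = ray y (x - y) t).
    by apply; lra.
  by rewrite /ray /=; congr pair; ring.
by rewrite -opprB nsqN.
Qed.

Lemma nsq_ray_le x y (t s : R) : nsq x <= s -> nsq y <= s -> 0 <= t <= 1 ->
  nsq (ray x (y - x) t) <= s.
Proof.
rewrite /nsq /ray /=; set a := x.1; set b := x.2; set c := y.1; set d := y.2.
move=> ab cd t01; have -> : (a + t * (c - a)) ^+ 2 + (b + t * (d - b)) ^+ 2 =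
  (1 - t) * (a ^+ 2 + b ^+ 2) + t * (c ^+ 2 + d ^+ 2) -
  t * (1 - t) * ((a - c) ^+ 2 + (b - d) ^+ 2) by ring.
have : 0 <= t * (1 - t) * ((a - c) ^+ 2 + (b - d) ^+ 2).
  case/andP: t01 => t0 t1.
  by apply: mulr_ge0; [apply: mulr_ge0; lra|rewrite addr_ge0 ?sqr_ge0].
by move: ab cd t01; set p := a ^+ 2 + _; set q := c ^+ 2 + _ => p1 q1 /andP[t0 t1]; nra.
Qed.

Lemma ray_disc x y (t : R) : disc x -> disc y -> 0 <= t <= 1 -> disc (ray x (y - x) t).
Proof.
move=> dx dy t01; apply: (@le_lt_trans _ _ (Num.max (nsq x) (nsq y))).
  by apply: nsq_ray_le t01; rewrite le_max lexx ?orbT.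
by rewrite gt_max; apply/andP; split; [exact: dx|exact: dy].
Qed.

Lemma nsqZ (t : R) z : nsq (t *: z) = t ^+ 2 * nsq z.
Proof. by rewrite /nsq /= /GRing.scale /=; ring. Qed.

Lemma conn_split w r x z (s : R) : conn w r x z -> 0 <= s <= r ->
  exists y, conn w s x y /\ conn w (r - s) y z.
Proof.
move=> c; elim: c s => [{}r {}x r0 dx s sr|{}r r' m {}x y {}z dx dy mb mr c IH s sr].
  exists x; split; first by apply: conn_refl => //; lra.
  by apply: conn_refl => //; lra.
set d := m * Num.sqrt (nsq (y - x)) in mr.
have r'0 := conn_ge0 c.
have m0 := segment_bound_ge0 mb.
have [ds|sd] := leP d s.
  (* The budget r may exceed d + r', so what is left of s after the first segment is truncated at
     r'. *)
  have [|y' [c1 c2]] := IH (Num.min (s - d) r').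
    by rewrite le_min r'0 andbT subr_ge0 ds/= ge_min lexx orbT.
  exists y'; split.
    apply: (conn_step dx dy mb _ c1); rewrite -/d -lerBrDl ge_min lexx //.
  apply: conn_le c2 _; rewrite lerBlDr -lerBlDl opprB addrA le_min.
  by apply/andP; split; lra.
have d0 : 0 < d by lra.
(* The cut falls inside the first segment; both pieces inherit the bound [m]. *)
pose t := s / d.
have t0 : 0 <= t by rewrite divr_ge0//; lra.
have t1 : t <= 1 by rewrite ler_pdivrMr// mul1r ltW.
exists (ray x (y - x) t); split.
  apply: (conn_segment (m := m)) => //.
  - by apply: ray_disc; rewrite ?t0.
  - move=> u u01; have := mb (u * t).
    rewrite (_ : ray x _ (u * t) = ray x (ray x (y - x) t - x) u).
      by apply; nra.
    by rewrite /ray /=; congr pair; ring.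
  rewrite (_ : _ - x = t *: (y - x)).
    rewrite nsqZ sqrtrM ?sqr_ge0// sqrtr_sqr ger0_norm// mulrCA -/d.
    by rewrite /t divfK// gt_eqF.
  by rewrite /ray [LHS]surjective_pairing [RHS]surjective_pairing /= /GRing.scale /=; congr pair; ring.
apply: (conn_step (r' := r') (m := m) (y := y)) => //.
- by apply: ray_disc; rewrite ?t0.
- move=> u u01; have := mb (t + u * (1 - t)).
  rewrite (_ : ray x _ (_ + _) = ray (ray x (y - x) t) (y - ray x (y - x) t) u).
    by apply; nra.
  by rewrite /ray /=; congr pair; ring.
rewrite (_ : y - _ = (1 - t) *: (y - x)).
  rewrite nsqZ sqrtrM ?sqr_ge0// sqrtr_sqr ger0_norm ?subr_ge0// mulrCA -/d.
  by rewrite mulrBl mul1r /t divfK ?gt_eqF//; lra.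
by rewrite /ray [LHS]surjective_pairing [RHS]surjective_pairing /= /GRing.scale /=; congr pair; ring.
Qed.

End Connections.

(** * From polygons to C^1 curves *)

Section CurveUpperBound.
Context {R : realType}.
Implicit Types (w : R * R -> R) (x y z : R * R).

(** Equal to 2s^2 on [0, 1/2] and to 1 - 2(1 - s)^2 on [1/2, 1], constant outside [0, 1]; a
    combination of [sqp] is C^1 at the three junctions at once. *)
Definition smoothstep (s : R) : R := 2 * sqp s - 4 * sqp (s - 1 / 2) + 2 * sqp (s - 1).
Definition dsmoothstep (s : R) : R :=
  4 * (Num.max s 0 - 2 * Num.max (s - 1 / 2) 0 + Num.max (s - 1) 0).

Lemma is_derive_affine (f : R -> R) (a b s d : R) :
  is_derive (a * s + b) 1 f d -> is_derive s 1 (fun s => f (a * s + b)) (a * d).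
Proof.
move=> df; have dg : is_derive s 1 (fun s => a * s + b) a.
  have := is_deriveD (is_deriveZ a (is_derive_id s (1 : R))) (is_derive_cst b s (1 : R)).
  by move=> /is_derive_eq; apply; rewrite /GRing.scale /=; ring.
by have := @is_derive1_comp _ f (fun s => a * s + b) s _ _ df dg; rewrite mulrC.
Qed.

Lemma is_derive_smoothstep (s : R) : is_derive s 1 smoothstep (dsmoothstep s).
Proof.
have d0 := is_derive_sqp s.
have d1 k : is_derive s 1 (fun s => sqp (s - k)) (2 * Num.max (s - k) 0).
  have := @is_derive_affine (@sqp R) 1 (- k) s _ (is_derive_sqp _).
  rewrite !mul1r; congr is_derive; apply/funext => u; by rewrite mul1r.
have := is_deriveD (is_deriveB (is_deriveZ 2 d0) (is_deriveZ 4 (d1 (1 / 2))))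
   (is_deriveZ 2 (d1 1)).
by move=> /is_derive_eq; apply; rewrite /GRing.scale /dsmoothstep /=; ring.
Qed.

Lemma continuous_dsmoothstep : continuous dsmoothstep.
Proof.
move=> s; have cm k : (fun s : R => Num.max (s - k) 0) @ s --> Num.max (s - k) 0.
  apply: (@continuous_max _ _ (fun s => s - k) (fun=> 0)); last exact: cvg_cst.
  by apply: cvgB; [exact: cvg_id|exact: cvg_cst].
have := cm 0; rewrite subr0 (_ : (fun s : R => Num.max (s - 0) 0) = fun s => Num.max s 0); last first.
  by apply/funext => u; rewrite subr0.
move=> c0; apply: cvgM; first exact: cvg_cst.
apply: cvgD; last exact: cm.
by apply: cvgB => //; apply: cvgM; [exact: cvg_cst|exact: cm].
Qed.

Lemma smoothstep_le0 s : s <= 0 -> smoothstep s = 0.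
Proof.
move=> s0; rewrite /smoothstep /sqp.
by rewrite !max_r; try lra; ring.
Qed.

Lemma smoothstep_ge1 s : 1 <= s -> smoothstep s = 1.
Proof.
move=> s1; rewrite /smoothstep /sqp.
by rewrite !max_l; try lra; field.
Qed.

Lemma dsmoothstep_le0 s : s <= 0 -> dsmoothstep s = 0.
Proof.
move=> s0; rewrite /dsmoothstep.
by rewrite !max_r; try lra; ring.
Qed.

Lemma dsmoothstep_ge1 s : 1 <= s -> dsmoothstep s = 0.
Proof.
move=> s1; rewrite /dsmoothstep.
by rewrite !max_l; try lra; field.
Qed.

Lemma smoothstep_itv s : 0 <= smoothstep s <= 1.
Proof.
have [s0|s0] := leP s 0; first by rewrite smoothstep_le0// lexx ler01.
have [s1|s1] := leP 1 s; first by rewrite smoothstep_ge1// lexx ler01.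
rewrite /smoothstep /sqp (max_l (ltW s0)) (max_r (_ : s - 1 <= 0)); last by lra.
by have [s2|s2] := leP (s - 1 / 2) 0; apply/andP; split; nra.
Qed.

Lemma dsmoothstep_itv s : 0 <= dsmoothstep s <= 2.
Proof.
have [s0|s0] := leP s 0; first by rewrite dsmoothstep_le0// lexx ler0n.
have [s1|s1] := leP 1 s; first by rewrite dsmoothstep_ge1// lexx ler0n.
rewrite /dsmoothstep (max_l (ltW s0)) (max_r (_ : s - 1 <= 0)); last by lra.
by have [s2|s2] := leP (s - 1 / 2) 0; apply/andP; split; nra.
Qed.

Lemma sqrtr_scale (k p q : R) : 0 <= k ->
  Num.sqrt ((k * p) ^+ 2 + (k * q) ^+ 2) = k * Num.sqrt (p ^+ 2 + q ^+ 2).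
Proof.
move=> k0; have -> : (k * p) ^+ 2 + (k * q) ^+ 2 = k ^+ 2 * (p ^+ 2 + q ^+ 2) by ring.
by rewrite sqrtrM ?sqr_ge0// sqrtr_sqr ger0_norm.
Qed.

(* The factor 2 is the maximum of [dsmoothstep]. Resting for [s <= 0] and for
   [1 <= s] allows curves to be concatenated by adding them. *)
Definition slow_curve w (r : R) x z := exists X Y X' Y' : R -> R,
  (forall s : R, is_derive s 1 X (X' s) /\ is_derive s 1 Y (Y' s)) /\
  [/\ continuous X', continuous Y',
   forall s, s <= 0 -> (X s, Y s) = x /\ (X' s, Y' s) = 0,
   forall s, 1 <= s -> (X s, Y s) = z /\ (X' s, Y' s) = 0 &
   forall s, disc (X s, Y s) /\
     expR (w (X s, Y s)) * Num.sqrt (X' s ^+ 2 + Y' s ^+ 2) <= 2 * r].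

Lemma slow_curve_cst w r x : 0 <= r -> disc x -> slow_curve w r x x.
Proof.
move=> r0 dx; exists (fun=> x.1), (fun=> x.2), (fun=> 0), (fun=> 0).
split; first by move=> s; split; exact: is_derive_cst.
have Ex : (x.1, x.2) = x by case: (x).
split=> //.
- by move=> s; exact: cvg_cst.
- by move=> s; exact: cvg_cst.
- move=> s; split; first by rewrite Ex.
  by rewrite expr0n /= addr0 sqrtr0 mulr0 mulr_ge0.
Qed.

Lemma slow_curve_segment w m r x y : disc x -> disc y ->
  (forall t, 0 <= t <= 1 -> expR (w (ray x (y - x) t)) <= m) ->
  m * Num.sqrt (nsq (y - x)) <= r -> slow_curve w r x y.
Proof.
move=> dx dy mb mr; have m0 := segment_bound_ge0 mb.
exists (fun s => x.1 + smoothstep s * (y - x).1), (fun s => x.2 + smoothstep s * (y - x).2).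
exists (fun s => dsmoothstep s * (y - x).1), (fun s => dsmoothstep s * (y - x).2).
have D (a b s : R) : is_derive s 1 (fun s => a + smoothstep s * b) (dsmoothstep s * b).
  have := is_deriveD (is_derive_cst a s (1 : R)) (is_deriveZ b (is_derive_smoothstep s)).
  rewrite /GRing.scale /= add0r mulrC; congr is_derive.
  by apply/funext => u; rewrite !fctE /= mulrC.
split; first by move=> s; split.
have C (b : R) : continuous (fun s => dsmoothstep s * b).
  by move=> s; apply: cvgM; [exact: continuous_dsmoothstep|exact: cvg_cst].
split; [exact: C|exact: C| | |].
- move=> s s0; rewrite smoothstep_le0// dsmoothstep_le0// !mul0r !addr0; split=> //.
  by case: (x).
- move=> s s1; rewrite smoothstep_ge1// dsmoothstep_ge1// !mul1r !mul0r; split=> //.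
  by case: (y) => ? ? /=; rewrite !(addrC x.1, addrC x.2) !subrK.
- move=> s; have /andP[s0 s1] := smoothstep_itv s; split.
    by apply: ray_disc => //; rewrite s0 s1.
  have -> : Num.sqrt ((dsmoothstep s * (y - x).1) ^+ 2 + (dsmoothstep s * (y - x).2) ^+ 2) =
     dsmoothstep s * Num.sqrt (nsq (y - x)).
    by apply: sqrtr_scale; have /andP[] := dsmoothstep_itv s.
  rewrite mulrCA; have /andP[d0 d2] := dsmoothstep_itv s.
  apply: ler_pM => //.
  apply: le_trans mr; rewrite ler_wpM2r ?sqrtr_ge0//.
  by apply: (mb (smoothstep s)); rewrite s0 s1.
Qed.

Lemma slow_curve_trans w r r' x y z : 0 < r -> 0 < r' ->
  slow_curve w r x y -> slow_curve w r' y z -> slow_curve w (r + r') x z.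
Proof.
move=> r0 r'0 [X1 [Y1 [X1' [Y1' [D1 [cX1 cY1 b1 e1 l1]]]]]].
move=> [X2 [Y2 [X2' [Y2' [D2 [cX2 cY2 b2 e2 l2]]]]]].
(* Each curve receives a share of [0, 1] proportional to its length budget, so that both speed
   bounds become 2 (r + r'). *)
pose a := (r + r') / r; pose b := (r + r') / r'.
have a0 : 0 < a by rewrite divr_gt0// addr_gt0.
have b0 : 0 < b by rewrite divr_gt0// addr_gt0.
pose B s := b * s + (1 - b).
have Bb s : r / (r + r') <= s -> 0 <= B s.
  move=> rs; have -> : B s = b * (s - r / (r + r')).
    by rewrite /B /b; field; rewrite !gt_eqF//= addr_gt0.
  by rewrite mulr_ge0 ?subr_ge0// ltW.
have Bb' s : s <= r / (r + r') -> B s <= 0.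
  move=> rs; have -> : B s = b * (s - r / (r + r')).
    by rewrite /B /b; field; rewrite !gt_eqF//= addr_gt0.
  by rewrite mulr_ge0_le0 ?subr_le0// ltW.
(* The summand 0 gives [A] the shape expected by [is_derive_affine]. *)
pose A s := a * s + 0.
have Aa s : r / (r + r') <= s -> 1 <= A s.
  by move=> rs; rewrite /A addr0 /a mulrAC ler_pdivlMr// mul1r mulrC -ler_pdivrMr ?addr_gt0.
have tr : 0 <= r / (r + r') <= 1.
  rewrite divr_ge0 ?addr_ge0 ?(ltW r0) ?(ltW r'0)//=.
  by rewrite ler_pdivrMr ?addr_gt0// mul1r lerDl ltW.
have split_at s : ((X2 (B s), Y2 (B s)) = y /\ (X2' (B s), Y2' (B s)) = 0) \/
    ((X1 (A s), Y1 (A s)) = y /\ (X1' (A s), Y1' (A s)) = 0).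
  by have [/Bb'/b2|/ltW/Aa/e1] := leP s (r / (r + r')); [left|right].
exists (fun s => X1 (A s) + X2 (B s) - y.1), (fun s => Y1 (A s) + Y2 (B s) - y.2).
exists (fun s => a * X1' (A s) + b * X2' (B s)), (fun s => a * Y1' (A s) + b * Y2' (B s)).
have D (F G F' G' : R -> R) (k s : R) : (forall s : R, is_derive s 1 F (F' s)) ->
    (forall s : R, is_derive s 1 G (G' s)) ->
    is_derive s 1 (fun s => F (A s) + G (B s) - k) (a * F' (A s) + b * G' (B s)).
  move=> dF dG; have dFA := is_derive_affine (dF (A s)).
  have dGB := is_derive_affine (dG (B s)).
  have := is_deriveB (is_deriveD dFA dGB) (is_derive_cst k s (1 : R)).
  by rewrite subr0.
split.
  by move=> s; split; apply: D => u; [case: (D1 u)|case: (D2 u)|case: (D1 u)|case: (D2 u)].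
have cA (k : R) (l : R) (F : R -> R) : continuous F -> continuous (fun s => F (k * s + l)).
  move=> cF s; have c1 : (fun s => k * s + l) @ s --> k * s + l.
    by apply: cvgD; [apply: cvgM; [exact: cvg_cst|exact: cvg_id]|exact: cvg_cst].
  exact: (@cvg_comp _ _ _ _ F _ _ _ c1 (cF _)).
have C (F G : R -> R) : continuous F -> continuous G ->
    continuous (fun s => a * F (A s) + b * G (B s)).
  move=> cF cG s; apply: cvgD; apply: cvgM; try exact: cvg_cst.
    exact: (cA a 0 F cF s).
  exact: (cA b (1 - b) G cG s).
split; [exact: C|exact: C| | |].
- move=> s s0; have /b2[] : B s <= 0 by apply: Bb'; move/andP: tr => [t0 _]; exact: le_trans t0.
  have /b1[] : A s <= 0 by rewrite /A addr0 mulr_ge0_le0// ltW.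
  move=> <- [-> ->] <- [-> ->] /=.
  by rewrite !mulr0 addr0; split=> //; congr pair; ring.
- move=> s s1; have /e1[] : 1 <= A s by apply: Aa; move/andP: tr => [_ t1]; exact: le_trans s1.
  have /e2[] : 1 <= B s.
    rewrite /B -subr_ge0 (_ : _ - 1 = b * (s - 1)); last by ring.
    by rewrite mulr_ge0 ?subr_ge0// ltW.
  move=> <- [-> ->] <- [-> ->] /=.
  by rewrite !mulr0 addr0; split=> //; congr pair; ring.
- move=> s; have [[<- [-> ->]]|[<- [-> ->]]] := split_at s.
    rewrite /= !addrK !mulr0 !addr0; have [dd ll] := l1 (A s); split=> //.
    rewrite sqrtr_scale ?(ltW a0) ?(ltW b0)// mulrCA.
    have -> : 2 * (r + r') = a * (2 * r) by rewrite /a; field; rewrite gt_eqF.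
    by apply: ler_wpM2l; [exact: ltW|exact: ll].
  rewrite /= ![X1 _ + _]addrC ![Y1 _ + _]addrC !addrK !mulr0 !add0r.
  have [dd ll] := l2 (B s); split=> //.
  rewrite sqrtr_scale ?(ltW a0) ?(ltW b0)// mulrCA.
  have -> : 2 * (r + r') = b * (2 * r') by rewrite /b; field; rewrite gt_eqF.
  by apply: ler_wpM2l; [exact: ltW|exact: ll].
Qed.

(** The strict inequality leaves a slack 2e to be shared, so that even a degenerate segment gets the
    positive budget required by [slow_curve_trans]. *)
Lemma conn_slow_curve w r x z : conn w r x z ->
  forall s, r < s -> slow_curve w s x z.
Proof.
elim=> [{}r {}x r0 dx s rs|{}r r' m {}x y {}z dx dy mb mr c IH s rs].
  by apply: slow_curve_cst => //; rewrite (le_trans r0)// ltW.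
have r'0 := conn_ge0 c; have m0 := segment_bound_ge0 mb.
set d := m * Num.sqrt (nsq (y - x)) in mr.
have d0 : 0 <= d by rewrite mulr_ge0 ?sqrtr_ge0// ltW.
pose e := (s - r' - d) / 2.
have e0 : 0 < e by rewrite divr_gt0//; lra.
have -> : s = (d + e) + (r' + e) by rewrite /e; field.
apply: slow_curve_trans; [lra|lra| |apply: IH; lra].
by apply: (slow_curve_segment (m := m)) => //; rewrite -/d lerDl ltW.
Qed.

Lemma riem_dist_slow_curve w r x z : (forall z, disc z -> {for z, continuous w}) ->
  slow_curve w r x z -> (riem_dist w x z <= (2 * r)%:E)%E.
Proof.
move=> cw [X [Y [X' [Y' [D [cX cY b e l]]]]]].
pose c s := (X s, Y s).
have dc (s : R) : differentiable c s.
  have [[dX _] [dY _]] := D s.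
  exact: differentiable_pair ((derivable1_diffP _ _).1 dX) ((derivable1_diffP _ _).1 dY).
have D1 s : 'D_1 c s = (X' s, Y' s).
  have dcs : derivable c s 1 by exact: diff_derivable.
  have [dX1 dY1] := is_derive_fst_snd dcs.
  have [dX dY] := D s.
  rewrite [LHS]surjective_pairing; congr pair.
    by rewrite -(@derive_val _ _ _ _ _ _ _ dX) -(@derive_val _ _ _ _ _ _ _ dX1).
  by rewrite -(@derive_val _ _ _ _ _ _ _ dY) -(@derive_val _ _ _ _ _ _ _ dY1).
have cD1 (s : R) : {for s, continuous ('D_1 c)}.
  have -> : 'D_1 c = fun s => (X' s, Y' s) by apply/funext.
  exact: (continuous_pair (cX s) (cY s)).
apply: (@le_trans _ _ (curve_length w c)).
  apply: ereal_inf_lbound; exists c => //; split.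
  (* The curve is C^1 on the whole line, so a single piece suffices and the curve is its own
     extension. *)
  - exists 1%N, (fun i => i%:R); split => // i; rewrite ltnS leqn0 => /eqP ->.
    split; first exact: ltr01.
    move=> p _; exists setT, c; split => //; first exact: openT.
    split => // h s _.
    have -> : 'D_h c = fun s => h *: 'D_1 c s.
      apply/funext => u; rewrite !deriveE// -[in LHS](mulr1 h).
      exact: linearZ.
    by apply: cvgZr; exact: cD1.
  - by have [] := b 0 (lexx _).
  - by have [] := e 1 (lexx _).
  - by move=> s _; have [] := l s.
have <- : (\int[lebesgue_measure]_(s in `[0%R, 1%R] : set R) (2 * r)%:E = (2 * r)%:E)%E.
  rewrite integral_cst//= lebesgue_measure_itv/= lte_fin ltr01 sube0.
  by rewrite mule1.
rewrite /curve_length; apply: ge0_le_integral => //.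
- apply/measurable_realfun.measurable_EFinP.
  apply: (@measurable_funS _ _ _ _ setT) => //.
  apply: measurable_realfun.continuous_measurable_fun => s.
  apply: continuous_length_density => //; first by have [] := l s.
  exact: diff_derivable.
- by move=> s _; rewrite lee_fin D1; have [] := l s.
Qed.

End CurveUpperBound.

(** * A Hopf-Rinow theorem *)
Section HopfRinow.
Context {R : realType}.
Implicit Types (w : R * R -> R) (x y z : R * R).

Definition subdisc (s : R) : set (R * R) := [set z | nsq z <= s].

Lemma compact_subdisc s : s <= 1 -> compact (subdisc s).
Proof.
move=> s1; apply: (@subclosed_compact _ _ (`[(-1 : R), 1]%classic `*` `[(-1 : R), 1]%classic)).
- have -> : subdisc s = @nsq R @^-1` [set x | x <= s] by [].
  apply: closed_comp; last exact: closed_le.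
  by move=> z _; exact: continuous_nsq.
- by apply: compact_setX; exact: segment_compact.
- move=> z; rewrite /subdisc /nsq /= => zs; rewrite !in_itv /=.
  by split; apply/andP; split; nra.
Qed.

Lemma subdisc_disc s : s < 1 -> subdisc s `<=` disc.
Proof. by move=> s1 z zs; exact: le_lt_trans zs s1. Qed.

Lemma bounded_subdisc (f : R * R -> R) (s : R) :
  (forall z, disc z -> {for z, continuous f}) -> s < 1 ->
  exists2 M : R, 0 < M & forall z, nsq z <= s -> `|f z| <= M.
Proof.
move=> cf s1; have [s0|s0] := ltP s 0.
  by exists 1 => // z zs; move: (nsq_ge0 z); rewrite leNgt (le_lt_trans zs).
have cfs : {within subdisc s, continuous (fun z => `|f z|)}.
  apply: continuous_in_subspaceT => z; rewrite inE => /(subdisc_disc s1) dz.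
  by apply: cvg_norm; exact: cf.
have [|M _ HM] := compact_EVT_max _ (compact_subdisc (ltW s1)) cfs.
  by exists 0; rewrite /subdisc /nsq /= expr0n /= addr0.
exists (`|f M| + 1) => [|z zs]; first by rewrite ltr_wpDl.
by rewrite (le_trans (HM z _)) ?lerDl// inE.
Qed.

(* The ball of radius [r] around [x] is not relatively compact in the disc. *)
Definition escapes w (r : R) x := forall s : R, s < 1 ->
  exists z, [/\ disc z, s <= nsq z & conn w r x z].

(* The new centre is a limit point of midpoints of polygons that run to the
   boundary; if these midpoints leave every compact set, [x] itself will do. *)
Lemma escapes_halve w r x : (forall z, disc z -> {for z, continuous w}) ->
  0 < r -> disc x -> escapes w r x ->
  exists y, conn w (2 / 3 * r) x y /\ escapes w (2 / 3 * r) y.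
Proof.
move=> cw r0 dx esc.
have [esc'|nesc] := pselect (escapes w (2 / 3 * r) x).
  by exists x; split=> //; apply: conn_refl => //; rewrite mulr_ge0// ltW.
have [s [s1 Hs]] : exists s, s < 1 /\
    forall z, disc z -> conn w (2 / 3 * r) x z -> nsq z < s.
  apply: contrapT => H; apply: nesc => s s1; apply: contrapT => H'.
  apply: H; exists s; split => // z dz c; rewrite ltNge; apply/negP => sz.
  by apply: H'; exists z.
have /choice[yz Hyz] (n : nat) : exists yz : (R * R) * (R * R),
    [/\ 1 - n.+1%:R^-1 <= nsq yz.2, disc yz.2, conn w (r / 2) x yz.1 &
        conn w (r / 2) yz.1 yz.2].
  have [|z [dz nz c]] := esc (1 - n.+1%:R^-1); first by rewrite ltrBlDr ltrDl invr_gt0.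
  have [|y [c1 c2]] := conn_split (s := r / 2) c; first by apply/andP; split; lra.
  by exists (y, z); split=> //; apply: conn_le c2 _; lra.
have ys n : nsq (yz n).1 <= s.
  have [_ _ c _] := Hyz n; have [_ dy] := conn_disc c.
  by apply/ltW/Hs => //; apply: conn_le c _; lra.
have [M M0 HM] : exists2 M : R, 0 < M & forall z, nsq z <= s -> expR (w z) <= M.
  have [z dz|M M0 HM] := @bounded_subdisc (fun z => expR (w z)) s _ s1.
    exact: (@cvg_comp _ _ _ _ (@expR R) _ _ _ (cw z dz) (@continuous_expR R _)).
  by exists M => // z zs; rewrite (le_trans (ler_norm _))// HM.
have [|y [ys' cl]] := compact_subdisc (ltW s1) (F := (fun n => (yz n).1) @ \oo).
  by exists 0%N => // n _; exact: ys.
(* The ratio 2/3 comes from here: each half has length r/2, and r/6 is what it takes to pass from a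
   midpoint to its limit point. *)
have near_y N : exists2 n, (N <= n)%N & conn w (r / 6) y (yz n).1.
  have nb : nbhs y [set p | sqdist p y < (r / (6 * M)) ^+ 2].
    have := @continuous_sqdist R y y; rewrite /prop_for /continuous_at.
    rewrite {2}/sqdist !subrr expr0n /= addr0 => c.
    by apply: (cvgr_lt _ c); rewrite exprn_gt0// divr_gt0// mulr_gt0.
  have fN : ((fun n => (yz n).1) @ \oo) [set p | exists2 n, (N <= n)%N & p = (yz n).1].
    by exists N => // n /= Nn; exists n.
  have [p [[n Nn ->] /= pn]] := cl _ _ fN nb; exists n => //.
  apply: (conn_segment (m := M)).
  - exact: subdisc_disc ys'.
  - exact: subdisc_disc (ys n).
  - by move=> t t01; apply/HM/nsq_ray_le.
  - rewrite mulrC -ler_pdivlMr// -[leRHS]ger0_norm; last first.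
      by rewrite !divr_ge0// ltW.
    rewrite -sqrtr_sqr ler_wsqrtr//.
    have -> : r / 6 / M = r / (6 * M) by rewrite -mulrA -invfM.
    exact: ltW pn.
exists y; split.
  have [n _ c] := near_y 0%N; have [_ _ c1 _] := Hyz n.
  by apply: conn_le (conn_trans c1 (conn_sym c)) _; lra.
move=> u u1; pose N := Num.bound ((1 - u)^-1).
have [n Nn c] := near_y N; have [nz dz _ c2] := Hyz n.
exists (yz n).2; split => //; last by apply: conn_le (conn_trans c c2) _; lra.
apply: le_trans nz; rewrite lerBrDr -lerBrDl.
have u1' : 0 < 1 - u by rewrite subr_gt0.
rewrite -[leRHS]invrK lef_pV2 ?posrE ?invr_gt0//.
have /ltW : (1 - u)^-1 < N%:R by apply: archi_boundP; rewrite invr_ge0 ltW.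
by move=> /le_trans; apply; rewrite ler_nat (leq_trans Nn).
Qed.

(** Otherwise [escapes_halve], iterated, yields a Cauchy sequence of centres whose shrinking balls
    all reach the boundary, and this is incompatible with a limit in the disc. *)
Lemma complete_bounded_conn w (o : R * R) (r : R) :
  (forall z, disc z -> {for z, continuous w}) -> complete_metric w ->
  disc o -> 0 < r ->
  exists2 s : R, s < 1 & forall z, conn w r o z -> nsq z < s.
Proof.
move=> cw compl disc_o r0; apply: contrapT => H.
have esc : escapes w r o.
  move=> s s1; apply: contrapT => H'; apply: H; exists s => // z c.
  rewrite ltNge; apply/negP => sz; apply: H'; exists z; split=> //.
  by have [] := conn_disc c.
have /choice[next Hnext] (p : R * (R * R)) : exists q, 0 < p.1 -> disc p.2 ->
    escapes w p.1 p.2 -> conn w (2 / 3 * p.1) p.2 q /\ escapes w (2 / 3 * p.1) q.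
  have [[p0 dp ep]|np] := pselect [/\ 0 < p.1, disc p.2 & escapes w p.1 p.2].
    by have [q Hq] := escapes_halve cw p0 dp ep; exists q.
  by exists 0 => p0 dp ep; exfalso; apply: np.
pose rr n := (2 / 3) ^+ n * r.
pose y := fix y n := if n is n'.+1 then next (rr n', y n') else o.
have rr0 n : 0 < rr n by rewrite mulr_gt0// exprn_gt0//; lra.
have rrS n : rr n.+1 = 2 / 3 * rr n by rewrite /rr exprS mulrA.
have Hy n : disc (y n) /\ escapes w (rr n) (y n).
  elim: n => [|n [dy ey]]; first by rewrite /rr expr0 mul1r.
  have [c e] := Hnext (rr n, y n) (rr0 n) dy ey.
  by rewrite rrS; split=> //; have [] := conn_disc c.
have yS n : conn w (2 / 3 * rr n) (y n) (y n.+1).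
  by have [dy ey] := Hy n; have [] := Hnext (rr n, y n) (rr0 n) dy ey.
(* The geometric series is kept telescoped: 2/3 rr i = 2 rr i - 2 rr (i + 1). *)
have ymn m k : conn w (2 * rr m - 2 * rr (m + k)%N) (y m) (y (m + k)%N).
  elim: k => [|k IH].
    by rewrite addn0 subrr; apply: conn_refl => //; have [] := Hy m.
  rewrite addnS; apply: conn_le (conn_trans IH (yS _)) _.
  by rewrite rrS; lra.
have cdist (p q : R * R) (a b : R) : conn w a p q -> 2 * a < b ->
    (riem_dist w p q < b%:E)%E.
  move=> c ab; have c' : slow_curve w ((a + b / 2) / 2) p q.
    by apply: (conn_slow_curve c); lra.
  by apply: le_lt_trans (riem_dist_slow_curve cw c') _; rewrite lte_fin; lra.
have rr_small (e : R) : 0 < e -> exists N, forall n, (N <= n)%N -> rr n < e.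
  move=> e0; have cv : (geometric r (2 / 3)) @ \oo --> (0 : R).
    by apply: cvg_geometric; rewrite ger0_norm; lra.
  have [N _ HN] : \forall n \near \oo, geometric r (2 / 3) n < e by exact: (cvgr_lt _ cv).
  by exists N => n /HN; rewrite /= /rr mulrC.
have [l dl Hl] : exists2 l, disc l &
      forall e : R, 0 < e -> exists N : nat, forall n : nat,
        (N <= n)%N -> (riem_dist w (y n) l < e%:E)%E.
  apply: compl => [n|e e0]; first by have [] := Hy n.
  have [N HN] := rr_small (e / 4) (divr_gt0 e0 (ltr0Sn _ _)).
  exists N => m n Nm Nn; have hm := HN m Nm; have hn := HN n Nn.
  have [mn|/ltnW nm] := leqP m n.
    apply: (cdist _ _ (2 * rr m)); last by lra.
    by rewrite -(subnKC mn); apply: conn_le (ymn _ _) _; have := rr0 (m + (n - m))%N; lra.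
  apply: (cdist _ _ (2 * rr n)); last by lra.
  apply: conn_sym.
  by rewrite -(subnKC nm); apply: conn_le (ymn _ _) _; have := rr0 (n + (m - n))%N; lra.
(* For large n, closeness to [l] makes psi (y n) larger than psi l / 2, while closeness to a point
   near the boundary, where [psi] vanishes, makes it smaller. *)
have [psi [s [psil s1 psi0 Hpsi]]] := riem_dist_bump cw dl.
have [N1 H1] := Hl (psi l / 2) (divr_gt0 psil (ltr0Sn _ _)).
have [N2 H2] := rr_small (psi l / 8) (divr_gt0 psil (ltr0Sn _ _)).
pose n := maxn N1 N2.
have := Hpsi _ _ _ (H1 n (leq_maxl _ _)).
have [dn en] := Hy n; have [z [dz sz c]] := en s s1.
have := Hpsi _ _ (psi l / 2) (cdist _ _ _ _ c _).
have rn := H2 n (leq_maxr _ _).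
move=> /(_ _); rewrite (psi0 z sz) !ltr_norml.
have lt : 2 * rr n < psi l / 2 by lra.
by move=> /(_ lt); lra.
Qed.

End HopfRinow.

(** * Second variation of the energy of chains *)
Section Taylor.
Context {R : realType}.
Implicit Types (w : R * R -> R) (x y z : R * R).

Record C2bound w (W : C2disc w) (s M : R) := {
  bound_fun : forall z, nsq z <= s -> `|w z| <= M;
  bound_dx : forall z, nsq z <= s -> `|dx W z| <= M;
  bound_dy : forall z, nsq z <= s -> `|dy W z| <= M;
  bound_dxx : forall z, nsq z <= s -> `|dxx W z| <= M;
  bound_dxy : forall z, nsq z <= s -> `|dxy W z| <= M;
  bound_dyx : forall z, nsq z <= s -> `|dyx W z| <= M;
  bound_dyy : forall z, nsq z <= s -> `|dyy W z| <= M }.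

(** The normalisation 1 <= M lets different powers of M be compared in the estimates below. *)
Lemma C2bound_ex w (W : C2disc w) (s : R) : s < 1 ->
  exists2 M : R, 1 <= M & C2bound W s M.
Proof.
move=> s1; have B f cf := @bounded_subdisc _ f s cf s1.
have [M0 M00 H0] := B w (fun z dz => (C1_fun W dz).1).
have [M1 M10 H1] := B (dx W) (fun z dz => (C1_dx W dz).1).
have [M2 M20 H2] := B (dy W) (fun z dz => (C1_dy W dz).1).
have [M3 M30 H3] := B (dxx W) (@continuous_dxx _ _ W).
have [M4 M40 H4] := B (dxy W) (@continuous_dxy _ _ W).
have [M5 M50 H5] := B (dyx W) (@continuous_dyx _ _ W).
have [M6 M60 H6] := B (dyy W) (@continuous_dyy _ _ W).
exists (1 + M0 + M1 + M2 + M3 + M4 + M5 + M6); first by lra.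
by split=> z zs; [move: (H0 z zs)|move: (H1 z zs)|move: (H2 z zs)|
  move: (H3 z zs)|move: (H4 z zs)|move: (H5 z zs)|move: (H6 z zs)] => Hz; lra.
Qed.

Lemma MVT01 (g g' : R -> R) : (forall t : R, t \in `[0, 1] -> is_derive t 1 g (g' t)) ->
  exists2 t, t \in `[0, 1] & g 1 - g 0 = g' t.
Proof.
move=> dg; have l01 : (0 : R) < 1 by exact: ltr01.
have dg' : forall t : R, t \in `]0, 1[ -> is_derive t 1 g (g' t).
  by move=> t t01; apply: dg; exact: subset_itv_oo_cc t01.
have cg : {within `[0, 1], continuous g}.
  by apply: derivable_within_continuous => t /dg [].
have [t t01 E] := MVT l01 dg' cg.
exists t; first exact: subset_itv_oo_cc t01.
by rewrite E subr0 mulr1.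
Qed.

Lemma ray_increment f (f1 f2 : R * R -> R) x y (s : R) : C1disc f f1 f2 -> s < 1 ->
  nsq x <= s -> nsq y <= s ->
  exists2 t, 0 <= t <= 1 & let z := ray x (y - x) t in
    nsq z <= s /\ f y - f x = (y - x).1 * f1 z + (y - x).2 * f2 z.
Proof.
move=> Hf s1 xs ys.
have Hr t : t \in `[0, 1] -> nsq (ray x (y - x) t) <= s.
  by rewrite in_itv /= => t01; exact: nsq_ray_le.
pose g t := f (ray x (y - x) t).
pose g' t := (y - x).1 * f1 (ray x (y - x) t) + (y - x).2 * f2 (ray x (y - x) t).
have dg (t : R) : t \in `[0, 1] -> is_derive t 1 g (g' t).
  by move=> t01; apply: is_derive_ray => //; exact: le_lt_trans (Hr t t01) s1.
have [t t01 E] := MVT01 dg; exists t => //.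
split; first exact: Hr.
rewrite -[RHS]E /g ray0 (_ : ray x (y - x) 1 = y)//.
rewrite /ray !mul1r [RHS]surjective_pairing /=.
by congr pair; ring.
Qed.

Lemma taylor1 w (W : C2disc w) (s M : R) x y : C2bound W s M -> s < 1 ->
  nsq x <= s -> nsq y <= s -> (w y - w x) ^+ 2 <= 2 * M ^+ 2 * nsq (y - x).
Proof.
move=> HM s1 xs ys; have [t t01 [zs ->]] := ray_increment (C1_fun W) s1 xs ys.
move: (bound_dx HM zs) (bound_dy HM zs); rewrite /nsq.
set a := (y - x).1; set b := (y - x).2; set p := dx W _; set q := dy W _ => pM qM.
have pM2 : p ^+ 2 <= M ^+ 2 by rewrite -real_normK ?num_real// ler_pXn2r// nnegrE (le_trans _ pM).
have qM2 : q ^+ 2 <= M ^+ 2 by rewrite -real_normK ?num_real// ler_pXn2r// nnegrE (le_trans _ qM).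
apply: (@le_trans _ _ ((p ^+ 2 + q ^+ 2) * (a ^+ 2 + b ^+ 2))).
  by have := sqr_ge0 (a * q - b * p); nra.
by apply: ler_wpM2r; [rewrite addr_ge0 ?sqr_ge0|lra].
Qed.

(** The mean value theorem is applied to [w] and then to both partial derivatives, each with its own
    intermediate point. In 2M, one M is due to the pure second derivatives and one to the mixed
    ones. *)
Lemma taylor2 w (W : C2disc w) (s M : R) x y : C2bound W s M -> s < 1 ->
  nsq x <= s -> nsq y <= s ->
  `|w y - w x - ((y - x).1 * dx W x + (y - x).2 * dy W x)| <= 2 * M * nsq (y - x).
Proof.
move=> HM s1 xs ys; have [t t01 [zs ->]] := ray_increment (C1_fun W) s1 xs ys.
set z := ray x (y - x) t in zs *.
have [t1 t101 [zs1 E1]] := ray_increment (C1_dx W) s1 xs zs.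
have [t2 t201 [zs2 E2]] := ray_increment (C1_dy W) s1 xs zs.
have -> : (y - x).1 * dx W z + (y - x).2 * dy W z -
    ((y - x).1 * dx W x + (y - x).2 * dy W x) =
    (y - x).1 * (dx W z - dx W x) + (y - x).2 * (dy W z - dy W x) by ring.
rewrite E1 E2.
have -> : (z - x).1 = t * (y - x).1 by rewrite /z /ray /=; ring.
have -> : (z - x).2 = t * (y - x).2 by rewrite /z /ray /=; ring.
move: (bound_dxx HM zs1) (bound_dxy HM zs1) (bound_dyx HM zs2) (bound_dyy HM zs2).
rewrite /nsq; set a := (y - x).1; set b := (y - x).2.
move: (dxx W _) (dxy W _) (dyx W _) (dyy W _) => p q r u pM qM rM uM.
have -> : a * (t * a * p + t * b * q) + b * (t * a * r + t * b * u) =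
   t * (a ^+ 2 * p + a * b * (q + r) + b ^+ 2 * u) by ring.
have /andP[t0 t1'] := t01.
rewrite normrM ger0_norm//.
have M0 : 0 <= M by exact: le_trans pM.
apply: (@le_trans _ _ (1 * (2 * M * (a ^+ 2 + b ^+ 2)))); last by rewrite mul1r.
apply: ler_pM => //.
have h1 : `|a * b| <= (a ^+ 2 + b ^+ 2) / 2.
  rewrite ler_norml; apply/andP; split.
    by have := sqr_ge0 (a + b); nra.
  by have := sqr_ge0 (a - b); nra.
apply: (le_trans (ler_normD _ _)); apply: (le_trans (lerD (ler_normD _ _) (lexx _))).
have sqn (c d : R) : `|c ^+ 2 * d| = c ^+ 2 * `|d| by rewrite normrM ger0_norm ?sqr_ge0.
rewrite !sqn [`|_ * (q + r)|]normrM normrM.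
have h2 : a ^+ 2 * `|p| <= a ^+ 2 * M by rewrite ler_wpM2l ?sqr_ge0.
have h3 : b ^+ 2 * `|u| <= b ^+ 2 * M by rewrite ler_wpM2l ?sqr_ge0.
have h4 : `|a| * `|b| * `|q + r| <= (a ^+ 2 + b ^+ 2) / 2 * (2 * M).
  apply: ler_pM => //; first by rewrite -normrM.
  by rewrite (le_trans (ler_normD _ _))//; lra.
by nra.
Qed.

(** From 1 - x <= e^(-x) follows e^x <= 1/(1 - x), and 1/(1 - x) - 1 - x = x^2/(1 - x). *)
Lemma expR_le_quadratic (x : R) : `|x| <= 1 / 2 -> 0 <= expR x - 1 - x <= 2 * x ^+ 2.
Proof.
rewrite ler_norml => /andP[x1 x2].
have h1 := expR_ge1Dx x.
have h2 := expR_ge1Dx (- x).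
have h3 : expR x * expR (- x) = 1 by rewrite -expRD subrr expR0.
apply/andP; split; first by lra.
have e0 := expR_gt0 x.
suff : expR x * (1 - x) <= 1 by nra.
by rewrite -h3; nra.
Qed.

(* Rotations by almost [t]; unlike those of cos and sin, the estimates needed
   here are algebraic. *)
Definition cayley_cos (t : R) := (1 - t ^+ 2 / 4) / (1 + t ^+ 2 / 4).
Definition cayley_sin (t : R) := t / (1 + t ^+ 2 / 4).

Lemma cayley_sqD (t : R) : cayley_cos t ^+ 2 + cayley_sin t ^+ 2 = 1.
Proof.
have h : 0 < 1 + t ^+ 2 / 4 by have := sqr_ge0 t; lra.
by rewrite /cayley_cos /cayley_sin; field; rewrite gt_eqF//; have := sqr_ge0 t; lra.
Qed.

Lemma cayley_cos_bound (t : R) : `|cayley_cos t - 1| <= t ^+ 2 / 2.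
Proof.
have h0 := sqr_ge0 t.
have h : 0 < 1 + t ^+ 2 / 4 by lra.
have -> : cayley_cos t - 1 = - ((t ^+ 2 / 2) / (1 + t ^+ 2 / 4)).
  by rewrite /cayley_cos; field; lra.
rewrite normrN ger0_norm; last by rewrite divr_ge0 ?(ltW h)//; lra.
by rewrite ler_pdivrMr// ler_peMr//; lra.
Qed.

Lemma cayley_sin_bound (t : R) : `|t - cayley_sin t| <= t ^+ 2 / 4.
Proof.
have h0 := sqr_ge0 t.
have h : 0 < 1 + t ^+ 2 / 4 by lra.
have -> : t - cayley_sin t = (t ^+ 2 / 4) * (t / (1 + t ^+ 2 / 4)).
  by rewrite /cayley_sin; field; lra.
rewrite normrM ger0_norm; last by lra.
rewrite -[leRHS]mulr1 ler_wpM2l//; first by lra.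
rewrite normrM (ger0_norm (_ : 0 <= (1 + t ^+ 2 / 4)^-1)) ?invr_ge0 ?(ltW h)//.
rewrite ler_pdivrMr// mul1r -(real_normK (num_real t)).
by have := sqr_ge0 (`|t| / 2 - 1); nra.
Qed.

(* With [D] the increment of [w] along a step, [a] its linear part and [t] the
   rotation angle, [k (cos - i sin) - 1 + a + i t] measures how far discrete
   parallel transport is from being parallel: it is of second order. *)
Lemma transport_defect (M nu D a t : R) : 1 <= M -> 0 <= nu ->
  D ^+ 2 <= 2 * M ^+ 2 * nu -> `|D - a| <= 2 * M * nu ->
  t ^+ 2 <= 2 * M ^+ 2 * nu -> D ^+ 2 <= 1 / 16 ->
  let k := expR (- D) in
  [/\ 0 <= k, k ^+ 2 <= 2 & (k * cayley_cos t - 1 + a) ^+ 2 +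
      (t - k * cayley_sin t) ^+ 2 <= 100 * M ^+ 4 * nu ^+ 2].
Proof.
move=> M1 nu0 D2 Da t2 D16 k.
have D14 : `|D| <= 1 / 4 by rewrite -(ler_pXn2r (n := 2)) ?nnegrE// real_normK ?num_real//; lra.
have [|k1 k2] := andP (@expR_le_quadratic (- D) _); first by rewrite normrN; lra.
rewrite -/k sqrrN opprK in k1 k2.
have Dn := D14; rewrite ler_norml in Dn; have /andP[Da1 Da2] := Dn.
have k0 : 0 <= k by exact: expR_ge0.
have kle : k <= 11 / 8 by lra.
split=> //; first by nra.
have M2 : M <= M ^+ 2 by nra.
(* In units of M^2 nu the three terms are at most 4, 2 and 11/8, hence 8; for [him] below they are
   1/2 and 4, hence 6. The 100 of the statement is 8^2 + 6^2. *)
have hre : `|k * cayley_cos t - 1 + a| <= 8 * (M ^+ 2 * nu).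
  have -> : k * cayley_cos t - 1 + a = (k - 1 + D) + (a - D) + k * (cayley_cos t - 1) by ring.
  apply: (le_trans (ler_normD _ _)); apply: (le_trans (lerD (ler_normD _ _) (lexx _))).
  rewrite (distrC a) (ger0_norm k1) normrM (ger0_norm k0).
  have h1 : k * `|cayley_cos t - 1| <= 11 / 8 * (t ^+ 2 / 2).
    by apply: ler_pM => //; exact: cayley_cos_bound.
  have h2 : M * nu <= M ^+ 2 * nu by rewrite ler_wpM2r.
  by lra.
have him : `|t - k * cayley_sin t| <= 6 * (M ^+ 2 * nu).
  have -> : t - k * cayley_sin t = (t - cayley_sin t) + cayley_sin t * (1 - k) by ring.
  apply: (le_trans (ler_normD _ _)); rewrite normrM.
  have h1 := cayley_sin_bound t.
  have h2 : `|cayley_sin t| <= `|t|.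
    have h : 1 <= 1 + t ^+ 2 / 4 by have := sqr_ge0 t; lra.
    rewrite /cayley_sin normrM normfV (ger0_norm (_ : 0 <= 1 + _)); last by lra.
    by rewrite ler_pdivrMr; [rewrite ler_peMr|lra].
  have h3 : `|1 - k| <= 2 * `|D|.
    rewrite distrC; have -> : k - 1 = (k - 1 + D) - D by ring.
    apply: (le_trans (ler_normB _ _)); rewrite (ger0_norm k1).
    suff : 2 * D ^+ 2 <= `|D| by lra.
    by rewrite -(real_normK (num_real D)); have := normr_ge0 D; nra.
  have h4 : `|cayley_sin t| * `|1 - k| <= `|t| * (2 * `|D|) by exact: ler_pM.
  have h5 : `|t| * (2 * `|D|) <= t ^+ 2 + D ^+ 2.
    rewrite -(real_normK (num_real D)) -(real_normK (num_real t)).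
    by have := sqr_ge0 (`|t| - `|D|); nra.
  by lra.
have -> : 100 * M ^+ 4 * nu ^+ 2 = (8 * (M ^+ 2 * nu)) ^+ 2 + (6 * (M ^+ 2 * nu)) ^+ 2 by ring.
have P0 : 0 <= M ^+ 2 * nu by rewrite mulr_ge0 ?sqr_ge0.
rewrite -(real_normK (num_real (_ + a))) -(real_normK (num_real (t - _))).
by apply: lerD; rewrite ler_pXn2r// nnegrE//; lra.
Qed.

End Taylor.

(** * Hyperbolic metrics on concentric discs *)

Section PoincareMetrics.
Context {R : realType}.
Implicit Types (z V : R * R).

(* [exp (2 * hypr rho z) |dz|^2] is the metric of curvature -1 on the disc
   [nsq z < rho], complete there. *)
Definition hypr (rho : R) z : R := ln (4 * rho) / 2 - ln (rho - nsq z).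

Lemma jet2_affine (a b : R) : jet2 (fun t => a + t * b) b 0.
Proof.
by apply: (jet2_eq (jet2D (jet2_cst a) (jet2M jet2_id (jet2_cst b)))); ring.
Qed.

Lemma jet2_sqr (f : R -> R) (b c : R) : jet2 f b c ->
  jet2 (fun t => f t ^+ 2) (2 * f 0 * b) (2 * b ^+ 2 + 2 * f 0 * c).
Proof.
move=> jf; apply: (near_eq_jet2 _ (jet2_eq (jet2M jf jf) _ _)); try ring.
by near=> t; rewrite expr2.
Unshelve. all: by end_near. Qed.

Lemma jet2_nsq (x V : R * R) : jet2 (fun t => nsq (ray x V t))
  (2 * (x.1 * V.1 + x.2 * V.2)) (2 * nsq V).
Proof.
have j a b := jet2_sqr (jet2_affine a b).
apply: (jet2_eq (jet2D (j x.1 V.1) (j x.2 V.2))); rewrite /nsq !mul0r !addr0; ring.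
Qed.

Lemma jet2_hypr (rho : R) z V : nsq z < rho -> let d := rho - nsq z in
  jet2 (fun t => hypr rho (ray z V t)) (2 * (z.1 * V.1 + z.2 * V.2) / d)
    (2 * nsq V / d + 4 * (z.1 * V.1 + z.2 * V.2) ^+ 2 / d ^+ 2).
Proof.
move=> zr d; have d0 : 0 < d by rewrite subr_gt0.
have j1 := jet2B (jet2_cst rho) (jet2_nsq z V).
have /= := jet2B (jet2_cst (ln (4 * rho) / 2)) (jet2_ln j1 _); rewrite ray0 => /(_ d0).
by move=> /jet2_eq; apply; rewrite -/d; field; rewrite gt_eqF.
Qed.

Lemma expR_hypr (rho : R) z : 0 < rho -> nsq z < rho ->
  expR (2 * hypr rho z) = 4 * rho / (rho - nsq z) ^+ 2.
Proof.
move=> r0 zr; have d0 : 0 < rho - nsq z by rewrite subr_gt0.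
have -> : 2 * hypr rho z = ln (4 * rho) - 2 * ln (rho - nsq z) by rewrite /hypr; field.
by rewrite expRB expRM_natl !lnK ?posrE// mulr_gt0.
Qed.

Lemma continuous_hypr (rho : R) z : nsq z < rho -> {for z, continuous (hypr rho)}.
Proof.
move=> zr; have d0 : 0 < rho - nsq z by rewrite subr_gt0.
apply: cvgB; first exact: cvg_cst.
have c1 : (fun z => rho - nsq z) @ z --> rho - nsq z.
  by apply: cvgB; [exact: cvg_cst|exact: continuous_nsq].
exact: (@cvg_comp _ _ _ _ (@ln R) _ _ _ c1 (continuous_ln d0)).
Qed.

End PoincareMetrics.

Notation hyp := (hypr 1).

(** * First and second variation of a chain *)

Section SecondVariation.
Context {R : realType}.
Implicit Types (w : R * R -> R) (x y z V : R * R).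

Definition rotv V : R * R := (- V.2, V.1).

Lemma nsq_rotv V : nsq (rotv V) = nsq V.
Proof. by rewrite /nsq /=; ring. Qed.

(** By [jet2_hypr] the left side adds the second derivatives of [hyp] along V and iV; this is
    Liouville's equation Lap hyp = e^(2 hyp). *)
Lemma hyp_laplacian z V : disc z -> let d := 1 - nsq z in
  (2 * nsq V / d + 4 * (z.1 * V.1 + z.2 * V.2) ^+ 2 / d ^+ 2) +
  (2 * nsq (rotv V) / d + 4 * (z.1 * (rotv V).1 + z.2 * (rotv V).2) ^+ 2 / d ^+ 2) =
  nsq V * expR (2 * hyp z).
Proof.
move=> dz d; have d0 : 0 < d by rewrite subr_gt0.
rewrite (expR_hypr ltr01 dz) mulr1 nsq_rotv -/d /=.
have E : (z.1 * V.1 + z.2 * V.2) ^+ 2 + (z.1 * - V.2 + z.2 * V.1) ^+ 2 =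
   (1 - d) * nsq V by rewrite /d /nsq; ring.
transitivity (4 * nsq V / d + 4 * ((z.1 * V.1 + z.2 * V.2) ^+ 2 + (z.1 * - V.2 + z.2 * V.1) ^+ 2) / d ^+ 2).
  by field; rewrite gt_eqF.
by rewrite E; field; rewrite gt_eqF.
Qed.

(* In complex notation this is [d + 2 w_z V q], the covariant derivative along
   the step [q] of a field with value [V] and increment [d]. *)
Definition defect w (W : C2disc w) x q V d : R * R :=
  let a := q.1 * dx W x + q.2 * dy W x in
  let th := q.2 * dx W x - q.1 * dy W x in
  (d.1 + a * V.1 - th * V.2, d.2 + a * V.2 + th * V.1).

(** First derivative of the cost e^(2w(x)) |q|^2 of a step when its origin moves along V and q
    changes by d. Writing it through [defect] makes bounds for the defects bound the first variation
    as well. *)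
Definition slope w (W : C2disc w) x q V d :=
  2 * expR (2 * w x) * (q.1 * (defect W x q V d).1 + q.2 * (defect W x q V d).2).

(** Second derivative of the same cost. It is left expanded because it simplifies only after the
    contribution of the rotated field is added. *)
Definition convexity w (W : C2disc w) x q V d :=
  let p := V.1 * dx W x + V.2 * dy W x in
  expR (2 * w x) * (4 * p ^+ 2 * nsq q +
    2 * (V.1 ^+ 2 * dxx W x + V.1 * V.2 * (dxy W x + dyx W x) + V.2 ^+ 2 * dyy W x) * nsq q +
    8 * p * (q.1 * d.1 + q.2 * d.2) + 2 * nsq d).

Lemma jet2_cost w (W : C2disc w) x y V V' : disc x ->
  jet2 (fun t => expR (2 * w (ray x V t)) * nsq (ray y V' t - ray x V t))
    (slope W x (y - x) V (V' - V)) (convexity W x (y - x) V (V' - V)).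
Proof.
move=> dx_.
have jq : jet2 (fun t => nsq (ray y V' t - ray x V t))
    (2 * ((y - x).1 * (V' - V).1 + (y - x).2 * (V' - V).2)) (2 * nsq (V' - V)).
  apply: near_eq_jet2 (jet2_nsq (y - x) (V' - V)); near=> t.
  by rewrite /nsq /ray /=; ring.
have je := jet2_expR (jet2Z 2 (jet2_ray W V dx_)).
apply: (jet2_eq (jet2M je jq)); rewrite !ray0.
  by rewrite /slope /defect /nsq /=; ring.
by rewrite /convexity /=; ring.
Unshelve. all: by end_near. Qed.

Lemma slope_rotv w (W : C2disc w) x q V d : slope W x q (rotv V) (rotv d) =
  2 * expR (2 * w x) * (- q.1 * (defect W x q V d).2 + q.2 * (defect W x q V d).1).
Proof. by rewrite /slope /defect /=; ring. Qed.

(* All terms of first order in [w] are absorbed by [nsq (defect _ _ _ _ _)]. *)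
Lemma convexityD_rotv w (W : C2disc w) x q V d : disc x ->
  convexity W x q V d + convexity W x q (rotv V) (rotv d) =
  expR (2 * w x) * (4 * nsq (defect W x q V d) + 2 * nsq V * nsq q * laplacian w x).
Proof.
move=> dx_; rewrite (laplacianE W dx_) /convexity /defect /nsq /=.
set e := expR _; set p := dx W x; set r := dy W x.
by ring.
Qed.

(* By Cauchy-Schwarz the energy is at least the square of the length. *)
Definition energy w (N : nat) (x : nat -> R * R) : R :=
  N%:R * \sum_(i < N) expR (2 * w (x i)) * nsq (x i.+1 - x i).

Lemma jet2_energy w (W : C2disc w) (N : nat) (x V : nat -> R * R) :
  (forall i, (i <= N)%N -> disc (x i)) ->
  jet2 (fun t => energy w N (fun i => ray (x i) (V i) t))
    (N%:R * \sum_(i < N) slope W (x i) (x i.+1 - x i) (V i) (V i.+1 - V i))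
    (N%:R * \sum_(i < N) convexity W (x i) (x i.+1 - x i) (V i) (V i.+1 - V i)).
Proof.
move=> dx_; apply: jet2Z.
apply: (@jet2_sum _ N (fun i t => expR (2 * w (ray (x i) (V i) t)) *
   nsq (ray (x i.+1) (V i.+1) t - ray (x i) (V i) t))
   (fun i => slope W (x i) (x i.+1 - x i) (V i) (V i.+1 - V i))
   (fun i => convexity W (x i) (x i.+1 - x i) (V i) (V i.+1 - V i))) => i iN.
by apply: jet2_cost; apply: dx_; exact: ltnW.
Qed.

(** The logarithm ln(1 - E) + hyp - w is maximal at t = 0, so its second derivative is nonpositive
    there; ln(1 - E) contributes - c/(1 - E) - (b/(1 - E))^2. *)
Lemma energy_max_jet w (W : C2disc w) (N : nat) (x V : nat -> R * R) :
  (forall i, (i <= N)%N -> disc (x i)) -> energy w N x < 1 ->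
  (\forall t \near (0 : R),
    (1 - energy w N (fun i => ray (x i) (V i) t)) *
      expR (hyp (ray (x N) (V N) t) - w (ray (x N) (V N) t)) <=
    (1 - energy w N x) * expR (hyp (x N) - w (x N))) ->
  let E := energy w N x in
  let z := x N in let d := 1 - nsq z in
  let b := N%:R * \sum_(i < N) slope W (x i) (x i.+1 - x i) (V i) (V i.+1 - V i) in
  let c := N%:R * \sum_(i < N) convexity W (x i) (x i.+1 - x i) (V i) (V i.+1 - V i) in
  (2 * nsq (V N) / d + 4 * (z.1 * (V N).1 + z.2 * (V N).2) ^+ 2 / d ^+ 2) -
  ((V N).1 ^+ 2 * dxx W z + (V N).1 * (V N).2 * (dxy W z + dyx W z) +
   (V N).2 ^+ 2 * dyy W z) <= c / (1 - E) + (b / (1 - E)) ^+ 2.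
Proof.
move=> dx_ E1 Hmax; cbv zeta; set E := energy w N x; set z := x N.
set d := 1 - nsq z; set b := N%:R * \sum_(i < N) slope _ _ _ _ _.
set c := N%:R * \sum_(i < N) convexity _ _ _ _ _.
have dz : disc z by exact: dx_.
have jE := jet2_energy W V dx_.
have E0 : energy w N (fun i => ray (x i) (V i) 0) = E.
  by congr energy; apply/funext => i; rewrite ray0.
have j1 := jet2B (jet2_cst 1) jE.
have cj1 := jet2_continuous j1.
have pos0 : 0 < 1 - energy w N (fun i => ray (x i) (V i) 0) by rewrite E0 subr_gt0.
have jP := jet2D (jet2_ln j1 pos0) (jet2B (jet2_hypr (V N) (dz : nsq z < 1)) (jet2_ray W (V N) dz)).
have [|_] := jet2_max jP.
  have near_pos : \forall t \near (0 : R), 0 < 1 - energy w N (fun i => ray (x i) (V i) t).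
    exact: (cvgr_gt _ cj1).
  near=> t.
  have pt : 0 < 1 - energy w N (fun i => ray (x i) (V i) t) by near: t.
  have ht : (1 - energy w N (fun i => ray (x i) (V i) t)) *
      expR (hyp (ray (x N) (V N) t) - w (ray (x N) (V N) t)) <=
      (1 - E) * expR (hyp z - w z) by near: t.
  rewrite E0 !ray0 -ler_expR expRD [leRHS]expRD !lnK ?posrE//.
  by rewrite subr_gt0.
rewrite E0 -/b -/c => H; rewrite -subr_le0; apply: le_trans H.
have E1' : 0 < 1 - E by rewrite subr_gt0.
rewrite le_eqVlt; apply/orP; left; apply/eqP.
have d0 : 0 < d by rewrite subr_gt0.
by rewrite !sub0r -/d; field; rewrite !gt_eqF.
Unshelve. all: by end_near. Qed.

(** The inequalities of [energy_max_jet] for V and for iV are added. On the left this produces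
    |V_N|^2 (e^(2 hyp) - Lap w) at the end point, where V is a unit vector. On the right,
    [convexityD_rotv] leaves the defects and a Laplacian that the lower curvature bound controls. *)
Lemma second_variation w (W : C2disc w) (N : nat) (x V : nat -> R * R) (C B : R) :
  (forall i, (i <= N)%N -> disc (x i)) -> energy w N x < 1 -> 0 <= C ->
  (forall z, disc z -> laplacian w z <= C * expR (2 * w z)) ->
  (forall i, (i <= N)%N -> nsq (V i) <= expR (- (2 * w (x i)))) ->
  nsq (V N) = expR (- (2 * w (x N))) ->
  N%:R * \sum_(i < N) expR (2 * w (x i)) *
    nsq (defect W (x i) (x i.+1 - x i) (V i) (V i.+1 - V i)) <= B ->
  (forall V' : nat -> R * R, V' = V \/ V' = (fun i => rotv (V i)) ->
    \forall t \near (0 : R),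
      (1 - energy w N (fun i => ray (x i) (V' i) t)) *
        expR (hyp (ray (x N) (V' N) t) - w (ray (x N) (V' N) t)) <=
      (1 - energy w N x) * expR (hyp (x N) - w (x N))) ->
  let E := energy w N x in
  expR (2 * (hyp (x N) - w (x N))) <=
    C + (4 * B + 2 * C) / (1 - E) + 2 * ((1 + B) / (1 - E)) ^+ 2.
Proof.
move=> dx_ E1 C0 lapC VU VN HB Hmax; cbv zeta; set E := energy w N x.
have := energy_max_jet W dx_ E1 (Hmax _ (or_introl erefl)).
have := energy_max_jet W dx_ E1 (Hmax _ (or_intror erefl)).
have dz : disc (x N) by exact: dx_.
have Epos : 0 < 1 - E by rewrite subr_gt0.
have hypL := hyp_laplacian (V N) dz.
rewrite /= in hypL *; rewrite -/E.
set c1 := N%:R * \sum_(i < N) convexity _ _ _ _ _.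
set b1 := N%:R * \sum_(i < N) slope _ _ _ _ _.
set c2 := N%:R * \sum_(i < N) convexity _ _ _ _ _.
set b2 := N%:R * \sum_(i < N) slope _ _ _ _ _ => H1 H2.
have rotB i : rotv (V i.+1) - rotv (V i) = rotv (V i.+1 - V i).
  by rewrite /rotv [LHS]surjective_pairing /=; congr pair; ring.
have E0 i : 0 <= expR (2 * w (x i)) * nsq (x i.+1 - x i).
  by rewrite mulr_ge0 ?expR_ge0 ?nsq_ge0.
have En0 : 0 <= E by rewrite mulr_ge0// sumr_ge0.
(* From 2 <q, p> <= |q|^2 + |p|^2; the isometry [e] is the identity for b2 and the right angle
   rotation for b1. *)
have Bb (e : R * R -> R * R) : (forall p, nsq (e p) = nsq p) ->
    `|N%:R * \sum_(i < N) 2 * expR (2 * w (x i)) *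
      ((x i.+1 - x i).1 * (e (defect W (x i) (x i.+1 - x i) (V i) (V i.+1 - V i))).1 +
      (x i.+1 - x i).2 * (e (defect W (x i) (x i.+1 - x i) (V i) (V i.+1 - V i))).2)|
    <= E + B.
  move=> He; apply: (@le_trans _ _ (E + N%:R * \sum_(i < N) expR (2 * w (x i)) *
    nsq (defect W (x i) (x i.+1 - x i) (V i) (V i.+1 - V i)))); last by rewrite lerD2l.
  rewrite /E /energy -mulrDr -big_split /= normrM ger0_norm// ler_wpM2l//.
  apply: (le_trans (ler_norm_sum _ _ _)); apply: ler_sum => i _.
  rewrite -mulrDr -(He (defect _ _ _ _ _)); set q := _ - x i; set p := e _.
  have -> : 2 * expR (2 * w (x i)) * (q.1 * p.1 + q.2 * p.2) =
     expR (2 * w (x i)) * (2 * (q.1 * p.1 + q.2 * p.2)) by ring.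
  rewrite normrM (ger0_norm (expR_ge0 _)) ler_wpM2l ?expR_ge0//.
  rewrite /nsq ler_norml; apply/andP; split.
    by have := sqr_ge0 (q.1 + p.1); have := sqr_ge0 (q.2 + p.2); nra.
  by have := sqr_ge0 (q.1 - p.1); have := sqr_ge0 (q.2 - p.2); nra.
have hb2 : `|b2| <= 1 + B.
  apply: (@le_trans _ _ (E + B)); last by rewrite lerD2r ltW.
  exact: (Bb id (fun=> erefl)).
have hb1 : `|b1| <= 1 + B.
  apply: (@le_trans _ _ (E + B)); last by rewrite lerD2r ltW.
  apply: le_trans (Bb rotv nsq_rotv); rewrite le_eqVlt; apply/orP; left; apply/eqP.
  congr (`|_ * _|); apply: eq_bigr => i _.
  by rewrite rotB slope_rotv /=; ring.
have hc : c1 + c2 <= 4 * B + 2 * C.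
  have -> : c1 + c2 = N%:R * \sum_(i < N) expR (2 * w (x i)) *
     (4 * nsq (defect W (x i) (x i.+1 - x i) (V i) (V i.+1 - V i)) +
      2 * nsq (V i) * nsq (x i.+1 - x i) * laplacian w (x i)).
    rewrite addrC /c1 /c2 -mulrDr -big_split /=; congr (_ * _).
    apply: eq_bigr => i _; rewrite rotB convexityD_rotv//.
    by apply: dx_; exact: ltnW.
  apply: (@le_trans _ _ (4 * (N%:R * \sum_(i < N) expR (2 * w (x i)) *
    nsq (defect W (x i) (x i.+1 - x i) (V i) (V i.+1 - V i))) + 2 * C * E)); last first.
    apply: lerD; first by rewrite ler_wpM2l.
    by rewrite -[leRHS]mulr1 ler_wpM2l ?mulr_ge0// ltW.
  rewrite /E /energy [4 * _]mulrCA [2 * C * _]mulrCA -mulrDr ler_wpM2l//.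
  rewrite !mulr_sumr -big_split /=; apply: ler_sum => i _.
  rewrite mulrDr; apply: lerD; first by rewrite mulrCA.
  set q := nsq (_ - _); set e := expR _.
  have hV : nsq (V i) * laplacian w (x i) <= C.
    have di : disc (x i) by apply: dx_; exact: ltnW.
    apply: (@le_trans _ _ (nsq (V i) * (C * e))); first by rewrite ler_wpM2l ?nsq_ge0 ?lapC.
    rewrite mulrCA -[leRHS]mulr1 ler_wpM2l//.
    apply: (@le_trans _ _ (expR (- (2 * w (x i))) * e)).
      by rewrite ler_wpM2r ?expR_ge0// VU// ltnW.
    by rewrite /e -expRD addNr expR0.
  have -> : e * (2 * nsq (V i) * q * laplacian w (x i)) =
     2 * (nsq (V i) * laplacian w (x i)) * (e * q) by ring.
  by rewrite ler_wpM2r ?ler_wpM2l// mulr_ge0 ?expR_ge0 ?nsq_ge0.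
have hbsq (b : R) : `|b| <= 1 + B -> (b / (1 - E)) ^+ 2 <= ((1 + B) / (1 - E)) ^+ 2.
  move=> hb; rewrite -(real_normK (num_real (b / _))) ler_pXn2r ?nnegrE//; last first.
    by rewrite divr_ge0 ?(ltW Epos)// (le_trans _ hb).
  by rewrite normrM normfV (gtr0_norm Epos) ler_wpM2r// invr_ge0 ltW.
have key : nsq (V N) * (expR (2 * hyp (x N)) - laplacian w (x N)) <=
    (4 * B + 2 * C) / (1 - E) + 2 * ((1 + B) / (1 - E)) ^+ 2.
  apply: (@le_trans _ _ (c1 / (1 - E) + (b1 / (1 - E)) ^+ 2 + (c2 / (1 - E) + (b2 / (1 - E)) ^+ 2))).
    apply: le_trans (lerD H1 H2); rewrite (laplacianE W dz) mulrBr -hypL.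
    rewrite le_eqVlt; apply/orP; left; apply/eqP.
    by rewrite nsq_rotv /nsq /=; ring.
  have -> : c1 / (1 - E) + (b1 / (1 - E)) ^+ 2 + (c2 / (1 - E) + (b2 / (1 - E)) ^+ 2) =
    (c1 + c2) / (1 - E) + ((b1 / (1 - E)) ^+ 2 + (b2 / (1 - E)) ^+ 2) by ring.
  apply: lerD; first by rewrite ler_wpM2r// invr_ge0 ltW.
  by have := hbsq _ hb1; have := hbsq _ hb2; lra.
suff : expR (2 * (hyp (x N) - w (x N))) - C <=
    nsq (V N) * (expR (2 * hyp (x N)) - laplacian w (x N)) by lra.
rewrite VN [leRHS]mulrBr; apply: lerB; first by rewrite -expRD -mulrN -mulrDr addrC.
apply: (@le_trans _ _ (expR (- (2 * w (x N))) * (C * expR (2 * w (x N))))).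
  by rewrite ler_wpM2l ?expR_ge0// lapC.
by rewrite mulrCA -expRD addNr expR0 mulr1.
Qed.

End SecondVariation.

(** * The Schwarz lemma of Yau *)
Section SchwarzYau.
Context {R : realType}.
Implicit Types (w : R * R -> R) (x y z : R * R).

Local Notation pointseq := (prod_topology (fun _ : nat => (R * R)%type)).

(** Parallel transport along a short step q multiplies by about exp(-(a + i t)) with a + i t = 2 w_z
    q. Replacing a by the exact increment of [w] makes transport preserve metric lengths exactly,
    see [nsq_frame]. *)
Definition transport w (W : C2disc w) x y (u : R * R) : R * R :=
  let k := expR (- (w y - w x)) in
  let t := (y - x).2 * dx W x - (y - x).1 * dy W x in
  (k * (cayley_cos t * u.1 + cayley_sin t * u.2),
   k * (cayley_cos t * u.2 - cayley_sin t * u.1)).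

Fixpoint frame w (W : C2disc w) (x : nat -> R * R) (i : nat) : R * R :=
  if i is j.+1 then transport W (x j) (x j.+1) (frame W x j)
  else (expR (- w (x 0%N)), 0).

Lemma nsq_transport w (W : C2disc w) x y u :
  nsq (transport W x y u) = expR (- (w y - w x)) ^+ 2 * nsq u.
Proof.
rewrite /transport /nsq /=; set k := expR _; set t := _ - _ * dy W x.
transitivity (k ^+ 2 * ((cayley_cos t ^+ 2 + cayley_sin t ^+ 2) * (u.1 ^+ 2 + u.2 ^+ 2))).
  by ring.
by rewrite cayley_sqD mul1r.
Qed.

Lemma nsq_frame w (W : C2disc w) (c : nat -> R * R) i :
  nsq (frame W c i) = expR (- (2 * w (c i))).
Proof.
elim: i => [|i IH] /=.
  by rewrite /nsq /= expr0n /= addr0 -expRM_natl; congr expR; ring.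
by rewrite nsq_transport IH -expRM_natl -expRD; congr expR; ring.
Qed.

(** In complex notation the defect is b T + a kappa u, with T the transported vector and kappa the
    quantity of [transport_defect]. Squaring the sum doubles the constants: |T|^2 <= 2 (at x, with
    |u| = 1) gives 4 and 100 gives 200. *)
Lemma defect_transport w (W : C2disc w) (s M : R) x y u (a b : R) :
  C2bound W s M -> 1 <= M -> s < 1 -> nsq x <= s -> nsq y <= s ->
  2 * M ^+ 2 * nsq (y - x) <= 1 / 16 -> nsq u = expR (- (2 * w x)) -> a ^+ 2 <= 1 ->
  expR (2 * w x) *
    nsq (defect W x (y - x) (a *: u) ((a + b) *: transport W x y u - a *: u)) <=
  4 * b ^+ 2 + 200 * M ^+ 4 * nsq (y - x) ^+ 2.
Proof.
move=> HM M1 s1 xs ys small nu a1.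
have D2 := taylor1 HM s1 xs ys; have T2 := taylor2 HM s1 xs ys.
set D := w y - w x in D2 T2 *; set q := y - x in small D2 T2 *.
set al := q.1 * dx W x + q.2 * dy W x in T2.
pose t := q.2 * dx W x - q.1 * dy W x.
have t2 : t ^+ 2 <= 2 * M ^+ 2 * nsq q.
  move: (bound_dx HM xs) (bound_dy HM xs); rewrite /t /nsq.
  move: (dx W x) (dy W x) => p r pM rM.
  have pM2 : p ^+ 2 <= M ^+ 2.
    by rewrite -real_normK ?num_real// ler_pXn2r// nnegrE (le_trans _ pM).
  have rM2 : r ^+ 2 <= M ^+ 2.
    by rewrite -real_normK ?num_real// ler_pXn2r// nnegrE (le_trans _ rM).
  apply: (@le_trans _ _ ((p ^+ 2 + r ^+ 2) * (q.1 ^+ 2 + q.2 ^+ 2))).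
    by have := sqr_ge0 (q.1 * p + q.2 * r); nra.
  by apply: ler_wpM2r; [rewrite addr_ge0 ?sqr_ge0|lra].
have D16 : D ^+ 2 <= 1 / 16 by exact: le_trans small.
have [k0 k2 kap] := transport_defect M1 (nsq_ge0 q) D2 T2 t2 D16.
set k := expR (- D) in k0 k2 kap.
set kr := k * cayley_cos t - 1 + al in kap.
set ki := t - k * cayley_sin t in kap.
pose T := transport W x y u.
have -> : defect W x q (a *: u) ((a + b) *: T - a *: u) =
   (b * T.1 + a * (kr * u.1 - ki * u.2), b * T.2 + a * (kr * u.2 + ki * u.1)).
  rewrite /defect -/al -/t /T /transport -/q -/D -/k -/t /kr /ki /=.
  by rewrite /GRing.scale /=; congr pair; ring.
have nT : expR (2 * w x) * nsq T = k ^+ 2.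
  by rewrite /T nsq_transport nu mulrCA -expRD addrN expR0 mulr1.
clearbody T.
have nu1 : expR (2 * w x) * nsq u = 1 by rewrite nu -expRD addrN expR0.
apply: (@le_trans _ _ (expR (2 * w x) *
    (2 * b ^+ 2 * nsq T + 2 * a ^+ 2 * (kr ^+ 2 + ki ^+ 2) * nsq u))).
  rewrite ler_wpM2l ?expR_ge0//.
  set A1 := kr * u.1 - ki * u.2; set A2 := kr * u.2 + ki * u.1.
  have -> : 2 * a ^+ 2 * (kr ^+ 2 + ki ^+ 2) * nsq u = 2 * (a ^+ 2 * (A1 ^+ 2 + A2 ^+ 2)).
    by rewrite /A1 /A2 /nsq; ring.
  rewrite /nsq /=.
  have := sqr_ge0 (b * T.1 - a * A1); have := sqr_ge0 (b * T.2 - a * A2).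
  move: (T.1) (T.2) (A1) (A2) => X1 X2 B1 B2; nra.
have -> : expR (2 * w x) *
    (2 * b ^+ 2 * nsq T + 2 * a ^+ 2 * (kr ^+ 2 + ki ^+ 2) * nsq u) =
  2 * b ^+ 2 * (expR (2 * w x) * nsq T) +
  2 * (a ^+ 2 * (kr ^+ 2 + ki ^+ 2)) * (expR (2 * w x) * nsq u) by ring.
rewrite nT nu1 mulr1.
have h1 : b ^+ 2 * k ^+ 2 <= b ^+ 2 * 2 by rewrite ler_wpM2l ?sqr_ge0.
have h2 : a ^+ 2 * (kr ^+ 2 + ki ^+ 2) <= 1 * (100 * M ^+ 4 * nsq q ^+ 2).
  by apply: ler_pM; rewrite ?addr_ge0 ?sqr_ge0.
by lra.
Qed.

(** It vanishes at the fixed end and has unit length at the free end N. Beyond N it is 0, so that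
    the idle coordinates of a sequence do not move. *)
Definition path_field w (W : C2disc w) (N : nat) (c : nat -> R * R) (i : nat) : R * R :=
  if (i <= N)%N then (i%:R / N%:R) *: frame W c i else 0.

(** Since e^(2w) >= e^(-2M), bounded energy forces every Euclidean step to be of order N^(-1/2):
    chains become fine uniformly as N grows. *)
Lemma chain_energy_bounds w (W : C2disc w) (s M : R) (N : nat) (c : nat -> R * R) :
  C2bound W s M -> 1 <= M -> s < 1 -> (forall i, nsq (c i) <= s) ->
  (0 < N)%N -> energy w N c <= 1 ->
  N%:R * \sum_(i < N) nsq (c i.+1 - c i) <= expR (2 * M) /\
  forall i, (i < N)%N -> N%:R * nsq (c i.+1 - c i) <= expR (2 * M).
Proof.
move=> HM M1 s1 cs N0 E1.
have sum_le : N%:R * \sum_(i < N) nsq (c i.+1 - c i) <= expR (2 * M).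
  have H : expR (- (2 * M)) * (N%:R * \sum_(i < N) nsq (c i.+1 - c i)) <= 1.
    apply: le_trans E1; rewrite mulrCA /energy ler_wpM2l// mulr_sumr.
    apply: ler_sum => i _; rewrite ler_wpM2r ?nsq_ge0// ler_expR.
    by have := bound_fun HM (cs i); rewrite ler_norml; lra.
  by rewrite -(ler_pM2l (expR_gt0 (- (2 * M)))) -expRD addNr expR0.
split=> // i iN; apply: le_trans sum_le; rewrite ler_wpM2l//.
rewrite (bigD1 (Ordinal iN)) //= lerDl sumr_ge0// => j _; exact: nsq_ge0.
Qed.

(** The bound is 4 + 1: the increments 1/N of the coefficient contribute N * N * 4/N^2 = 4, and the
    failure of parallelism contributes at most 1 because N is large. *)
Lemma defect_energy_le w (W : C2disc w) (s M : R) (N : nat) (c : nat -> R * R) :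
  C2bound W s M -> 1 <= M -> s < 1 -> (forall i, nsq (c i) <= s) ->
  (0 < N)%N -> energy w N c <= 1 ->
  200 * M ^+ 4 * expR (2 * M) ^+ 2 <= N%:R ->
  N%:R * \sum_(i < N) expR (2 * w (c i)) *
    nsq (defect W (c i) (c i.+1 - c i) (path_field W N c i)
      (path_field W N c i.+1 - path_field W N c i)) <= 5.
Proof.
move=> HM M1 s1 cs N0 E1 NM.
have [sumle nule] := chain_energy_bounds HM M1 s1 cs N0 E1.
set S := expR (2 * M) in NM sumle nule.
have S1 : 1 <= S by rewrite -expR0 ler_expR; lra.
have NR : 0 < N%:R :> R by rewrite ltr0n.
have small i : (i < N)%N -> 2 * M ^+ 2 * nsq (c i.+1 - c i) <= 1 / 16.
  move=> iN; have h := nule i iN.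
  have h1 : N%:R * (2 * M ^+ 2 * nsq (c i.+1 - c i)) <= 2 * M ^+ 2 * S.
    by rewrite mulrCA ler_wpM2l// mulr_ge0 ?sqr_ge0.
  have h2 : 32 * (M ^+ 2 * S) <= 200 * M ^+ 4 * S ^+ 2.
    have -> : 200 * M ^+ 4 * S ^+ 2 = 200 * ((M ^+ 2 * S) * (M ^+ 2 * S)) by ring.
    have : 1 <= M ^+ 2 * S by rewrite -[leLHS]mulr1 ler_pM//; nra.
    by nra.
  by rewrite -(ler_pM2l NR); lra.
apply: (@le_trans _ _ (N%:R * \sum_(i < N) (4 * N%:R^-1 ^+ 2 +
    200 * M ^+ 4 * nsq (c i.+1 - c i) ^+ 2))).
  rewrite ler_wpM2l//; apply: ler_sum => i _.
  have iN := ltn_ord i.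
  rewrite /path_field (ltnW iN) iN.
  have -> : i.+1%:R / N%:R = i%:R / N%:R + N%:R^-1 :> R.
    by rewrite -natr1 mulrDl mul1r.
  apply: (@defect_transport w W s M (c i) (c i.+1) (frame W c i) (i%:R / N%:R)
    N%:R^-1 HM M1 s1 (cs _) (cs _) (small _ iN) (nsq_frame W c i)).
  rewrite expr_le1// ?divr_ge0//.
  by rewrite ler_pdivrMr// mul1r ler_nat ltnW.
rewrite big_split /= mulrDr sumr_const card_ord.
have -> : N%:R * (4 * N%:R^-1 ^+ 2 *+ N) = 4 :> R.
  by rewrite -[X in _ * X]mulr_natr; field; rewrite gt_eqF.
rewrite -mulr_sumr mulrCA.
have h3 : N%:R * (N%:R * \sum_(i < N) nsq (c i.+1 - c i) ^+ 2) <= S ^+ 2.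
  apply: (@le_trans _ _ (S * (N%:R * \sum_(i < N) nsq (c i.+1 - c i)))).
    rewrite mulrCA [leRHS]mulrCA ler_wpM2l// !mulr_sumr; apply: ler_sum => i _.
    by rewrite expr2 mulrA ler_wpM2r ?nsq_ge0// nule.
  by rewrite expr2 ler_wpM2l// expR_ge0.
have h4 : N%:R * (200 * M ^+ 4 * (N%:R * \sum_(i < N) nsq (c i.+1 - c i) ^+ 2)) <= N%:R * 1.
  rewrite mulrCA mulr1; apply: le_trans NM; apply: ler_wpM2l h3.
  by apply: mulr_ge0; [exact: ler0n|apply: exprn_ge0; lra].
by move: h4; rewrite ler_pM2l//; lra.
Qed.

(** Bounds the length of a chain by its energy, which brings [complete_bounded_conn] to bear on
    chains. *)
Lemma chain_conn w (W : C2disc w) (s M : R) (N : nat) (c : nat -> R * R) :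
  C2bound W s M -> 1 <= M -> s < 1 -> (forall i, nsq (c i) <= s) ->
  (0 < N)%N -> energy w N c <= 1 ->
  32 * M ^+ 2 * expR (2 * M) <= N%:R ->
  forall i, (i <= N)%N -> conn w 2 (c 0%N) (c i).
Proof.
move=> HM M1 s1 cs N0 E1 NM.
have [_ nule] := chain_energy_bounds HM M1 s1 cs N0 E1.
set S := expR (2 * M) in NM nule.
have NR : 0 < N%:R :> R by rewrite ltr0n.
have small i : (i < N)%N -> 2 * M ^+ 2 * nsq (c i.+1 - c i) <= 1 / 16.
  move=> iN; have h := nule i iN.
  have h1 : N%:R * (2 * M ^+ 2 * nsq (c i.+1 - c i)) <= 2 * M ^+ 2 * S.
    by rewrite mulrCA ler_wpM2l// mulr_ge0 ?sqr_ge0.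
  by rewrite -(ler_pM2l NR); lra.
have dc i : disc (c i) by exact: le_lt_trans (cs i) s1.
(* On each segment e^w varies by a factor of at most 3/2, and p <= (1/N + N p^2)/2 for p the length
   measured at its origin. The sum is at most 3/4 (1 + E) <= 2. *)
pose a i : R := 3 / 4 * (N%:R^-1 + N%:R * (expR (2 * w (c i)) * nsq (c i.+1 - c i))).
have a0 i : 0 <= a i.
  apply: mulr_ge0; first by lra.
  by apply: addr_ge0; [rewrite invr_ge0 ler0n|rewrite !mulr_ge0 ?expR_ge0 ?nsq_ge0].
have link i : (i < N)%N -> conn w (a i) (c i) (c i.+1).
  move=> iN; apply: (conn_segment (m := 3 / 2 * expR (w (c i)))) => //.
    move=> t t01; have zs := nsq_ray_le (cs i) (cs i.+1) t01.
    have := taylor1 HM s1 (cs i) zs; set z := ray _ _ _.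
    have -> : z - c i = t *: (c i.+1 - c i).
      by rewrite [LHS]surjective_pairing [RHS]surjective_pairing /= /GRing.scale /=; congr pair; ring.
    rewrite nsqZ => h.
    have h16 : (w z - w (c i)) ^+ 2 <= (1 / 4) ^+ 2.
      apply: (le_trans h); apply: (@le_trans _ _ (1 / 16)); last by lra.
      apply: le_trans (small i iN); apply: ler_wpM2l.
        by rewrite mulr_ge0 ?sqr_ge0.
      by case/andP: t01 => t0 t1; rewrite ler_piMl ?nsq_ge0// expr_le1.
    have h4 : `|w z - w (c i)| <= 1 / 4.
      by rewrite -(ler_pXn2r (n := 2)) ?nnegrE// real_normK ?num_real.
    have [|e1 e2] := andP (@expR_le_quadratic R (w z - w (c i)) _); first by lra.
    have -> : w z = (w z - w (c i)) + w (c i) by rewrite subrK.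
    rewrite expRD ler_wpM2r ?expR_ge0//.
    by move: h4 e2 h16; rewrite ler_norml => /andP[? ?]; lra.
  pose p := expR (w (c i)) * Num.sqrt (nsq (c i.+1 - c i)).
  rewrite (_ : 3 / 2 * _ * _ = 3 / 2 * p); last by rewrite /p mulrA.
  rewrite /a.
  have -> : expR (2 * w (c i)) * nsq (c i.+1 - c i) = p ^+ 2.
    by rewrite /p exprMn sqr_sqrtr ?nsq_ge0// expRM_natl.
  have : 0 <= N%:R * (p - N%:R^-1) ^+ 2 by rewrite mulr_ge0 ?sqr_ge0.
  have -> : N%:R * (p - N%:R^-1) ^+ 2 = N%:R * p ^+ 2 - 2 * p + N%:R^-1.
    by field; rewrite gt_eqF.
  by lra.
have suma : \sum_(0 <= i < N) a i <= 2.
  rewrite big_mkord /a -mulr_sumr big_split /= sumr_const card_ord -mulr_sumr.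
  have -> : N%:R^-1 *+ N = 1 :> R by rewrite -[LHS]mulr_natr mulVf// gt_eqF.
  by move: E1; rewrite /energy; lra.
move=> i iN; apply: (conn_le (r := \sum_(0 <= j < i) a j)).
  elim: i iN => [|i IH] iN; first by apply: conn_refl; rewrite ?big_geq.
  by rewrite big_nat_recr//=; apply: conn_trans (IH (ltnW iN)) (link i iN).
apply: le_trans suma; rewrite [leRHS](big_cat_nat (n := i))//= lerDl.
by rewrite sumr_ge0.
Qed.

(** Chains are infinite sequences here, so that Tychonoff's theorem applies directly. *)
Lemma product_max (A : nat -> set (R * R)) (J : pointseq -> R) :
  (forall i, compact (A i)) -> (exists c : nat -> R * R, forall i, A i (c i)) ->
  (forall c : pointseq, (forall i, A i (c i)) -> {for c, continuous J}) ->
  exists2 c : nat -> R * R, (forall i, A i (c i)) &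
    forall c' : nat -> R * R, (forall i, A i (c' i)) -> J c' <= J c.
Proof.
move=> Aco [c0 Ac0] cJ.
have [||c] := compact_EVT_max _ (@tychonoff nat (fun=> (R * R)%type) A Aco) (f := J).
- by exists c0.
- by apply: continuous_in_subspaceT => c; rewrite inE => Ac; exact: cJ.
rewrite inE => Ac Hc; exists c => // c' Ac'; apply: Hc; by rewrite inE.
Qed.

Lemma continuous_mul (T : topologicalType) (F G : T -> R) (c : T) :
  {for c, continuous F} -> {for c, continuous G} ->
  {for c, continuous (fun c => F c * G c)}.
Proof. by move=> cF cG; exact: cvgM. Qed.

Lemma continuous_mulcl (T : topologicalType) (k : R) (F : T -> R) (c : T) :
  {for c, continuous F} -> {for c, continuous (fun c => k * F c)}.
Proof. by apply: continuous_mul; exact: cvg_cst. Qed.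

Lemma continuous_subl (T : topologicalType) (k : R) (F : T -> R) (c : T) :
  {for c, continuous F} -> {for c, continuous (fun c => k - F c)}.
Proof. by move=> cF; apply: cvgB; [exact: cvg_cst|exact: cF]. Qed.

Lemma continuous_sum_ord (T : topologicalType) (F : nat -> T -> R) (n : nat) (c : T) :
  (forall i, {for c, continuous (F i)}) ->
  {for c, continuous (fun c => \sum_(i < n) F i c)}.
Proof.
move=> cF; elim: n => [|n IH].
  have -> : (fun c => \sum_(i < 0) F i c) = fun=> 0.
    by apply/funext => u; rewrite big_ord0.
  exact: cvg_cst.
have -> : (fun c => \sum_(i < n.+1) F i c) = fun c => \sum_(i < n) F i c + F n c.
  by apply/funext => u; rewrite big_ord_recr.
by apply: cvgD; [exact: IH|exact: cF].
Qed.

Lemma continuous_energy w (N : nat) (c : pointseq) :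
  (forall z, disc z -> {for z, continuous w}) -> (forall i, disc (c i)) ->
  {for c, continuous (energy w N : pointseq -> R)}.
Proof.
move=> cw dc.
have cproj i : (fun c : pointseq => c i) @ c --> c i.
  exact: (@proj_continuous nat (fun=> (R * R)%type) i c).
suff cs : {for c, continuous (fun c : pointseq =>
    \sum_(i < N) expR (2 * w (c i)) * nsq (c i.+1 - c i))}.
  exact: (@continuous_mulcl pointseq N%:R _ c cs).
apply: (@continuous_sum_ord _ (fun i (c : pointseq) =>
   expR (2 * w (c i)) * nsq (c i.+1 - c i))) => i.
apply: (@continuous_mul pointseq
  (fun c => expR (2 * w (c i))) (fun c => nsq (c i.+1 - c i))).
  have c1 := @cvg_comp _ _ _ _ w _ _ _ (cproj i) (cw _ (dc i)).
  have c2 := @continuous_mulcl pointseq 2 _ c c1.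
  exact: (@cvg_comp _ _ _ _ (@expR R) _ _ _ c2 (@continuous_expR R _)).
have c1 : (fun c : pointseq => c i.+1 - c i) @ c -->
    c i.+1 - c i by exact: (cvgB (cproj i.+1) (cproj i)).
exact: (@cvg_comp _ _ _ _ (@nsq R) _ _ _ c1 (@continuous_nsq R _)).
Qed.

(* The constant is [C + (4 B + 2 C) + 2 (1 + B)^2] with the bound [B = 5] of
   [defect_energy_le]. *)
Lemma schwarz_yau w (W : C2disc w) (C : R) : complete_metric w -> 0 <= C ->
  (forall z, disc z -> laplacian w z <= C * expR (2 * w z)) ->
  forall o, disc o -> expR (2 * (hyp o - w o)) <= 92 + 3 * C.
Proof.
move=> compl C0 lapC o disc_o.
have cw z (dz : disc z) : {for z, continuous w} := (C1_fun W dz).1.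
have [s s1 Hs] := complete_bounded_conn cw compl disc_o (ltr0n R 2).
have os : nsq o < s by apply: Hs; apply: conn_refl.
have [M M1 HM] := C2bound_ex W s1.
set S := expR (2 * M).
have S1 : 1 <= S by rewrite -expR0 ler_expR; lra.
pose K := 200 * M ^+ 4 * S ^+ 2.
have K0 : 0 <= K.
  apply: mulr_ge0; last exact: sqr_ge0.
  by apply: mulr_ge0; [exact: ler0n|apply: exprn_ge0; lra].
pose N := (Num.bound K).+1.
have NK : K <= N%:R.
  by apply: ltW; apply: (lt_le_trans (archi_boundP K0)); rewrite ler_nat leqnSn.
have NK' : 32 * M ^+ 2 * S <= N%:R.
  apply: le_trans NK; rewrite /K.
  have -> : 200 * M ^+ 4 * S ^+ 2 = 200 * ((M ^+ 2 * S) * (M ^+ 2 * S)) by ring.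
  have : 1 <= M ^+ 2 * S by rewrite -[leLHS]mulr1 ler_pM//; nra.
  by nra.
(* The first point is pinned at [o]; all others range over one compact subdisc. *)
pose A i : set (R * R) := if i == 0%N then [set o] else subdisc s.
have Asub i z : A i z -> nsq z <= s.
  by rewrite /A; case: eqP => // _ ->; exact: ltW.
pose J (c : pointseq) : R :=
  (1 - energy w N c) * expR (hyp (c N) - w (c N)).
have [|||c Ac Jmax] := @product_max A J.
- move=> i; rewrite /A; case: eqP => _; first exact: compact_set1.
  exact: compact_subdisc (ltW s1).
- by exists (fun=> o) => i; rewrite /A; case: eqP => // _; exact: ltW.
- move=> c Ac.
  have dc i : disc (c i) by apply: le_lt_trans s1; exact: Asub (Ac i).
  have cproj : (fun c : pointseq => c N) @ c --> c N.
    exact: (@proj_continuous nat (fun=> (R * R)%type) N c).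
  apply: (@continuous_mul pointseq
    (fun c => 1 - energy w N c) (fun c => expR (hyp (c N) - w (c N)))).
    have ce := @continuous_energy w N c cw dc.
    exact: (@continuous_subl pointseq 1 _ c ce).
  have c1 := @cvg_comp _ _ _ _ w _ _ _ cproj (cw _ (dc N)).
  have c2 := @cvg_comp _ _ _ _ (hypr (1 : R)) _ _ _ cproj (continuous_hypr (dc N : nsq (c N) < 1)).
  have c3 : (fun c : pointseq => hyp (c N) - w (c N)) @ c -->
    hyp (c N) - w (c N) by exact: (cvgB c2 c1).
  exact: (@cvg_comp _ _ _ _ (@expR R) _ _ _ c3 (@continuous_expR R _)).
have cs i : nsq (c i) <= s by exact: Asub (Ac i).
have dc i : disc (c i) by exact: le_lt_trans (cs i) s1.
have c0 : c 0%N = o by have := Ac 0%N; rewrite /A eqxx.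
have Jo : expR (hyp o - w o) <= J c.
  have := Jmax (fun=> o); rewrite {1}/J /energy big1; last first.
    by move=> i _; rewrite subrr /nsq /= expr0n /= addr0 mulr0.
  rewrite mulr0 subr0 mul1r; apply => i.
  by rewrite /A; case: eqP => // _; exact: ltW.
have E1 : energy w N c < 1.
  have : 0 < J c by apply: lt_le_trans Jo; exact: expR_gt0.
  by rewrite /J pmulr_lgt0 ?expR_gt0// subr_gt0.
(* The inequality is strict: the maximiser stays off the boundary of the subdisc, so small
   variations remain competitors. *)
have cin i : (i <= N)%N -> nsq (c i) < s.
  by move=> iN; apply: Hs; rewrite -c0; exact: (chain_conn HM M1 s1 cs _ (ltW E1) NK' iN).
pose V := path_field W N c.
have V0 : V 0%N = 0 by rewrite /V /path_field /= mul0r scale0r.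
have near_max (V' : nat -> R * R) : (forall i, (N < i)%N || (i == 0%N) -> V' i = 0) ->
  \forall t \near (0 : R), J (fun i => ray (c i) (V' i) t) <= J c.
  move=> V'0.
  have ray_0 i t : V' i = 0 -> ray (c i) (V' i) t = c i.
    by move=> ->; rewrite /ray /= !mulr0 !addr0; case: (c i).
  have near_in n : (n <= N.+1)%N ->
      \forall t \near (0 : R), forall i, (i < n)%N -> nsq (ray (c i) (V' i) t) <= s.
    elim: n => [_|n IH nN]; first by near=> t.
    have H1 := IH (ltnW nN).
    have cr : nsq (ray (c n) (V' n) t) @[t --> (0 : R)] --> nsq (c n).
      rewrite -{2}(ray0 (c n) (V' n)).
      exact: (@cvg_comp _ _ _ _ (@nsq R) _ _ _ (@continuous_ray _ (c n) (V' n) 0)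
        (@continuous_nsq R _)).
    have H2 : \forall t \near (0 : R), nsq (ray (c n) (V' n) t) <= s.
      by apply: (cvgr_le _ cr); apply: cin; rewrite -ltnS.
    near=> t => i; rewrite ltnS leq_eqVlt => /predU1P[->|ni]; first by near: t.
    by move: i ni; near: t.
  have H := near_in N.+1 (leqnn _).
  near=> t; apply: Jmax => i.
  have Ht : forall i, (i < N.+1)%N -> nsq (ray (c i) (V' i) t) <= s by near: t.
  have [iN|Ni] := leqP i N; last by rewrite ray_0 ?V'0 ?Ni.
  have [->|i0] := eqVneq i 0%N; first by rewrite ray_0 ?V'0.
  by rewrite /A (negPf i0); exact: Ht.
have V'0 i : (N < i)%N || (i == 0%N) -> V i = 0.
  move=> /orP[Ni|/eqP ->//].
  by rewrite /V /path_field leqNgt Ni.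
have := @second_variation R w W N c V C 5 (fun i _ => dc i) E1 C0 lapC.
have N0 : (0 < N)%N by [].
have NR : 0 < N%:R :> R by rewrite ltr0n.
move=> /(_ _ _ _ _)/=; rewrite -/(energy w N c) => H2.
have {}H2 : expR (2 * (hyp (c N) - w (c N))) <=
   C + (4 * 5 + 2 * C) / (1 - energy w N c) + 2 * ((1 + 5) / (1 - energy w N c)) ^+ 2.
  apply: H2.
  - move=> i iN; rewrite /V /path_field iN nsqZ nsq_frame ler_piMl ?expR_ge0//.
    rewrite expr_le1 ?divr_ge0//.
    by rewrite ler_pdivrMr// mul1r ler_nat.
  - by rewrite /V /path_field leqnn nsqZ nsq_frame divff ?gt_eqF// expr1n mul1r.
  - exact: (defect_energy_le HM M1 s1 cs N0 (ltW E1) NK).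
  - move=> V' [->|->]; apply: near_max => i iN; first exact: V'0.
    by rewrite V'0//; exact: (congr1 (fun a : R => (a, 0)) (oppr0 R)).
have En0 : 0 <= energy w N c.
  by rewrite mulr_ge0// sumr_ge0// => i _; rewrite mulr_ge0 ?expR_ge0 ?nsq_ge0.
(* Multiplication by eta^2 clears the denominators and leaves C eta^2 + (20 + 2C) eta + 72 with eta
   <= 1. *)
set eta := 1 - energy w N c in H2.
have eta0 : 0 < eta by rewrite subr_gt0.
have eta1 : eta <= 1 by rewrite lerBlDr lerDl.
have exp2 (u : R) : expR (2 * u) = expR u ^+ 2 by rewrite -expRM_natl.
rewrite exp2 in H2; rewrite exp2.
have Jo' : expR (hyp o - w o) <= eta * expR (hyp (c N) - w (c N)) by exact: Jo.
apply: (@le_trans _ _ ((eta * expR (hyp (c N) - w (c N))) ^+ 2)).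
  by rewrite ler_pXn2r ?nnegrE ?mulr_ge0 ?expR_ge0// ltW.
rewrite exprMn.
apply: (@le_trans _ _ (eta ^+ 2 * (C + (4 * 5 + 2 * C) / eta + 2 * ((1 + 5) / eta) ^+ 2))).
  by rewrite ler_wpM2l ?sqr_ge0.
have -> : eta ^+ 2 * (C + (4 * 5 + 2 * C) / eta + 2 * ((1 + 5) / eta) ^+ 2) =
   C * eta ^+ 2 + (20 + 2 * C) * eta + 72 by field; rewrite gt_eqF.
have h1 : C * eta ^+ 2 <= C * 1 by rewrite ler_wpM2l// expr_le1// ltW.
have h2 : (20 + 2 * C) * eta <= (20 + 2 * C) * 1 by rewrite ler_wpM2l//; lra.
by lra.
Unshelve. all: by end_near. Qed.

End SchwarzYau.

(** * Maximum principles along the flow *)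
Section MaximumPrinciple.
Context {R : realType}.
Implicit Types (u : R * R -> R) (z : R * R).

(* A pointwise Laplacian that only requires second order expansions along the
   two coordinate directions. *)
Definition laplace_at u z (L : R) := exists b1 b2 c1 c2 : R,
  [/\ jet2 (fun t => u (ray z (1, 0) t)) b1 c1,
      jet2 (fun t => u (ray z (0, 1) t)) b2 c2 & L = c1 + c2].

Lemma C2disc_laplace_at u (U : C2disc u) z : disc z -> laplace_at u z (laplacian u z).
Proof.
move=> dz; exists (dx U z), (dy U z), (dxx U z), (dyy U z); split.
- by apply: (jet2_eq (jet2_ray U (1, 0) dz)) => /=; ring.
- by apply: (jet2_eq (jet2_ray U (0, 1) dz)) => /=; ring.
- exact: laplacianE.
Qed.

Lemma laplace_atB u u' z (L L' : R) : laplace_at u z L -> laplace_at u' z L' ->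
  laplace_at (fun z => u z - u' z) z (L - L').
Proof.
move=> [b1 [b2 [c1 [c2 [j1 j2 ->]]]]] [d1 [d2 [e1 [e2 [k1 k2 ->]]]]].
exists (b1 - d1), (b2 - d2), (c1 - e1), (c2 - e2).
by split; [exact: jet2B|exact: jet2B|ring].
Qed.

Lemma laplace_atZ u z (k L : R) : laplace_at u z L ->
  laplace_at (fun z => k * u z) z (k * L).
Proof.
move=> [b1 [b2 [c1 [c2 [j1 j2 ->]]]]].
exists (k * b1), (k * b2), (k * c1), (k * c2).
by split; [exact: jet2Z|exact: jet2Z|ring].
Qed.

Lemma laplace_at_max u z (L : R) : laplace_at u z L ->
  (\forall z' \near z, u z' <= u z) -> L <= 0.
Proof.
move=> [b1 [b2 [c1 [c2 [j1 j2 ->]]]]] umax.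
have H V : \forall t \near (0 : R), u (ray z V t) <= u (ray z V 0).
  have nu : nbhs (ray z V 0) [set x | u x <= u z] by rewrite ray0.
  by rewrite ray0; exact: (@continuous_ray _ z V 0 _ nu).
have [_ c1_le0] := jet2_max j1 (H _); have [_ c2_le0] := jet2_max j2 (H _).
by rewrite -[leRHS]addr0 lerD.
Qed.

Lemma laplace_at_hypr (rho : R) z : 0 < rho -> nsq z < rho ->
  laplace_at (hypr rho) z (expR (2 * hypr rho z)).
Proof.
move=> r0 zr; have d0 : 0 < rho - nsq z by rewrite subr_gt0.
do 4!eexists; split; [exact: jet2_hypr|exact: jet2_hypr|].
by rewrite expR_hypr// /nsq /=; field; rewrite gt_eqF.
Qed.

Lemma hypr_blowup (rho M : R) z0 : nsq z0 < rho ->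
  exists rho', [/\ nsq z0 < rho', rho' < rho & forall z, nsq z = rho' -> M < hypr rho z].
Proof.
move=> z0r; pose d := Num.min ((rho - nsq z0) / 2) (expR (ln (4 * rho) / 2 - M - 1)).
have d0 : 0 < d by rewrite lt_min expR_gt0 andbT; lra.
have dz : d <= (rho - nsq z0) / 2 by rewrite ge_min lexx.
exists (rho - d); split; [lra|lra|] => z zr.
rewrite /hypr zr (_ : rho - (rho - d) = d); last by ring.
have : ln d <= ln (4 * rho) / 2 - M - 1.
  by rewrite -[leRHS]expRK ler_ln ?posrE ?expR_gt0// ge_min lexx orbT.
by lra.
Qed.

(** At a space-time maximum over an initial time interval only the past is compared, and at t = T
    the flow has only a past. The parameter [a] keeps s inside the time interval. *)
Definition left_derivative (f : R -> R) (a t l : R) := forall e : R, 0 < e ->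
  exists2 d : R, 0 < d & forall s, a <= s -> s < t -> t - s < d ->
    `|f t - f s - l * (t - s)| <= e * (t - s).

Lemma left_derivativeB (f g : R -> R) (a t l m : R) :
  left_derivative f a t l -> left_derivative g a t m ->
  left_derivative (fun s => f s - g s) a t (l - m).
Proof.
move=> Hf Hg e e0; have e20 : 0 < e / 2 by lra.
have [d1 d10 H1] := Hf _ e20; have [d2 d20 H2] := Hg _ e20.
exists (Num.min d1 d2); first by rewrite lt_min d10.
move=> s as_ st; rewrite lt_min => /andP[/(H1 s as_ st) h1 /(H2 s as_ st) h2].
by move: h1 h2; rewrite !ler_norml => /andP[? ?] /andP[? ?]; apply/andP; split; lra.
Qed.

Lemma left_derivative_shift (f : R -> R) (a b t l : R) : 0 <= b ->
  left_derivative f a (t + b) l -> left_derivative (fun s => f (s + b)) a t l.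
Proof.
move=> b0 Hf e /Hf[d d0 H]; exists d => // s as_ st ts.
have -> : t - s = t + b - (s + b) by ring.
by apply: H; lra.
Qed.

Lemma quotient_left_derivative (f : R -> R) (T t l : R) : 0 < t <= T ->
  (f s - f t) / (s - t) @[s --> within `[0, T] t^'] --> l ->
  left_derivative f 0 t l.
Proof.
move=> /andP[t0 tT] /cvgrPdist_le H e /H /nbhs_ballP[d /= d0 Hd]; exists d => // s s0 st ts.
have := Hd s; rewrite /ball /= gtr0_norm ?subr_gt0// => /(_ ts).
rewrite lt_eqF// in_itv /= s0 (le_trans (ltW st) tT) => /(_ isT isT) h.
have ts0 : 0 < t - s by rewrite subr_gt0.
rewrite -ler_pdivrMr// -[X in _ / X](gtr0_norm ts0) -normf_div -normrN.
apply: le_trans h; rewrite le_eqVlt; apply/orP; left; apply/eqP; congr `|_|.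
by field; rewrite subr_eq0 lt_eqF//= gt_eqF.
Qed.

Lemma is_derive_left_derivative (f : R -> R) (a t l : R) :
  is_derive t 1 f l -> left_derivative f a t l.
Proof.
move=> df e e0.
have cv : h^-1 *: (f (h *: (1 : R) + t) - f t) @[h --> 0^'] --> l.
  by case: df => df <-; exact: df.
move/cvgrPdist_le : cv => /(_ e e0) /nbhs_ballP[d /= d0 Hd]; exists d => // s as_ st ts.
have ts0 : 0 < t - s by rewrite subr_gt0.
have := Hd (s - t); rewrite /ball /= sub0r opprB gtr0_norm// => /(_ ts).
rewrite subr_eq0 lt_eqF// => /(_ isT).
rewrite [(s - t) *: (1 : R)]mulr1 subrK => h.
rewrite -ler_pdivrMr// -[X in _ / X](gtr0_norm ts0) -normf_div -normrN.
apply: le_trans h; rewrite le_eqVlt; apply/orP; left; apply/eqP; congr `|_|.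
by rewrite /GRing.scale /=; field; rewrite subr_eq0 lt_eqF//= gt_eqF.
Qed.

(** If m > l, then f - b has the negative left derivative l - m at t, hence larger values just
    before t. *)
Lemma left_derivative_compare (f b : R -> R) (a t l m : R) : a < t ->
  left_derivative f a t l -> left_derivative b a t m ->
  (forall s, a <= s < t -> f s - b s <= f t - b t) -> m <= l.
Proof.
move=> at_ Hf Hb fb; have Hd := left_derivativeB Hf Hb.
rewrite leNgt; apply/negP => lm.
have e0 : 0 < (m - l) / 2 by lra.
have [d d0 H] := Hd _ e0.
pose s := t - Num.min (d / 2) (t - a).
have sd : Num.min (d / 2) (t - a) <= d / 2 by rewrite ge_min lexx.
have sa : Num.min (d / 2) (t - a) <= t - a by rewrite ge_min lexx orbT.
have s0 : 0 < Num.min (d / 2) (t - a) by rewrite lt_min; apply/andP; split; lra.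
have as_ : a <= s by rewrite /s; lra.
have st : s < t by rewrite /s; lra.
have tsd : t - s < d by rewrite /s; lra.
have := H s as_ st tsd; rewrite ler_norml => /andP[_ h].
have := fb s; rewrite as_ st => /(_ isT) h2.
have ts : 0 < t - s by rewrite subr_gt0.
have : 0 < (m - l) * (t - s) by rewrite mulr_gt0// subr_gt0.
by lra.
Qed.

End MaximumPrinciple.

(** * Regularity of a Ricci flow *)

Section Flow.
Context {R : realType}.
Context (T : R) (v : R -> R * R -> R) (flow : ricci_flow T v).
Implicit Types z : R * R.

Lemma flow_C2disc (t : R) : t \in `[0, T] -> C2disc (v t).
Proof.
by move=> tT; apply: locally_C2_C2disc; apply: smooth_on_slice (flow.1) tT.
Qed.

Lemma flow_left_derivative (t : R) z : 0 < t <= T -> disc z ->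
  left_derivative (fun s => v s z) 0 t (- gauss_curvature (v t) z).
Proof.
move=> t0T dz; have tT : t \in `[0, T].
  by rewrite in_itv /=; case/andP: t0T => /ltW -> ->.
exact: quotient_left_derivative t0T (flow.2 t z tT dz).
Qed.

Lemma flow_continuous :
  {within `[0, T] `*` disc, continuous (fun p : R * (R * R) => v p.1 p.2)}.
Proof.
apply/subspace_continuousP => p Sp.
have [U [F [oU Up CF FE]]] := (flow.1) p Sp.
have cF : F @ p --> F p by have := CF 0%N; apply.
rewrite (FE p Sp Up) in cF.
have H1 : F @ within (`[0, T] `*` disc) (nbhs p) --> v p.1 p.2.
  exact: cvg_within_filter.
apply: cvg_trans H1; apply: near_eq_cvg.
have nU : nbhs p U by exact: open_nbhs_nbhs.
by apply: filterS nU => x Ux xab; apply: FE.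
Qed.

Lemma flow_time_continuous (t : R) z : t \in `[0, T] -> disc z ->
  v s z @[s --> within `[0, T] (nbhs t)] --> v t z.
Proof.
move=> tT dz; have := flow_continuous => /subspace_continuousP/(_ (t, z)).
move=> /(_ (conj tT dz)) H P /H /nbhs_ballP[e /= e0 He].
apply/nbhs_ballP; exists e => //= s ts sT; apply: (He (s, z)); last by split.
by split => //=; exact: ballxx.
Qed.

End Flow.

(** * Comparison with hyperbolic metrics and between flows *)

Section Comparison.
Context {R : realType}.
Implicit Types (u : R * R -> R) (v w : R -> R * R -> R) (z : R * R) (T rho : R).

Lemma near_nsq_lt z (s : R) : nsq z < s -> \forall z' \near z, nsq z' < s.
Proof. by move=> zs; exact: (cvgr_lt _ (@continuous_nsq R z)). Qed.

(** Ahlfors' Schwarz lemma. On the smaller disc u is bounded while [hypr rho] blows up, so the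
    difference has an interior maximum, where e^(2u) <= Lap u <= Lap hypr = e^(2 hypr). *)
Lemma le_hypr u (U : C2disc u) rho z :
  (forall z, disc z -> expR (2 * u z) <= laplacian u z) ->
  0 < rho < 1 -> nsq z < rho -> u z <= hypr rho z.
Proof.
move=> uL /andP[r0 r1] zr; rewrite leNgt; apply/negP => uz.
have cu x (dx : disc x) : {for x, continuous u} := (C1_fun U dx).1.
have [M M0 HM] := bounded_subdisc cu r1.
have [s [zs sr Hs]] := hypr_blowup M zr.
have s1 : s < 1 by exact: lt_trans sr r1.
have cg : {within subdisc s, continuous (fun z => u z - hypr rho z)}.
  apply: continuous_in_subspaceT => x; rewrite inE => xs.
  apply: cvgB; first exact: cu (subdisc_disc s1 xs).
  by apply: continuous_hypr; exact: le_lt_trans xs sr.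
have [|c] := compact_EVT_max _ (compact_subdisc (ltW s1)) cg.
  by exists z; exact: ltW.
rewrite inE => cs Hc.
have gc : 0 < u c - hypr rho c.
  apply: lt_le_trans (Hc z _); first by rewrite subr_gt0.
  by rewrite inE; exact: ltW.
have cr : nsq c < rho by exact: le_lt_trans cs sr.
have cs' : nsq c < s.
  rewrite lt_neqAle (cs : nsq c <= s) andbT; apply/eqP => /Hs hc.
  have := HM c (ltW cr); rewrite ler_norml => /andP[_ uc].
  by move: gc; lra.
have dc : disc c by exact: lt_trans cr r1.
have := laplace_at_max (laplace_atB (C2disc_laplace_at U dc) (laplace_at_hypr r0 cr)).
move=> /(_ _); rewrite subr_le0 => H.
have : expR (2 * u c) <= expR (2 * hypr rho c).
  apply: le_trans (uL c dc) _; apply: H; near=> x; apply: Hc; rewrite inE.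
  by apply: ltW; near: x; exact: near_nsq_lt.
by rewrite ler_expR; move: gc; lra.
Unshelve. all: by end_near. Qed.

Lemma compact_cylinder T (s : R) : s <= 1 -> compact (`[0, T] `*` subdisc s).
Proof. by move=> s1; apply: compact_setX; [exact: segment_compact|exact: compact_subdisc]. Qed.

Lemma cylinder_subset T (s : R) : s < 1 -> `[0, T] `*` subdisc s `<=` `[0, T] `*` @disc R.
Proof. by move=> s1 p [tT ps]; split => //; exact: subdisc_disc ps. Qed.

(** The barrier is itself a Ricci flow: it scales the hyperbolic metric of the smaller disc by 1 +
    2t. *)
Lemma flow_le_hypr T v rho (t : R) z : ricci_flow T v ->
  (forall z, disc z -> gauss_curvature (v 0) z <= -1) ->
  0 < rho < 1 -> nsq z < rho -> t \in `[0, T] ->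
  v t z <= hypr rho z + ln (1 + 2 * t) / 2.
Proof.
move=> flow K0 r01 zr tT; have /andP[r0 r1] := r01.
have /andP[t0 tT'] : 0 <= t <= T by move: tT; rewrite in_itv.
have T0 : 0 <= T by exact: le_trans tT'.
have in0 : 0 \in `[0, T] by rewrite in_itv /= lexx.
have ln_ge0' (s : R) : 0 <= s -> 0 <= ln (1 + 2 * s).
  by move=> s0; rewrite ln_ge0//; lra.
have init x : nsq x < rho -> v 0 x <= hypr rho x.
  apply: (le_hypr (flow_C2disc flow in0)) r01 => y dy.
  have := K0 y dy; rewrite /gauss_curvature mulNr lerN2 => h.
  by rewrite -(ler_pM2l (expR_gt0 (- (2 * v 0 y)))) -expRD addNr expR0.
rewrite leNgt; apply/negP => vz.
pose gap := v t z - (hypr rho z + ln (1 + 2 * t) / 2).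
have gap0 : 0 < gap by rewrite subr_gt0.
(* The extra term eps t makes the time inequality strict, yet is too small to close the gap at (t,
   z). *)
pose eps := gap / (T + 1).
have eps0 : 0 < eps by rewrite divr_gt0//; lra.
have epsT : eps * t < gap.
  by rewrite /eps mulrAC ltr_pdivrMr; [nra|lra].
have cv := flow_continuous flow.
have cv_rho : {within `[0, T] `*` subdisc rho, continuous (fun p : R * (R * R) => v p.1 p.2)}.
  exact: continuous_subspaceW (cylinder_subset r1) cv.
have [|q _ Hq] := compact_EVT_max _ (compact_cylinder (T := T) (ltW r1)) cv_rho.
  by exists (t, z); split => //=; exact: ltW.
(* On this circle the barrier exceeds the maximum of v, which excludes the lateral boundary. *)
have [s [zs sr Hs]] := hypr_blowup (v q.1 q.2) zr.
have s1 : s < 1 by exact: lt_trans sr r1.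
pose Q (p : R * (R * R)) := v p.1 p.2 - (hypr rho p.2 + (ln (1 + 2 * p.1) / 2 + eps * p.1)).
have cQ : {within `[0, T] `*` subdisc s, continuous Q}.
  apply/subspace_continuousP => p pS; have [/=] := pS; rewrite in_itv /= => /andP[p0 pT] ps.
  apply: cvgB.
    have := continuous_subspaceW (cylinder_subset s1) cv.
    by move=> /subspace_continuousP/(_ p pS).
  apply: cvg_within_filter.
  have c1 : (fun p : R * (R * R) => p.1) @ p --> p.1 by exact: cvg_fst.
  have c2 : (fun p : R * (R * R) => p.2) @ p --> p.2 by exact: cvg_snd.
  have c3 : {for p.2, continuous (hypr rho)} by apply: continuous_hypr; exact: le_lt_trans ps sr.
  have c4 : (fun p : R * (R * R) => 1 + 2 * p.1) @ p --> 1 + 2 * p.1.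
    by apply: cvgD; [exact: cvg_cst|apply: cvgM; [exact: cvg_cst|exact: c1]].
  have pos : 0 < 1 + 2 * p.1 by lra.
  apply: cvgD; first exact: (@cvg_comp _ _ _ _ (hypr rho) _ _ _ c2 c3).
  apply: cvgD; last by apply: cvgM; [exact: cvg_cst|exact: c1].
  apply: cvgM; last exact: cvg_cst.
  exact: (@cvg_comp _ _ _ _ (@ln R) _ _ _ c4 (continuous_ln pos)).
have [|[t1 z1]] := compact_EVT_max _ (compact_cylinder (T := T) (ltW s1)) cQ.
  by exists (t, z); split => //=; exact: ltW.
rewrite inE => -[/= t1T z1s] Hc.
have HQ (s' : R) x : s' \in `[0, T] -> nsq x <= s -> Q (s', x) <= Q (t1, z1).
  by move=> sT xs; apply: Hc; rewrite inE; split.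
have Qpos : 0 < Q (t1, z1).
  apply: lt_le_trans (HQ t z tT (ltW zs)); rewrite /Q /=.
  by move: epsT; rewrite /gap; lra.
have /andP[t10 t1T'] : 0 <= t1 <= T by move: t1T; rewrite /= in_itv.
have z1r : nsq z1 < rho by exact: le_lt_trans z1s sr.
have et1 : 0 <= eps * t1 by rewrite mulr_ge0// ltW.
have z1s' : nsq z1 < s.
  rewrite lt_neqAle (z1s : nsq z1 <= s) andbT; apply/eqP => /Hs h1.
  have := Hq (t1, z1); rewrite inE => /(_ (conj t1T (ltW z1r))) /= h2.
  by move: Qpos; rewrite /Q /=; have := ln_ge0' t1 t10; lra.
have t1_gt0 : 0 < t1.
  rewrite lt_neqAle t10 andbT; apply/eqP => t1_0.
  have := init z1 z1r; move: Qpos; rewrite /Q /= -t1_0 !mulr0 !addr0 ln1 mul0r addr0.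
  by lra.
have dz1 : disc z1 by exact: lt_trans z1r r1.
have hT1 : t1 \in `[0, T] by exact: t1T.
have space : laplacian (v t1) z1 <= expR (2 * hypr rho z1).
  rewrite -subr_le0.
  apply: (laplace_at_max (laplace_atB (C2disc_laplace_at (flow_C2disc flow hT1) dz1)
    (laplace_at_hypr r0 z1r))).
  near=> x; have := HQ t1 x hT1; rewrite /Q /= => /(_ _) h.
  have xs : nsq x <= s by apply: ltW; near: x; exact: near_nsq_lt.
  by have := h xs; lra.
have db : is_derive t1 1 (fun s => ln (1 + 2 * s) / 2 + eps * s) ((1 + 2 * t1)^-1 + eps).
  have pos : 0 < 1 * 1 + 2 * t1 by lra.
  have d1 := @is_derive_affine R (@ln R) 2 1 t1 (2 * t1 + 1)^-1.
  have {}d1 : is_derive t1 1 (fun s => ln (2 * s + 1)) (2 * (2 * t1 + 1)^-1).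
    by apply: d1; apply: is_derive1_ln; lra.
  have := is_deriveD (is_deriveZ (1 / 2) d1) (is_deriveZ eps (is_derive_id t1 (1 : R))).
  rewrite (_ : _ + _ = (fun s => ln (1 + 2 * s) / 2 + eps * s)); last first.
    by apply/funext => x; rewrite !fctE /= /GRing.scale /= [2 * x + 1]addrC; ring.
  move=> /is_derive_eq; apply; rewrite /GRing.scale /= [2 * t1 + 1]addrC.
  by field; lra.
have := left_derivative_compare t1_gt0
  (flow_left_derivative flow (introT andP (conj t1_gt0 t1T')) dz1)
  (is_derive_left_derivative 0 db).
move=> /(_ _); rewrite /gauss_curvature mulNr opprK => H.
have {}H : (1 + 2 * t1)^-1 + eps <= expR (- (2 * v t1 z1)) * laplacian (v t1) z1.
  apply: H => s' /andP[s'0 s't].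
  have := HQ s' z1; rewrite in_itv /= s'0 (le_trans (ltW s't) t1T') /Q /=.
  by move=> /(_ isT z1s); lra.
have pos : 0 < 1 + 2 * t1 by lra.
have : expR (- (2 * v t1 z1)) * laplacian (v t1) z1 <= (1 + 2 * t1)^-1.
  apply: (@le_trans _ _ (expR (- (2 * v t1 z1)) * expR (2 * hypr rho z1))).
    by rewrite ler_wpM2l ?expR_ge0.
  rewrite -expRD -[leRHS]lnK ?posrE ?invr_gt0// ler_expR lnV ?posrE//.
  by move: Qpos; rewrite /Q /=; lra.
by lra.
Unshelve. all: by end_near. Qed.

(** Taking rho = (1 + |z|^2)/2 halves the distance term rho - |z|^2 relative to 1 - |z|^2, which
    costs ln 2. *)
Lemma flow_le_hyp T v (t : R) z : ricci_flow T v ->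
  (forall z, disc z -> gauss_curvature (v 0) z <= -1) ->
  t \in `[0, T] -> disc z -> v t z <= hyp z + (ln 2 + ln (1 + 2 * T) / 2).
Proof.
move=> flow K0 tT dz; have n1 : nsq z < 1 by [].
have n0 := nsq_ge0 z.
have := @flow_le_hypr T v ((1 + nsq z) / 2) t z flow K0.
move=> /(_ _ _ tT) H; apply: le_trans (H _ _) _; [apply/andP; split; lra|lra|].
rewrite /hypr (_ : (1 + nsq z) / 2 - nsq z = (1 - nsq z) / 2); last by field.
rewrite ln_div ?posrE//; last by rewrite subr_gt0.
have /andP[t0 tT'] : 0 <= t <= T by move: tT; rewrite in_itv.
have h1 : ln (1 + 2 * t) <= ln (1 + 2 * T) by rewrite ler_ln ?posrE; lra.
have h2 : ln (4 * ((1 + nsq z) / 2)) <= ln (4 * 1) :> R by rewrite ler_ln ?posrE; lra.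
by lra.
Qed.

Lemma hyp_ge0 z : disc z -> 0 <= hyp z.
Proof.
move=> dz; have n1 : nsq z < 1 by []; have n0 := nsq_ge0 z.
have h1 : 0 <= ln (4 * 1) :> R by rewrite ln_ge0//; lra.
have h2 : ln (1 - nsq z) <= 0 by rewrite ln_le0//; lra.
by rewrite /hypr; lra.
Qed.

Lemma shift_flow_continuous T w (delta s : R) : ricci_flow T w -> 0 <= delta -> s < 1 ->
  {within `[0, T - delta] `*` subdisc s,
    continuous (fun p : R * (R * R) => w (p.1 + delta) p.2)}.
Proof.
move=> flow d0 s1; apply/subspace_continuousP => p [].
rewrite /= in_itv /= => /andP[p0 pT] ps.
have qS : (`[0, T] `*` disc) (p.1 + delta, p.2).
  by split; [rewrite /= in_itv /=; apply/andP; split; lra|exact: subdisc_disc ps].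
have := flow_continuous flow => /subspace_continuousP/(_ _ qS) H P nP.
have {}nP : nbhs (p.1 + delta, p.2)
    [set q | (`[0, T] `*` disc) q -> P (w q.1 q.2)] := H P nP.
have cs : (fun p : R * (R * R) => (p.1 + delta, p.2)) @ p --> (p.1 + delta, p.2).
  have c1 : (fun p : R * (R * R) => p.1 + delta) @ p --> p.1 + delta.
    by apply: cvgD; [exact: cvg_fst|exact: cvg_cst].
  have c2 : (fun p : R * (R * R) => p.2) @ p --> p.2 by exact: cvg_snd.
  exact: (continuous_pair c1 c2).
have {}nP : nbhs p [set x | (`[0, T] `*` disc) (x.1 + delta, x.2) ->
    P (w (x.1 + delta) x.2)] := cs _ nP.
suff G : nbhs p [set x | (`[0, T - delta] `*` subdisc s) x -> P (w (x.1 + delta) x.2)].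
  exact: G.
apply: (filterS _ nP) => -[t x] /= HP [tT xs]; apply: HP; split; last exact: (subdisc_disc s1 xs).
move: tT; rewrite /= !in_itv /= => /andP[t0 tT].
by apply/andP; split; lra.
Qed.

Lemma flow_increment_ge T w (C delta : R) z : ricci_flow T w ->
  (forall (t : R) z, t \in `[0, T] -> disc z -> gauss_curvature (w t) z <= C) ->
  0 < delta < T -> disc z -> w 0 z - C * delta <= w delta z.
Proof.
move=> flow KC /andP[d0 dT] dz.
rewrite leNgt; apply/negP => H.
(* The slope k lies above C by half of the supposed deficit per unit of time. Then w + k s is not
   minimal at 0, and at a later minimum the curvature would be at least k. *)
pose k := C + (w 0 z - C * delta - w delta z) / (2 * delta).
have k_gap : (k - C) * delta = (w 0 z - C * delta - w delta z) / 2.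
  by rewrite /k; field; rewrite gt_eqF.
have kC : C < k by rewrite /k ltrDl divr_gt0 ?subr_gt0// mulr_gt0.
have sub : `[0, delta] `<=` `[0, T].
  by move=> s; rewrite /= !in_itv /= => /andP[-> /le_trans]; apply; exact: ltW.
have cf : {within `[0, delta], continuous (fun s => w s z + k * s)}.
  apply/subspace_continuousP => s sd; apply: cvgD.
    have cw : {within `[0, T], continuous (fun s => w s z)}.
      by apply/subspace_continuousP => s' s'T; exact: flow_time_continuous.
    by have := continuous_subspaceW sub cw => /subspace_continuousP/(_ s sd).
  apply: cvg_within_filter; apply: cvgM; [exact: cvg_cst|exact: cvg_id].
have [t1 t1d Hmin] := EVT_min (ltW d0) cf.
have d_in : delta \in `[0, delta] by rewrite in_itv /= (ltW d0) lexx.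
move: t1d; rewrite in_itv /= => /andP[t10 t1d].
have t1_gt0 : 0 < t1.
  rewrite lt_neqAle t10 andbT; apply/eqP => t1_0.
  by have := Hmin delta d_in; rewrite -t1_0 mulr0 addr0; move: k_gap; lra.
have t1T : 0 < t1 <= T by rewrite t1_gt0 (le_trans t1d (ltW dT)).
have db : is_derive t1 1 (fun s => - k * s) (- k).
  have := is_deriveZ (- k) (is_derive_id t1 (1 : R)).
  by move=> /is_derive_eq; apply; rewrite /GRing.scale /= mulr1.
have := left_derivative_compare t1_gt0 (is_derive_left_derivative 0 db)
  (flow_left_derivative flow t1T dz).
move=> /(_ _) H2; have {}H2 : - gauss_curvature (w t1) z <= - k.
  apply: H2 => s /andP[s0 st].
  have := Hmin s; rewrite in_itv /= s0 (le_trans (ltW st) t1d) => /(_ isT).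
  by lra.
have := KC t1 z _ dz; rewrite in_itv /= t10 (le_trans t1d (ltW dT)) => /(_ isT).
by lra.
Qed.

(* At a positive maximum [m] of [e^(-2Ct) (v - w) - (eta + eps (hyp + B t))] the
   function [v - w] is touched from above by [e^(2Ct) (m + eta + eps (hyp + B t))]. *)
Lemma flow_comparison T v w (C a A delta t : R) z :
  ricci_flow T v -> ricci_flow T w -> 0 <= C ->
  (forall (t : R) z, t \in `[0, T] -> disc z -> gauss_curvature (w t) z <= C) ->
  (forall (t : R) z, t \in `[0, T] -> disc z -> v t z <= hyp z + a) ->
  0 < delta < T ->
  (forall (t : R) z, t \in `[delta, T] -> disc z -> expR (2 * (hyp z - w t z)) <= A) ->
  (forall z, disc z -> v 0 z = w 0 z) ->
  0 <= t <= T - delta -> disc z ->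
  v t z - w (t + delta) z <= expR (2 * C * t) * (C * delta).
Proof.
move=> flv flw C0 KC va /andP[d0 dT] wA init t0T dz.
(* eta bounds the initial gap v(0) - w(delta), lam absorbs the reaction term, and B = A + 1 beats
   the Laplacian of eps hyp. *)
pose eta := C * delta; pose lam := 2 * C; pose B := A + 1; pose T' := T - delta.
have eta0 : 0 <= eta by rewrite mulr_ge0// ltW.
have inT (s : R) : 0 <= s <= T' -> s \in `[0, T] /\ (s + delta) \in `[delta, T].
  by rewrite /T' !in_itv /= => /andP[s0 sT]; split; apply/andP; split; lra.
have inT2 (s : R) : s \in `[delta, T] -> s \in `[0, T].
  by rewrite !in_itv /= => /andP[s0 sT]; apply/andP; split; lra.
have A0 : 0 < A.
  have [_ tdT] := inT t t0T.
  exact: lt_le_trans (expR_gt0 _) (wA _ z tdT dz).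
(* Both v - hyp and hyp - w are bounded above, by a and by ln A / 2. *)
pose c' := `|a| + `|ln A|.
have c'0 : 0 <= c' by rewrite addr_ge0.
have Dle (s : R) x : 0 <= s <= T' -> disc x -> v s x - w (s + delta) x <= c'.
  move=> /inT[sT sdT] dx; have h1 := va s x sT dx; have := wA _ x sdT dx.
  rewrite -[leRHS]lnK ?posrE// ler_expR => h2; rewrite /c'.
  by have := ler_norm a; have := ler_norm (ln A); have := normr_ge0 (ln A); lra.
suff main (eps : R) : 0 < eps ->
    expR (- (lam * t)) * (v t z - w (t + delta) z) <= eta + eps * (hyp z + B * t).
  have key : expR (- (lam * t)) * (v t z - w (t + delta) z) <= eta.
    apply/ler_addgt0Pr => e e0.
    have h0 : 0 < hyp z + B * t + 1.
      have := hyp_ge0 dz; case/andP: t0T => t0 _.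
      have : 0 <= B * t by rewrite mulr_ge0// /B; lra.
      by lra.
    apply: (le_trans (main (e / (hyp z + B * t + 1)) _)); first by rewrite divr_gt0.
    rewrite lerD2l mulrAC ler_pdivrMr// ler_wpM2l ?(ltW e0)//; lra.
  rewrite -(ler_pM2l (expR_gt0 (- (lam * t)))); apply: le_trans key _.
  by rewrite [leRHS]mulrA -expRD addNr expR0 mul1r.
move=> eps0.
pose Q (p : R * (R * R)) :=
  expR (- (lam * p.1)) * (v p.1 p.2 - w (p.1 + delta) p.2) -
  (eta + eps * (hyp p.2 + B * p.1)).
rewrite -subr_le0 -/(Q (t, z)) leNgt; apply/negP => Qtz.
(* For |z|^2 >= s the penalty eps hyp is at least c', the upper bound of v - w, so a positive
   maximum of Q lies strictly inside. *)
pose s := Num.max (nsq z) (1 - expR (- (c' / eps))).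
have s1 : s < 1 by rewrite gt_max; apply/andP; split => //; rewrite ltrBlDr ltrDl expR_gt0.
have zs : nsq z <= s by rewrite le_max lexx.
have cQ : {within `[0, T'] `*` subdisc s, continuous Q}.
  apply/subspace_continuousP => p pS; have [/=] := pS; rewrite in_itv /= => /andP[p0 pT] ps.
  have c1 : (fun p : R * (R * R) => p.1) @ p --> p.1 by exact: cvg_fst.
  have c2 : (fun p : R * (R * R) => p.2) @ p --> p.2 by exact: cvg_snd.
  have c3 : {for p.2, continuous (hypr (1 : R))} by apply: continuous_hypr; exact: subdisc_disc ps.
  have c4 : (fun p : R * (R * R) => - (lam * p.1)) @ p --> - (lam * p.1).
    by apply: cvgN; apply: cvgM; [exact: cvg_cst|exact: c1].
  apply: cvgB.
    apply: cvgM.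
      apply: cvg_within_filter.
      exact: (@cvg_comp _ _ _ _ (@expR R) _ _ _ c4 (@continuous_expR R _)).
    apply: cvgB; last first.
      have := shift_flow_continuous flw (ltW d0) s1.
      by move=> /subspace_continuousP/(_ p pS).
    have sub : `[0, T'] `*` subdisc s `<=` `[0, T] `*` disc.
      move=> q [/= qT qs]; split; last exact: subdisc_disc qs.
      by move: qT; rewrite /= in_itv /= => /inT[].
    have := continuous_subspaceW sub (flow_continuous flv).
    by move=> /subspace_continuousP/(_ p pS).
  apply: cvg_within_filter; apply: cvgD; first exact: cvg_cst.
  apply: cvgM; first exact: cvg_cst.
  apply: cvgD; first exact: (@cvg_comp _ _ _ _ (hypr (1 : R)) _ _ _ c2 c3).
  by apply: cvgM; [exact: cvg_cst|exact: c1].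
have [|[t1 z1]] := compact_EVT_max _ (compact_cylinder (T := T') (ltW s1)) cQ.
  by exists (t, z); split => //=; rewrite in_itv.
rewrite inE => -[/= t1T z1s] Hc.
have HQ (s' : R) x : 0 <= s' <= T' -> nsq x <= s -> Q (s', x) <= Q (t1, z1).
  by move=> sT xs; apply: Hc; rewrite inE; split => //=; rewrite in_itv.
have Qpos : 0 < Q (t1, z1) by exact: lt_le_trans Qtz (HQ t z t0T zs).
have t1T' : 0 <= t1 <= T' by move: t1T; rewrite /= in_itv.
have /andP[t10 t1T2] := t1T'.
have dz1 : disc z1 by exact: subdisc_disc z1s.
have hyp0 := hyp_ge0 dz1.
have Bt0 : 0 <= B * t1 by rewrite mulr_ge0// /B; lra.
set D := v t1 z1 - w (t1 + delta) z1.
have QE : Q (t1, z1) = expR (- (lam * t1)) * D - (eta + eps * (hyp z1 + B * t1)) by [].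
have epsh : 0 <= eps * (hyp z1 + B * t1) by rewrite mulr_ge0 ?(ltW eps0)// addr_ge0.
have Dpos : 0 < D.
  have : 0 < expR (- (lam * t1)) * D by move: Qpos; rewrite QE; lra.
  by rewrite pmulr_rgt0 ?expR_gt0.
have e_le1 : expR (- (lam * t1)) <= 1.
  by rewrite -expR0 ler_expR oppr_le0 mulr_ge0// /lam mulr_ge0.
have z1s' : nsq z1 < s.
  rewrite lt_max; apply/orP; right.
  have h1 : eps * hyp z1 < c'.
    have h2 : expR (- (lam * t1)) * D <= 1 * c'.
      by apply: ler_pM; rewrite ?expR_ge0 ?(ltW Dpos)//; exact: Dle.
    have h3 : 0 <= eps * (B * t1) by rewrite mulr_ge0// ltW.
    have h5 : eps * (hyp z1 + B * t1) = eps * hyp z1 + eps * (B * t1) by rewrite mulrDr.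
    move: Qpos h2 h3; rewrite QE h5 mul1r.
    move: (expR _ * D) (eps * (B * t1)) (eps * hyp z1) => x y u; lra.
  have h4 : hyp z1 < c' / eps by rewrite ltr_pdivlMr// mulrC.
  have n1 : 0 < 1 - nsq z1 by rewrite subr_gt0; exact: dz1.
  have : expR (- (c' / eps)) < 1 - nsq z1.
    rewrite -[ltRHS]lnK ?posrE// ltr_expR.
    have : 0 <= ln (4 * 1) :> R by rewrite ln_ge0//; lra.
    by move: h4; rewrite /hypr; lra.
  by lra.
have t1_gt0 : 0 < t1.
  rewrite lt_neqAle t10 andbT; apply/eqP => t1_0.
  have := flow_increment_ge flw KC (introT andP (conj d0 dT)) dz1.
  rewrite -(init _ dz1); move: Qpos; rewrite /Q /= -t1_0 !mulr0 oppr0 expR0 mul1r !addr0 add0r.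
  have : 0 <= eps * hyp z1 by rewrite mulr_ge0// ltW.
  by rewrite /eta; lra.
have [t1in t1din] := inT t1 t1T'.
have t1din' := inT2 _ t1din.
pose lv := laplacian (v t1) z1; pose lw := laplacian (w (t1 + delta)) z1.
have space : lv <= lw + eps * (expR (lam * t1) * expR (2 * hyp z1)).
  have L1 := laplace_atB (C2disc_laplace_at (flow_C2disc flv t1in) dz1)
    (C2disc_laplace_at (flow_C2disc flw t1din') dz1).
  have L2 := laplace_atB (laplace_atZ (expR (- (lam * t1))) L1)
    (laplace_atZ eps (laplace_at_hypr ltr01 (dz1 : nsq z1 < 1))).
  have H : expR (- (lam * t1)) * (lv - lw) - eps * expR (2 * hyp z1) <= 0.
    apply: (laplace_at_max L2); near=> x.
    have xs : nsq x <= s by apply: ltW; near: x; exact: near_nsq_lt.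
    by have := HQ t1 x t1T' xs; rewrite /Q /=; lra.
  rewrite addrC -lerBlDr -(ler_pM2l (expR_gt0 (- (lam * t1)))).
  rewrite subr_le0 in H; apply: le_trans H _.
  rewrite mulrCA [expR (- _) * _]mulrA -expRD addNr expR0 mul1r.
  by [].
set m := Q (t1, z1) in HQ Qpos QE.
pose b s := expR (lam * s) * (m + eta + eps * (hyp z1 + B * s)).
have bt1 : b t1 = D.
  have -> : D = expR (lam * t1) * (expR (- (lam * t1)) * D).
    by rewrite mulrA -expRD addrN expR0 mul1r.
  by rewrite /b; congr (_ * _); rewrite QE; ring.
have db : is_derive t1 1 b (lam * D + expR (lam * t1) * (eps * B)).
  have d1 : is_derive t1 1 (fun s => expR (lam * s + 0)) (lam * expR (lam * t1 + 0)).
    by apply: is_derive_affine; exact: is_derive_expR.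
  have d2 : is_derive t1 1 (fun s => (m + eta + eps * hyp z1) + (eps * B) * s) (eps * B).
    have := is_deriveD (is_derive_cst (m + eta + eps * hyp z1) t1 (1 : R))
      (is_deriveZ (eps * B) (is_derive_id t1 (1 : R))).
    by move=> /is_derive_eq; apply; rewrite /GRing.scale /= add0r mulr1.
  have := is_deriveM d1 d2.
  rewrite (_ : _ * _ = b); last first.
    by apply/funext => x; rewrite !fctE /= /b addr0; ring.
  move=> /is_derive_eq; apply; rewrite /GRing.scale /= -bt1 /b !addr0; ring.
have lvd : left_derivative (fun s => v s z1) 0 t1 (- gauss_curvature (v t1) z1).
  apply: (flow_left_derivative flv) => //; apply/andP; split=> //.
  by move: t1T2; rewrite /T'; lra.
have lwd : left_derivative (fun s => w (s + delta) z1) 0 t1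
    (- gauss_curvature (w (t1 + delta)) z1).
  apply: (@left_derivative_shift R (fun s => w s z1) 0 delta t1 _ (ltW d0)).
  apply: (flow_left_derivative flw) => //.
  by move: t1T2; rewrite /T' => ?; apply/andP; split; lra.
have := left_derivative_compare t1_gt0 (left_derivativeB lvd lwd)
  (is_derive_left_derivative 0 db).
move=> /(_ _) H.
have {}H : lam * D + expR (lam * t1) * (eps * B) <=
    - gauss_curvature (v t1) z1 - - gauss_curvature (w (t1 + delta)) z1.
  apply: H => s' /andP[s'0 s't].
  rewrite bt1 -/D subrr subr_le0.
  have s'T : 0 <= s' <= T' by rewrite s'0 /= (le_trans (ltW s't)).
  have := HQ s' z1 s'T z1s; rewrite /Q /= lerBlDr addrA => h.
  rewrite -(ler_pM2l (expR_gt0 (- (lam * s')))); apply: le_trans h _.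
  by rewrite /b mulrA -expRD addNr expR0 mul1r.
have Kw := KC _ z1 t1din' dz1.
set kw := gauss_curvature (w (t1 + delta)) z1 in H Kw.
have kwE : kw = - expR (- (2 * w (t1 + delta) z1)) * lw by [].
have Kv : - gauss_curvature (v t1) z1 <=
    - (expR (- (2 * D)) * kw) + eps * (expR (lam * t1) * A).
  rewrite /gauss_curvature mulNr opprK -/lv.
  apply: (@le_trans _ _ (expR (- (2 * v t1 z1)) *
      (lw + eps * (expR (lam * t1) * expR (2 * hyp z1))))).
    by rewrite ler_wpM2l ?expR_ge0.
  rewrite mulrDr; apply: lerD.
    rewrite kwE mulNr mulrN opprK mulrA -expRD le_eqVlt; apply/orP; left; apply/eqP.
    by congr (expR _ * _); rewrite /D; ring.
  rewrite mulrCA ler_wpM2l ?(ltW eps0)// mulrCA ler_wpM2l ?expR_ge0// -expRD.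
  apply: le_trans (wA _ z1 t1din dz1); rewrite ler_expR.
  by move: Dpos; rewrite /D; lra.
have h1 := expR_ge1Dx (- (2 * D)).
have h2 : expR (- (2 * D)) <= 1 by rewrite -[leRHS]expR0 ler_expR; lra.
(* Uses 1 - e^(-2D) <= 2D, with D > 0 and C >= 0. This matches lam D exactly, and the contradiction
   comes from B > A. *)
have h3 : (1 - expR (- (2 * D))) * kw <= 2 * D * C.
  apply: (@le_trans _ _ ((1 - expR (- (2 * D))) * C)).
    by rewrite ler_wpM2l// subr_ge0.
  by rewrite ler_wpM2r//; lra.
have h4 : lam * D + expR (lam * t1) * (eps * B) <= 2 * D * C + eps * (expR (lam * t1) * A).
  by move: H Kv; lra.
have h5 : 0 < eps * expR (lam * t1) by rewrite mulr_gt0// expR_gt0.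
by move: h4; rewrite /B /lam; lra.
Unshelve. all: by end_near. Qed.

End Comparison.

(** * Uniqueness *)
Section Uniqueness.
Context {R : realType}.
Implicit Types (u : R * R -> R) (v w : R -> R * R -> R) (z : R * R) (T : R).

Lemma flow_time_modulus T v (t : R) z (e : R) : ricci_flow T v -> t \in `[0, T] ->
  disc z -> 0 < e ->
  exists2 d : R, 0 < d & forall s, s \in `[0, T] -> `|t - s| < d -> `|v t z - v s z| <= e.
Proof.
move=> flow tT dz e0; have := flow_time_continuous flow tT dz.
move=> /cvgrPdist_le/(_ e e0)/nbhs_ballP[d /= d0 H]; exists d => // s sT ts.
exact: (H s ts sT).
Qed.

Lemma curvature_laplacian u z (C : R) : - C <= gauss_curvature u z ->
  laplacian u z <= C * expR (2 * u z).
Proof.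
rewrite /gauss_curvature mulNr lerN2 => h.
rewrite -(ler_pM2l (expR_gt0 (- (2 * u z)))) mulrCA -expRD addNr expR0 mulr1.
exact: h.
Qed.

(** Initial data agree only on the disc; as it is open, their derivatives there agree too. *)
Lemma eq_gauss_curvature u u' z : (forall x, disc x -> u x = u' x) -> disc z ->
  gauss_curvature u z = gauss_curvature u' z.
Proof.
move=> uu' dz; have near_eq : \forall x \near z, u x = u' x.
  have nd : nbhs z disc by apply: open_nbhs_nbhs; split=> //; exact: open_disc.
  by apply: filterS nd.
have D2 (V V' : R * R) : 'D_V' ('D_V u) z = 'D_V' ('D_V u') z.
  by apply: near_eq_derive; exact: near_eq_near_derive near_eq.
have L : laplacian u z = laplacian u' z :=
  congr2 (fun a b : R => a + b) (D2 (1, 0) (1, 0)) (D2 (0, 1) (0, 1)).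
by rewrite /gauss_curvature L (uu' z dz).
Qed.

(** Here delta -> 0, and w (t + delta) tends to w t. The restriction t < T leaves room for the
    shift. *)
Lemma admissible_le T v w (t : R) z : admissible T v -> admissible T w ->
  (forall z, disc z -> v 0 z = w 0 z) ->
  (forall z, disc z -> gauss_curvature (v 0) z <= -1) ->
  0 <= t < T -> disc z -> v t z <= w t z.
Proof.
move=> [flv _ _ _] [flw wcompl [C0 wC] wlow] vw K0 /andP[t0 tT] dz.
pose C := Num.max C0 0.
have Cge0 : 0 <= C by rewrite le_max lexx orbT.
have wC' (s : R) x : s \in `[0, T] -> disc x -> gauss_curvature (w s) x <= C.
  by move=> sT dx; rewrite (le_trans (wC s x sT dx))// le_max lexx.
have tin : t \in `[0, T] by rewrite in_itv /= t0 ltW.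
apply/ler_addgt0Pr => e e0; have e20 : 0 < e / 2 by lra.
have [d d0 Hd] := flow_time_modulus flw tin dz e20.
pose k := expR (2 * C * t) * C + 1.
have k0 : 0 < k by rewrite ltr_wpDl// mulr_ge0 ?expR_ge0.
have [delta [delta0 deltad deltat deltak]] :
    exists delta, [/\ 0 < delta, delta < d, delta < T - t & k * delta <= e / 2].
  pose m := Num.min (Num.min d (T - t)) (e / 2 / k).
  have m0 : 0 < m by rewrite !lt_min d0 subr_gt0 tT divr_gt0.
  have md : m <= d by rewrite !ge_min lexx.
  have mt : m <= T - t by rewrite !ge_min lexx orbT.
  have mk : m <= e / 2 / k by rewrite !ge_min lexx !orbT.
  exists (m / 2); split; [lra|lra|lra|].
  by rewrite mulrC -ler_pdivlMr//; lra.
have dT : 0 < delta < T by apply/andP; split; lra.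
have delta_in : delta \in `]0, T] by rewrite in_itv /=; apply/andP; split; lra.
have [C1 HC1] := wlow delta delta_in.
have schwarz (s : R) x : s \in `[delta, T] -> disc x ->
    expR (2 * (hyp x - w s x)) <= 92 + 3 * Num.max C1 0.
  move=> sT dx; have /andP[ds sT'] : delta <= s <= T by move: sT; rewrite in_itv.
  have sin : s \in `[0, T] by rewrite in_itv /= sT' andbT; lra.
  apply: (schwarz_yau (flow_C2disc flw sin)) => //.
  - by apply: wcompl; rewrite in_itv /= sT' andbT; lra.
  - by rewrite le_max lexx orbT.
  - move=> y dy; apply: curvature_laplacian; apply: le_trans (HC1 s y sT dy).
    by rewrite lerN2 le_max lexx.
(* [C1] depends on [delta], but it enters only through the constant [A] of [flow_comparison], which
   is absent from the conclusion. *)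
have := flow_comparison flv flw Cge0 wC'
  (fun s x sT dx => flow_le_hyp flv K0 sT dx) dT schwarz vw _ dz.
move=> /(_ t) H; have {}H : v t z - w (t + delta) z <= expR (2 * C * t) * (C * delta).
  by apply: H; rewrite t0 /=; lra.
have tdin : t + delta \in `[0, T] by rewrite in_itv /=; apply/andP; split; lra.
have := Hd (t + delta) tdin; rewrite opprD addrA subrr add0r normrN gtr0_norm//.
move=> /(_ deltad); rewrite ler_norml => /andP[h _].
have : expR (2 * C * t) * (C * delta) <= k * delta.
  by rewrite mulrA ler_wpM2r ?(ltW delta0)// /k lerDl.
by lra.
Qed.

End Uniqueness.

Unset Implicit Arguments.

Theorem theorem4p1 (R : realType) (u0 : R * R -> R) (T : R)
  (v vhat : R -> R * R -> R)
  (u0_smooth : smooth_on disc u0)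
  (u0_curv : forall z, disc z -> gauss_curvature u0 z <= -1)
  (T_gt0 : 0 < T)
  (v_adm : admissible T v)
  (v_init : forall z, disc z -> v 0 z = u0 z)
  (vhat_adm : admissible T vhat)
  (vhat_init : forall z, disc z -> vhat 0 z = u0 z) :
  forall (t : R) z, t \in `[0, T] -> disc z -> vhat t z = v t z.
Proof.
have K0 (f : R -> R * R -> R) : (forall z, disc z -> f 0 z = u0 z) ->
    forall z, disc z -> gauss_curvature (f 0) z <= -1.
  by move=> fu z dz; rewrite (eq_gauss_curvature fu dz) u0_curv.
have eq_lt (t : R) z : 0 <= t < T -> disc z -> vhat t z = v t z.
  have vvhat x (dx : disc x) : v 0 x = vhat 0 x by rewrite (v_init x dx) (vhat_init x dx).
  have vhatv x (dx : disc x) : vhat 0 x = v 0 x by rewrite (v_init x dx) (vhat_init x dx).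
  move=> tT dz; apply/le_anti/andP; split.
    exact: (admissible_le vhat_adm v_adm vhatv (K0 _ vhat_init) tT dz).
  exact: (admissible_le v_adm vhat_adm vvhat (K0 _ v_init) tT dz).
move=> t z tT dz; have /andP[t0 tT'] : 0 <= t <= T by move: tT; rewrite in_itv.
have [tlt|Tt] := ltP t T; first by apply: (eq_lt t z _ dz); rewrite t0 tlt.
(* At t = T no later time is left for the shift; equality is inherited from earlier times by
   continuity. *)
apply/eqP; rewrite -subr_eq0 -normr_le0; apply/ler_addgt0Pr => e e0; rewrite add0r.
have e20 : 0 < e / 2 by lra.
have [flv _ _ _] := v_adm; have [flvhat _ _ _] := vhat_adm.
have [d d0 Hd] := flow_time_modulus flv tT dz e20.
have [d' d'0 Hd'] := flow_time_modulus flvhat tT dz e20.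
pose m := Num.min (Num.min d d') T / 2.
have m0 : 0 < m by rewrite divr_gt0// !lt_min d0 d'0.
have md : m < d by rewrite ltr_pdivrMr// !gt_min; apply/orP; left; apply/orP; left; lra.
have md' : m < d' by rewrite ltr_pdivrMr// !gt_min; apply/orP; left; apply/orP; right; lra.
have mT : m < T by rewrite ltr_pdivrMr// !gt_min; apply/orP; right; lra.
have sin : t - m \in `[0, T] by rewrite in_itv /=; apply/andP; split; lra.
have tm : `|t - (t - m)| = m by rewrite opprB addrC subrK gtr0_norm.
have := Hd _ sin; rewrite tm => /(_ md) h.
have := Hd' _ sin; rewrite tm => /(_ md') h'.
have tmT : 0 <= t - m < T by apply/andP; split; lra.
have E := eq_lt (t - m) z tmT dz.
move: h h'; rewrite E !ler_norml => /andP[? ?] /andP[? ?]; apply/andP; split; lra.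
Qed.
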